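(* Let $K\in\{-1,0,1\}$ and let $\Omega\subset\mathbb N^n(K)$ be a smooth domain which is star-shaped with respect to the origin, i.e. $\Gamma:=\partial\Omega$ is the graph of a radial function $\rho:\mathbb S^{n-1}\to\mathbb R$, $$\Gamma=\{(z,\rho(z)): z\in\mathbb S^{n-1}\}.$$ Then the function $$\mathfrak b(z,r):=\frac{\phi(r-\rho(z))}{\phi(\rho(z))},\qquad (z,r)\in\mathbb N^n(K),$$ is a regularized distance for $\Omega$. Moreover, for any $(z,r)\in\mathbb N^n(K)\setminus\{0\}$, in the adapted orthonormal frame $\{\tau_1,\dots,\tau_{n-1},\tau_r\}$ at $(z,r)$ (described in the context), the matrix of the Hessian $\bar\nabla^2\mathfrak b$ is $$\mathrm{Hessian}(\mathfrak b)=\begin{pmatrix}\frac{w^3}{\phi(r)}a_{11}&\frac{w^2}{\phi(r)}a_{12}&\cdots&\frac{w^2}{\phi(r)}a_{1\,n-1}&0\\ \frac{w^2}{\phi(r)}a_{12}&\frac{w}{\phi(r)}a_{22}&\cdots&0&0\\ \vdots&\vdots&\ddots&\vdots&\vdots\\ \frac{w^2}{\phi(r)}a_{1\,n-1}&0&\cdots&\frac{w}{\phi(r)}a_{n-1\,n-1}&0\\ 0&0&\cdots&0&0\end{pmatrix}-K\,\mathfrak b\,I_n,$$ where $I_n$ is the $n\times n$ identity matrix, $w=\sqrt{1+\frac{|\nabla'\rho|^2}{\phi^2(\rho)}}$ (evaluated at $z$), and the eigenvalues $(\kappa_1,\dots,\kappa_{n-1})$ of the symmetric matrix $(a_{ij})_{1\le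 i,j\le n-1}$ are the principal curvatures of $\Gamma$ at $(z,\rho(z))$.
   Context: Space forms. $\mathbb N^n(K)$ is the space form of constant sectional curvature $K\in\{-1,0,1\}$, modelled in polar coordinates $(z,r)$, $z\in\mathbb S^{n-1}$ (unit sphere, with standard metric $dz^2$), $r\in[0,a)$, with metric $g^{\mathbb N}=dr^2+\phi^2(r)\,dz^2$, where $\phi(r)=r$, $a=\infty$ for $K=0$ ($\mathbb R^n$); $\phi(r)=\sin r$, $a=\pi$ for $K=1$ ($\mathbb S^n$); $\phi(r)=\sinh r$, $a=\infty$ for $K=-1$ ($\mathbb H^n$). The origin $0$ is the point $r=0$. The same formula defines $\phi$ at negative arguments; $\dot\phi$ denotes its derivative. $\bar\nabla$ is the Levi-Civita connection and $\bar\nabla^2f$ the Hessian of $f$ on $\mathbb N^n(K)$; $\nabla'$ is covariant differentiation on $\mathbb S^{n-1}$ with respect to $dz^2$. Regularized distance. Let $\Omega\subset\mathbb N^n(K)$ be a smooth, compact domain containing the origin as an interior point and with nonempty boundary. The signed distance to $\partial\Omega$ is $d(x)=-\mathrm{dist}(x,\partial\Omega)$ for $x\in\Omega$ and $d(x)=\mathrm{dist}(x,\partial\Omega)$ for $x\notin\Omega$. A function $\vartheta$ is a regularized distance for $\Omega$ if $\vartheta\in C^2(\mathbb N^n(K)\setminus\{0\})\cap C^{0,1}(\mathbb N^n(K))$ and the ratios $\vartheta(x)/d(x)$ and $d(x)/\vartheta(x)$ are positive and uniformly bounded from above for all $x\in\mathbb N^n(K)\setminus\partial\Omega$. Adapted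 frame and $(a_{ij})$. Given $z$, choose normal coordinates of $\mathbb S^{n-1}$ centered at $z$ with coordinate vectors $e_1,\dots,e_{n-1}$ (orthonormal at $z$) such that at $z$: $\rho_1=|\nabla'\rho|$, $\rho_\alpha=0$ for $2\le\alpha\le n-1$, and $(\rho_{\alpha\beta})_{2\le\alpha,\beta\le n-1}$ is diagonal, where $\rho_i=e_i\rho$ and $\rho_{ij}=\nabla'_{ij}\rho$. The frame at $(z,r)$ is $\tau_a=e_a/\phi(r)$ for $1\le a\le n-1$, and $\tau_r=\partial/\partial r$. Set $a_{ij}=\sum_{k,l}\gamma^{ik}h_{kl}\gamma^{lj}$, evaluated at $z$, with $$\gamma^{ij}=\frac1{\phi(\rho)}\Big(\delta_{ij}-\frac{\rho_i\rho_j}{\phi^2(\rho)w(1+w)}\Big),\qquad h_{ij}=\frac{\phi(\rho)}{\sqrt{\phi^2(\rho)+|\nabla'\rho|^2}}\Big(-\nabla'_{ij}\rho+\frac{2\dot\phi(\rho)}{\phi(\rho)}\rho_i\rho_j+\phi(\rho)\dot\phi(\rho)\delta_{ij}\Big).$$ Here $h_{ij}$ is the second fundamental form of $\Gamma$, with the sign for which small geodesic spheres about the origin have positive principal curvatures.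
   Formalization: For K=-1 the global claim fails (b grows exponentially in r, d linearly), so there the Lipschitz bound and the upper bound of b/d are asserted only on each ball r ≤ r0, with constants depending on r0; all else is global. *)

(* Defs.v *)
From HB Require Import structures.
From mathcomp Require Import all_boot all_order all_algebra.
From mathcomp Require Import all_classical all_reals all_analysis.

Set Implicit Arguments.
Unset Strict Implicit.
Unset Printing Implicit Defensive.

Import Order.TTheory GRing.Theory Num.Theory.
Import numFieldNormedType.Exports.

Local Open Scope classical_set_scope.
Local Open Scope ring_scope.

(* The ambient norm of 'rV[R]_n in the library is the sup norm, hence the
   explicit Euclidean product and norm. *)
Definition dotp (R : realType) (n : nat) (u v : 'rV[R]_n) : R :=
  \sum_i u 0 i * v 0 i.

Definition enorm (R : realType) (n : nat) (u : 'rV[R]_n) : R :=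
  Num.sqrt (dotp u u).

Definition pd (R : realType) (n : nat) (i : 'I_n) (f : 'rV[R]_n -> R)
  (x : 'rV[R]_n) : R := derive f x (delta_mx 0 i).

(* iterated partial derivative; the last index of s is differentiated first *)
Definition pds (R : realType) (n : nat) (s : seq 'I_n) (f : 'rV[R]_n -> R) :
  'rV[R]_n -> R := foldr (@pd R n) f s.

(* to be used with U open *)
Definition Ck (R : realType) (n : nat) (k : nat) (U : set 'rV[R]_n)
    (f : 'rV[R]_n -> R) : Prop :=
  forall x, U x ->
    (forall s : seq 'I_n, (size s <= k)%N -> {for x, continuous (pds s f)}) /\
    (forall (s : seq 'I_n) (i : 'I_n), (size s < k)%N ->
       derivable (pds s f) x (delta_mx 0 i)).

(* Riemannian geometry in one coordinate chart of dimension n: a metric is a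
   matrix-valued function of the coordinates, tangent vectors are row vectors
   of components with respect to the coordinate vector fields. *)
Section Chart.
Variables (R : realType) (n : nat) (g : 'rV[R]_n -> 'M[R]_n).

Definition inner (x u v : 'rV[R]_n) : R := (u *m g x *m v^T) 0 0.

(* Christoffel symbol Gamma^k_{ij} of the Levi-Civita connection *)
Definition christoffel (x : 'rV[R]_n) (k i j : 'I_n) : R :=
  2^-1 * \sum_l invmx (g x) k l *
    (pd i (fun y => g y j l) x + pd j (fun y => g y i l) x
     - pd l (fun y => g y i j) x).

(* components of the covariant Hessian in the coordinate basis *)
Definition hessian (f : 'rV[R]_n -> R) (x : 'rV[R]_n) : 'M[R]_n :=
  \matrix_(i, j) (pd i (pd j f) x - \sum_k christoffel x k i j * pd k f x).

Definition curve_length (c : R -> 'rV[R]_n) : R :=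
  Rintegral lebesgue_measure `[0, 1]%classic
    (fun t => Num.sqrt (inner (c t) (derive1 c t) (derive1 c t))).

(* C^1 curves with possibly vanishing velocity, parametrized by [0, 1]
   (a C^1 curve on [0, 1] always extends to the line).  Reparametrizing by
   slowing down at corners, these give the same infimum of lengths as
   piecewise C^1 curves. *)
Definition curve_from_to (U : set 'rV[R]_n) (x y : 'rV[R]_n)
    (c : R -> 'rV[R]_n) : Prop :=
  [/\ forall t, derivable c t 1, continuous (derive1 c),
      forall t, 0 <= t <= 1 -> U (c t), c 0 = x & c 1 = y].

Definition rdist (U : set 'rV[R]_n) (x y : 'rV[R]_n) : R :=
  inf [set l | exists2 c, curve_from_to U x y c & l = curve_length c].

Definition rdist_set (U A : set 'rV[R]_n) (x : 'rV[R]_n) : R :=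
  inf [set rdist U x y | y in A].

Section Hypersurface.
(* X is a local parametrization of a hypersurface when n = m + 1 *)
Variables (m : nat) (X : 'rV[R]_m -> 'rV[R]_n).

Definition coord_vec (a : 'I_m) (y : 'rV[R]_m) : 'rV[R]_n :=
  \row_k pd a (fun y' => X y' 0 k) y.

(* covariant derivative, along the a-th coordinate curve, of the b-th
   coordinate vector field *)
Definition cov_coord_vec (a b : 'I_m) (y : 'rV[R]_m) : 'rV[R]_n :=
  \row_k (pd a (fun y' => coord_vec b y' 0 k) y
          + \sum_i \sum_j christoffel (X y) k i j
              * coord_vec a y 0 i * coord_vec b y 0 j).

Definition is_unit_normal (y : 'rV[R]_m) (nu : 'rV[R]_n) : Prop :=
  inner (X y) nu nu = 1 /\ forall a, inner (X y) nu (coord_vec a y) = 0.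

Definition first_ff (y : 'rV[R]_m) : 'M[R]_m :=
  \matrix_(a, b) inner (X y) (coord_vec a y) (coord_vec b y).

(* With nu the outward normal, geodesic spheres are positively curved. *)
Definition second_ff (nu : 'rV[R]_n) (y : 'rV[R]_m) : 'M[R]_m :=
  \matrix_(a, b) - inner (X y) (cov_coord_vec a b y) nu.

Definition shape_operator (nu : 'rV[R]_n) (y : 'rV[R]_m) : 'M[R]_m :=
  invmx (first_ff y) *m second_ff nu y.

End Hypersurface.
End Chart.

(* kappa lists the eigenvalues of A with multiplicities *)
Definition eigenvalues_are (R : realType) (m : nat) (A : 'M[R]_m)
    (kappa : 'I_m -> R) : Prop :=
  char_poly A = \prod_i ('X - (kappa i)%:P).

(* Space forms.  The point with polar coordinates (z, r) is represented by
   r z in R^n, so that N^n(K) is the open ball of radius a with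
   a = +oo for K = 0, -1 and a = pi for K = 1; in the latter case the
   antipode of the origin is not part of the polar coordinate model. *)
Definition phi (R : realType) (K : int) (r : R) : R :=
  if K == 0 then r
  else if K == 1 then sin r
  else (expR r - expR (- r)) / 2.

Definition dphi (R : realType) (K : int) : R -> R := derive1 (@phi R K).

Definition in_radius (R : realType) (K : int) (r : R) : Prop :=
  K = 1 -> r < pi.

Definition space_form (R : realType) (K : int) (n : nat) : set 'rV[R]_n :=
  [set x | in_radius K (enorm x)].

Definition usphere (R : realType) (n : nat) : set 'rV[R]_n :=
  [set z | enorm z = 1].

(* The polar coordinate z of x.  At the origin z is arbitrary; a unit vector
   is selected there. *)
Definition dir (R : realType) (n : nat) (x : 'rV[R]_n.+1) : 'rV[R]_n.+1 :=
  if x == 0 then delta_mx 0 0 else (enorm x)^-1 *: x.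

(* dr^2 + phi(r)^2 dz^2 with r = |x| and z = x / |x|, i.e. dr(u) = <z, u> and
   dz(u) = (u - <z, u> z) / r; this extends smoothly to x = 0 by the Euclidean
   product. *)
Definition space_form_metric (R : realType) (K : int) (n : nat)
    (x : 'rV[R]_n.+1) : 'M[R]_n.+1 :=
  if x == 0 then 1%:M
  else (dir x)^T *m dir x
       + (phi K (enorm x) / enorm x) ^+ 2 *: (1%:M - (dir x)^T *m dir x).

Definition sf_dist (R : realType) (K : int) (n : nat) :
    'rV[R]_n.+1 -> 'rV[R]_n.+1 -> R :=
  rdist (@space_form_metric R K n) (@space_form R K n.+1).

Definition boundary (T : topologicalType) (A : set T) : set T :=
  closure A `\` interior A.

Definition signed_dist (R : realType) (K : int) (n : nat)
    (Omega : set 'rV[R]_n.+1) (x : 'rV[R]_n.+1) : R :=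
  let d := rdist_set (@space_form_metric R K n) (@space_form R K n.+1)
             (boundary Omega) x in
  if x \in Omega then - d else d.

Definition lipschitz_sf (R : realType) (K : int) (n : nat)
    (D : set 'rV[R]_n.+1) (theta : 'rV[R]_n.+1 -> R) : Prop :=
  exists L : R, forall x y, D x -> D y ->
    `|theta x - theta y| <= L * sf_dist K x y.

(* For D = N this is the notion of regularized distance on all of N.  A
   smaller D relaxes only the Lipschitz bound and the upper bound of theta / d:
   in hyperbolic space sinh(r - rho) / sinh(rho) grows exponentially in r while
   d grows linearly, so there these two bounds hold on bounded D only. *)
Definition regularized_distance_on (R : realType) (K : int) (n : nat)
    (D Omega : set 'rV[R]_n.+1) (theta : 'rV[R]_n.+1 -> R) : Prop :=
  let N := @space_form R K n.+1 in
  let d := signed_dist K Omega in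
  [/\ Ck 2 (N `\ 0) theta,
      lipschitz_sf K D theta,
      forall x, (N `\` boundary Omega) x -> 0 < theta x / d x /\ 0 < d x / theta x,
      exists C : R, forall x, (D `\` boundary Omega) x -> theta x / d x <= C
    & exists C : R, forall x, (N `\` boundary Omega) x -> d x / theta x <= C].

Definition regularized_distance (R : realType) (K : int) (n : nat)
    (Omega : set 'rV[R]_n.+1) (theta : 'rV[R]_n.+1 -> R) : Prop :=
  regularized_distance_on K (@space_form R K n.+1) Omega theta.

(* A function on the unit sphere of R^n is given by a function rho on R^n of
   which only the values at unit vectors are used. *)
Definition smooth_on_sphere (R : realType) (n : nat) (rho : 'rV[R]_n.+1 -> R) :
    Prop :=
  forall k, Ck k [set x | x != 0] (rho \o @dir R n).

Definition radial_graph (R : realType) (n : nat) (rho : 'rV[R]_n -> R) :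
    set 'rV[R]_n :=
  [set rho z *: z | z in @usphere R n].

(* Smoothness of the boundary is the smoothness of its radial function;
   Omega = {r <= rho(z)} follows from the listed properties. *)
Definition starshaped_domain (R : realType) (K : int) (n : nat)
    (Omega : set 'rV[R]_n.+1) (rho : 'rV[R]_n.+1 -> R) : Prop :=
  [/\ compact Omega /\ Omega `<=` @space_form R K n.+1,
      interior Omega 0,
      smooth_on_sphere rho,
      forall z, usphere z -> 0 < rho z /\ in_radius K (rho z)
    & boundary Omega = radial_graph rho].

Definition bfun (R : realType) (K : int) (n : nat) (rho : 'rV[R]_n.+1 -> R)
    (x : 'rV[R]_n.+1) : R :=
  phi K (enorm x - rho (dir x)) / phi K (rho (dir x)).

(* The sphere of dimension p.+1 in R^(p.+2); the rows of E are the vectors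
   e_1, ..., e_(p.+1), so that ord0 stands for the index 1. *)
Section Frame.
Variables (R : realType) (K : int) (p : nat) (rho : 'rV[R]_p.+2 -> R).
Variables (z : 'rV[R]_p.+2) (E : 'M[R]_(p.+1, p.+2)).

(* inverse of the normal coordinates centered at z: exp_z (y *m E) *)
Definition normal_param (y : 'rV[R]_p.+1) : 'rV[R]_p.+2 :=
  let v := y *m E in
  cos (enorm v) *: z + (sin (enorm v) / enorm v) *: v.

(* dz^2 in these coordinates *)
Definition sphere_metric (y : 'rV[R]_p.+1) : 'M[R]_p.+1 :=
  \matrix_(a, b) dotp (coord_vec normal_param a y) (coord_vec normal_param b y).

Definition rho_d (i : 'I_p.+1) : R := pd i (rho \o normal_param) 0.

Definition rho_dd : 'M[R]_p.+1 :=
  hessian sphere_metric (rho \o normal_param) 0.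

(* the e_i are orthonormal at z *)
Definition grad_norm : R := Num.sqrt (\sum_i rho_d i ^+ 2).

Definition adapted : Prop :=
  [/\ E *m E^T = 1%:M,
      E *m z^T = 0,
      rho_d ord0 = grad_norm,
      forall a, a != ord0 -> rho_d a = 0
    & forall a b, a != ord0 -> b != ord0 -> a != b -> rho_dd a b = 0].

Definition wfun : R := Num.sqrt (1 + grad_norm ^+ 2 / phi K (rho z) ^+ 2).

Definition gamma_mx : 'M[R]_p.+1 :=
  \matrix_(i, j) ((phi K (rho z))^-1 *
    ((i == j)%:R
     - rho_d i * rho_d j / (phi K (rho z) ^+ 2 * wfun * (1 + wfun)))).

Definition h_mx : 'M[R]_p.+1 :=
  \matrix_(i, j)
    (phi K (rho z) / Num.sqrt (phi K (rho z) ^+ 2 + grad_norm ^+ 2) *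
     (- rho_dd i j
      + 2 * dphi K (rho z) / phi K (rho z) * rho_d i * rho_d j
      + phi K (rho z) * dphi K (rho z) * (i == j)%:R)).

Definition a_mx : 'M[R]_p.+1 := gamma_mx *m h_mx *m gamma_mx.

(* Rows are tau_1, ..., tau_(p.+1), tau_r at the point r z: the tangent vector
   e_a of the sphere, at polar radius r, is the velocity r e_a of r z. *)
Definition frame (r : R) : 'M[R]_(p.+1 + 1, p.+2) :=
  col_mx ((phi K r)^-1 *: (r *: E)) z.

(* matrix in the frame of the Hessian of f at r z *)
Definition hessian_in_frame (f : 'rV[R]_p.+2 -> R) (r : R) :
    'M[R]_(p.+1 + 1) :=
  frame r *m hessian (@space_form_metric R K p.+1) f (r *: z) *m (frame r)^T.

Definition tangential_block (r : R) : 'M[R]_p.+1 :=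
  \matrix_(i, j)
    if (i == ord0) && (j == ord0) then wfun ^+ 3 / phi K r * a_mx ord0 ord0
    else if i == ord0 then wfun ^+ 2 / phi K r * a_mx ord0 j
    else if j == ord0 then wfun ^+ 2 / phi K r * a_mx ord0 i
    else if i == j then wfun / phi K r * a_mx i i
    else 0.

Definition graph_param (y : 'rV[R]_p.+1) : 'rV[R]_p.+2 :=
  rho (normal_param y) *: normal_param y.

(* principal curvatures of the radial graph at (z, rho(z)) with respect to
   the outward normal, i.e. the one with positive radial component *)
Definition principal_curvatures_are (kappa : 'I_p.+1 -> R) : Prop :=
  let g := @space_form_metric R K p.+1 in
  exists nu : 'rV[R]_p.+2,
    [/\ is_unit_normal g graph_param 0 nu,
        0 < inner g (rho z *: z) nu z
      & eigenvalues_are (shape_operator g graph_param nu 0) kappa].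

End Frame.

(* Main.v *)
Require Import Defs.
From HB Require Import structures.
From mathcomp Require Import all_boot all_order all_algebra.
From mathcomp Require Import all_classical all_reals all_analysis.
From mathcomp Require Import ring lra.
Import Order.TTheory GRing.Theory Num.Theory.
Import numFieldNormedType.Exports.
Local Open Scope classical_set_scope.
Local Open Scope ring_scope.

Set Implicit Arguments.
Unset Strict Implicit.
Unset Printing Implicit Defensive.

(** Write r = |x|, z = x / |x| and C(x) = phi'(rho(z)) / phi(rho(z)).  The subtraction
    formula for phi gives

      b(x) = phi(r) C(x) - phi'(r)        ([bfunE]),

    where C is homogeneous of degree 0; both halves of the theorem rest on this.

    The Hessian.  The second derivatives of b in Cartesian coordinates are explicit,
    the Christoffel symbols are obtained from Koszul's formula ([gamma_space_form]), and
    Euler's relations for C determine all derivatives of C in the direction z.  Hence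
    ([hessian_bfun]) the covariant Hessian has the value - K b on (z, z), vanishes on
    (z, u) with u orthogonal to z, and equals
    phi(r)/r^2 (D^2 C(u, v) + (C - K b phi(r)) <u, v>) on u, v orthogonal to z.  The
    frame vector tau_a is r/phi(r) e_a in Cartesian coordinates, so the tangential block
    is 1/phi(r) (D^2 C(e_i, e_j) + C delta_ij) - K b delta_ij.  As the derivative of
    phi'/phi is - 1/phi^2, the bracket is w/phi(rho)^2 h_ij ([tangential_blockE],
    [hessian_in_frameE]); in the adapted frame the matrix gamma is diagonal with entries
    1/(w phi(rho)), 1/phi(rho), ..., 1/phi(rho), and rewriting h through
    a = gamma h gamma yields the powers of w.  The derivatives rho_i and rho_ij
    are those of x |-> rho(x/|x|) in Cartesian coordinates: the sphere metric is flat to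
    first order at the center of normal coordinates, and the second derivatives of the
    coordinate map are radial, where Euler's relation kills the gradient.

    Principal curvatures.  The unit normal is explicit; the first fundamental form is
    phi^2 delta_ij + rho_i rho_j = (gamma^2)^-1 and the second one is h, so the shape
    operator gamma^2 h is conjugate, by gamma, to a = gamma h gamma.

    Comparison with the distance.  The derivative of b is bounded by a multiple of the
    Riemannian norm ([bfun_gradient]), so b changes along a curve by at most a multiple
    of its length ([increment_le_arc]).  This is the Lipschitz bound and, since b
    vanishes on the boundary, it bounds |b| by a multiple of the distance.  Conversely
    the distance is at most |r - rho(z)|, the length of a radial segment, which is at
    most a multiple of |b| because phi grows at least linearly ([gap_le_bfun]).  The
    signs agree because Omega is the set r <= rho(z): rays meet the boundary only once
    ([mem_inside], [not_mem_outside]). *)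

(** * Derivatives of functions of several variables *)

Section DirectionalDerivatives.
Variable R : realType.

(** Reduces directional derivatives to derivatives of one variable, where the chain rule
    and the mean value theorem can be used without differentiability in the Frechet sense. *)
Lemma is_derive_line (V W : normedModType R) (f : V -> W) (x v : V) (d : W) :
  is_derive x v f d <-> is_derive (0 : R) 1 (fun h : R => f (h *: v + x)) d.
Proof.
have E : 'D_v f x = 'D_1 (fun h : R => f (h *: v + x)) 0.
  rewrite /derive; apply: (f_equal (fun F : R -> W => lim (F @ (0 : R)^'))).
  by apply/funext => h /=; rewrite addr0 scale0r add0r [_%:A]mulr1.
split=> -[fd <-].
- by split; [exact: (derivable1P f x v).1 | rewrite E].
- by split; [exact: (derivable1P f x v).2 | rewrite E].
Qed.

Lemma is_derive_outer (V : normedModType R) (f : V -> R) (h : R -> R)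
    (x v : V) (a b : R) :
  is_derive (f x) 1 h a -> is_derive x v f b -> is_derive x v (h \o f) (a * b).
Proof.
move=> Dh /is_derive_line Df; apply/is_derive_line.
apply: (@is_derive1_comp R h (fun t : R => f (t *: v + x))).
by rewrite scale0r add0r.
Qed.

Lemma is_derive_continuous1 (W : normedModType R) (f : R -> W) (t : R) (d : W) :
  is_derive t 1 f d -> {for t, continuous f}.
Proof. by move=> [fd _]; exact/differentiable_continuous/derivable1_diffP. Qed.

End DirectionalDerivatives.

Section PartialDerivatives.
Variables (R : realType) (n : nat).
Implicit Types (f g : 'rV[R]_n -> R) (x y v : 'rV[R]_n) (U : set 'rV[R]_n).

Let e i : 'rV[R]_n := delta_mx 0 i.

Lemma coord_le_norm x i : `|x 0 i| <= `|x|.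
Proof.
rewrite [leRHS]/Num.Def.normr/= mx_normrE.
exact: (le_bigmax _ (fun k => `|x k.1 k.2|) (0, i)).
Qed.

Lemma rowB x y i : (x - y) 0 i = x 0 i - y 0 i.
Proof. by rewrite !mxE. Qed.

Lemma norm_le_coord x (M : R) : 0 <= M -> (forall i, `|x 0 i| <= M) -> `|x| <= M.
Proof.
move=> M0 xM; rewrite /Num.Def.normr/= mx_normrE bigmax_le// => -[k i] _ /=.
by rewrite ord1.
Qed.

(** Has the first k coordinates of y and the others of x, so that consecutive values
    differ along one axis only. *)
Let mix x y (k : nat) : 'rV[R]_n := \row_i (if (i < k)%N then y 0 i else x 0 i).

(** The mean value theorem on each of the n axis-parallel steps from x to y; balls of
    the sup norm contain all the intermediate points. *)
Lemma increment_le f x0 (r : R) (eps : R) :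
  (forall y i, `|y - x0| < r -> derivable f y (e i) /\ `|pd i f y| <= eps) ->
  0 <= eps ->
  forall x y, `|x - x0| < r -> `|y - x0| < r -> `|f y - f x| <= n%:R * eps * `|y - x|.
Proof.
move=> H eps0 x y xr yr.
have r0 : 0 < r by apply: le_lt_trans xr.
have step (k : 'I_n) : `|f (mix x y k.+1) - f (mix x y k)| <= eps * `|y - x|.
  pose d := y 0 k - x 0 k.
  have lineE (s : R) i : (mix x y k + (s * d) *: e k) 0 i =
      if (i < k)%N then y 0 i else if i == k then x 0 i + s * d else x 0 i.
    rewrite !mxE; case: (ltngtP i k) => ik.
    - by rewrite -[i == k]/(val i == val k) (ltn_eqF ik) andbF mulr0 addr0.
    - by rewrite -[i == k]/(val i == val k) (gtn_eqF ik) andbF mulr0 addr0.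
    - by rewrite (val_inj ik) !eqxx mulr1.
  have inball (s : R) : 0 <= s <= 1 -> `|mix x y k + (s * d) *: e k - x0| < r.
    move=> /andP[s0 s1]; pose m := Num.max `|x - x0| `|y - x0|.
    apply: (@le_lt_trans _ _ m); last by rewrite gt_max xr yr.
    have m1 : `|x - x0| <= m by rewrite le_max lexx.
    have m2 : `|y - x0| <= m by rewrite le_max lexx orbT.
    apply: norm_le_coord; first exact: le_trans m1.
    move=> i; rewrite rowB lineE.
    have xi : `|x 0 i - x0 0 i| <= m.
      by apply: le_trans m1; have := coord_le_norm (x - x0) i; rewrite rowB.
    have yi : `|y 0 i - x0 0 i| <= m.
      by apply: le_trans m2; have := coord_le_norm (y - x0) i; rewrite rowB.
    case: ifP => // _; case: eqP => // ik; rewrite {}ik in xi yi *.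
    move: xi yi; rewrite !ler_norml => /andP[xi1 xi2] /andP[yi1 yi2].
    by apply/andP; split; rewrite /d; nra.
  pose F (s : R) := f (mix x y k + (s * d) *: e k).
  have F0 : F 0 = f (mix x y k) by rewrite /F mul0r scale0r addr0.
  have F1 : F 1 = f (mix x y k.+1).
    rewrite /F; congr f; apply/rowP => i; rewrite lineE mxE ltnS mul1r.
    case: (ltngtP i k) => // ik.
    - by rewrite -[i == k]/(val i == val k) (gtn_eqF ik).
    - by rewrite (val_inj ik) eqxx /d addrC subrK.
  have dF (s : R) : 0 <= s <= 1 ->
      is_derive s 1 F (pd k f (mix x y k + (s * d) *: e k) * d).
    move=> s01; apply/is_derive_line.
    have [fd _] := H _ k (inball s s01).
    have /is_derive_line Df := derivableP fd.
    have -> : (fun h : R => F (h *: 1 + s)) =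
      (fun h => f (h *: e k + (mix x y k + (s * d) *: e k))) \o (fun h => h * d).
      apply/funext => h; rewrite /F /=; congr f.
      by rewrite [h *: 1]mulr1 mulrDl scalerDl addrCA.
    apply: is_derive1_comp; first by rewrite mul0r.
    apply: is_derive_eq.
    by rewrite [_ *: _]mulr0 add0r [_ *: _]mulr1.
  rewrite -F0 -F1.
  have [||c c01 ->] := @MVT_segment R F
      (fun s => pd k f (mix x y k + (s * d) *: e k) * d) 0 1 ler01.
  - by move=> s; rewrite in_itv /= => /andP[/ltW s0 /ltW s1]; apply: dF; rewrite s0.
  - apply: derivable_within_continuous => s; rewrite in_itv /= => s01.
    by have [] := dF s s01.
  - rewrite subr0 mulr1 normrM; apply: ler_pM => //.
      move: c01; rewrite in_itv /= => c01.
      by have [] := H _ k (inball c c01).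
    by have := coord_le_norm (y - x) k; rewrite rowB.
have -> : f y - f x = \sum_(k < n) (f (mix x y k.+1) - f (mix x y k)).
  rewrite -(big_mkord xpredT (fun k => f (mix x y k.+1) - f (mix x y k))).
  rewrite telescope_sumr //; congr (f _ - f _); apply/rowP => i; rewrite mxE //.
  by rewrite ltn_ord.
apply: le_trans (ler_norm_sum _ _ _) _.
apply: le_trans (ler_sum _ (fun i _ => step i)) _.
by rewrite sumr_const card_ord -[leLHS]mulr_natl mulrA.
Qed.

Lemma is_derive_coord x i j : is_derive x (e i) (fun y : 'rV[R]_n => y 0 j) (i == j)%:R.
Proof.
apply/is_derive_line.
have -> : (fun h : R => (h *: e i + x) 0 j) = (fun h => h * (i == j)%:R + x 0 j).
  by apply/funext => h; rewrite !mxE eqxx eq_sym.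
by apply: is_derive_eq; rewrite addr0 scaler0 add0r [_%:A]mulr1.
Qed.

Definition rowform (c : 'I_n -> R) x : R := \sum_i x 0 i * c i.

Lemma is_derive_rowform c y v : is_derive y v (rowform c) (rowform c v).
Proof.
apply/is_derive_line.
have -> : (fun h : R => rowform c (h *: v + y)) = (fun h => h * rowform c v + rowform c y).
  apply/funext => h; rewrite /rowform mulr_sumr -big_split /=.
  by apply: eq_bigr => i _; rewrite !mxE mulrDl mulrA.
apply: is_derive_eq.
by rewrite [_ *: _]mulr0 add0r addr0 [_ *: _]mulr1.
Qed.

Lemma differentiable_rowform c y : differentiable (rowform c) y.
Proof.
have -> : rowform c = \sum_i (fun x : 'rV[R]_n => x 0 i * c i).
  by apply/funext => x; rewrite fct_sumE.
apply: differentiable_sum => i; apply: differentiableM.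
  exact: differentiable_coord.
exact: differentiable_cst.
Qed.

(** The form in which differentiability is checked once the candidate differential has
    been subtracted. *)
Lemma differentiable_flat g x :
  (forall eps, 0 < eps -> \forall y \near x, `|g y - g x| <= eps * `|y - x|) ->
  differentiable g x.
Proof.
move=> H.
have E : g \o shift x = cst (g x) + (\0 : {linear 'rV[R]_n -> R}) +o_ (0 : 'rV[R]_n) id.
  apply/eqaddoP => eps eps0.
  have := H _ eps0; rewrite (near_shift 0) /= => He; near=> h.
  have -> : (g \o shift x - (cst (g x) + (\0 : {linear 'rV[R]_n -> R}))) h
      = g (h + x) - g x.
    by rewrite !fctE /= addr0.
  have : `|g (h + x) - g x| <= eps * `|h + x - x|.
    by near: h; move: He; rewrite subr0.
  by rewrite addrK.
have c0 : continuous (\0 : {linear 'rV[R]_n -> R}) by move=> y; exact: cst_continuous.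
apply/diff_locallyP; have D := diff_unique c0 E; rewrite D; split => //.
Unshelve. all: by end_near. Qed.

(** Subtracting the linear form with the same partial derivatives at x leaves a
    function with small partial derivatives near x, to which [increment_le] applies. *)
Lemma C1_differentiable f x :
  (\forall y \near x, forall i, derivable f y (e i)) ->
  (forall i, {for x, continuous (pd i f)}) -> differentiable f x.
Proof.
move=> df cf; pose c i := pd i f x.
have -> : f = (f - rowform c) + rowform c by apply/funext => y; rewrite !fctE subrK.
apply: differentiableD; last exact: differentiable_rowform.
apply: differentiable_flat => eps eps0.
(* [increment_le] loses the factor n; n.+1 avoids a division by 0. *)
pose eps' := eps / n.+1%:R.
have eps'0 : 0 < eps' by rewrite divr_gt0.
have /nbhs_ballP[r /= r0 Hr] : \forall y \near x, forall i : 'I_n,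
    derivable f y (e i) /\ `|pd i f y - pd i f x| <= eps'.
  have FF : Filter (nbhs x) by exact: nbhs_filter.
  apply: (@filter_forall 'rV[R]_n 'I_n (fun i y => derivable f y (e i) /\
    `|pd i f y - pd i f x| <= eps') (nbhs x) FF) => i.
  have /cvgrPdist_le /(_ _ eps'0) Hi := cf i.
  apply: filterS2 df Hi => y df1 Hi; split; first exact: df1.
  by rewrite distrC.
apply/nbhs_ballP; exists r => //= y; rewrite -ball_normE /= distrC => yr.
have xr : `|x - x| < r by rewrite subrr normr0.
apply: le_trans (@increment_le _ x r eps' _ (ltW eps'0) x y xr yr) _.
  move=> y' i y'r.
  have [|d1 d2] := Hr y' _ i; first by rewrite -ball_normE /= distrC.
  have D : is_derive y' (e i) (f - rowform c) (pd i f y' - rowform c (e i)).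
    by apply: is_deriveB; [exact: derivableP | exact: is_derive_rowform].
  split; first by case: D.
  rewrite /pd; case: D => _ ->.
  rewrite /rowform (bigD1 i) //= big1 ?addr0 ?mxE ?eqxx ?mul1r // => j ji.
  by rewrite mxE (negbTE ji) andbF mul0r.
apply: ler_wpM2r => //.
rewrite /eps' mulrA ler_pdivrMr // mulrC ler_wpM2l ?(ltW eps0) // ler_nat.
by [].
Unshelve. all: by end_near. Qed.

Lemma derive_pd f x v : differentiable f x ->
  'D_v f x = \sum_i v 0 i * pd i f x.
Proof.
move=> df; rewrite deriveE // [in LHS](row_sum_delta v) linear_sum /=.
by apply: eq_bigr => i _; rewrite linearZ /= -deriveE.
Qed.

End PartialDerivatives.

Section Chain.
Variables (R : realType) (n : nat).

(** Assumes only coordinatewise derivatives of the curve, so it applies to curves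
    given by formulas as well as to abstract C^1 curves. *)
Lemma is_derive_curve (F : 'rV[R]_n -> R) (c : R -> 'rV[R]_n) (t : R) (v : 'I_n -> R) :
  differentiable F (c t) -> (forall k, is_derive t 1 (fun s => c s 0 k) (v k)) ->
  is_derive t 1 (F \o c) (\sum_k v k * pd k F (c t)).
Proof.
move=> dF dc.
have Dc : derivable c t 1 by apply/derivable_mxP => i j; rewrite ord1; case: (dc j).
have dc' : differentiable c t by apply/derivable1_diffP.
split; first exact/derivable1_diffP/differentiable_comp.
rewrite deriveE; last exact: differentiable_comp.
rewrite diff_comp //= -!deriveE // derive_pd //.
apply: eq_bigr => k _; rewrite derive_mx // mxE.
by case: (dc k) => _ ->.
Qed.

End Chain.

(** * Functions of class C^k *)

Section CkClosure.
Variables (R : realType) (n : nat).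
Implicit Types (f g : 'rV[R]_n -> R) (x y v w : 'rV[R]_n) (U : set 'rV[R]_n).

Let e i : 'rV[R]_n := delta_mx 0 i.

Lemma pds_eq_on U f g : open U -> (forall x, U x -> f x = g x) ->
  forall s x, U x -> pds s f x = pds s g x.
Proof.
move=> oU fg; elim=> [|i s IH] x Ux; first exact: fg.
apply: near_eq_derive; have : nbhs x U by exact: open_nbhs_nbhs.
by apply: filterS => y /IH.
Qed.

Lemma Ck_eq_on k U f g : open U -> (forall x, U x -> f x = g x) ->
  Ck k U f -> Ck k U g.
Proof.
move=> oU fg cf x Ux; have [c d] := cf x Ux.
have nU : nbhs x U by exact: open_nbhs_nbhs.
have E s : \forall y \near x, pds s f y = pds s g y.
  by apply: filterS nU => y; exact: pds_eq_on.
split=> [s sk|s i sk].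
- have := c s sk; rewrite /prop_for /continuous_at -(pds_eq_on oU fg s Ux).
  by apply: cvg_trans; exact: (@near_eq_cvg _ _ (nbhs x) _ _ _ (E s)).
- by apply: near_eq_derivable (d s i sk); exact: E.
Qed.

Lemma Ck0 f x : {for x, continuous f} ->
  (forall s : seq 'I_n, (size s <= 0)%N -> {for x, continuous (pds s f)}) /\
  (forall (s : seq 'I_n) (i : 'I_n), (size s < 0)%N -> derivable (pds s f) x (e i)).
Proof. by move=> cf; split=> [s|//]; rewrite leqn0 size_eq0 => /eqP ->. Qed.

Lemma CkW j k U f : (j <= k)%N -> Ck k U f -> Ck j U f.
Proof.
move=> jk cf x Ux; have [c d] := cf x Ux.
by split=> [s sj|s i sj]; [apply: c; exact: leq_trans jk|apply: d; exact: leq_trans jk].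
Qed.

Lemma Ck_sub k U V f : U `<=` V -> Ck k V f -> Ck k U f.
Proof. by move=> UV cf x /UV /cf. Qed.

Lemma Ck_continuous k U f x : Ck k U f -> U x -> {for x, continuous f}.
Proof. by move=> cf /cf[/(_ [::] isT)]. Qed.

Lemma pds_rcons s i f : pds (rcons s i) f = pds s (pd i f).
Proof. by rewrite /pds -cats1 foldr_cat. Qed.

Lemma Ck_pd k U f i : Ck k.+1 U f -> Ck k U (pd i f).
Proof.
move=> cf x Ux; have [c d] := cf x Ux.
split=> [s sk|s j sk]; rewrite -pds_rcons.
  by apply: c; rewrite size_rcons.
by apply: d; rewrite size_rcons.
Qed.

Lemma Ck_derivable k U f x i : Ck k.+1 U f -> U x -> derivable f x (e i).
Proof. by move=> cf Ux; have [_ /(_ [::] i isT)] := cf x Ux. Qed.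

Lemma Ck_is_derive k U f x i : Ck k.+1 U f -> U x -> is_derive x (e i) f (pd i f x).
Proof. by move=> cf Ux; apply: derivableP; exact: Ck_derivable cf Ux. Qed.

(** The way to prove C^k by induction: give the first partial derivatives by a formula
    and show that they are of class C^(k-1). *)
Lemma CkS k U f (f' : 'I_n -> 'rV[R]_n -> R) : open U ->
  (forall x, U x -> {for x, continuous f}) ->
  (forall x i, U x -> is_derive x (e i) f (f' i x)) ->
  (forall i, Ck k U (f' i)) -> Ck k.+1 U f.
Proof.
move=> oU cf df ck x Ux.
have E i y : U y -> f' i y = pd i f y by move=> Uy; case: (df y i Uy).
have ck' i : Ck k U (pd i f) by exact: Ck_eq_on oU (E i) (ck i).
split=> [s|s i]; case: (lastP s) => [|s' j].
- by move=> _; exact: cf.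
- by rewrite size_rcons pds_rcons ltnS => /(ck' j x Ux).1.
- by move=> _; case: (df x i Ux).
- by rewrite size_rcons pds_rcons ltnS => /(ck' j x Ux).2.
Qed.

Lemma Ck_differentiable k U f x : open U -> Ck k.+1 U f -> U x -> differentiable f x.
Proof.
move=> oU cf Ux; apply: C1_differentiable.
  have : nbhs x U by exact: open_nbhs_nbhs.
  by apply: filterS => y Uy i; exact: Ck_derivable cf Uy.
by move=> i; apply: Ck_continuous (Ck_pd i cf) Ux.
Qed.

Lemma Ck_cst k U (a : R) : open U -> Ck k U (fun=> a).
Proof.
move=> oU; elim: k a => [|k IH] a.
  move=> x Ux; apply: Ck0; exact: cst_continuous.
apply: (@CkS k U _ (fun _ _ => 0) oU) => [x _|i]; last exact: IH.
exact: cst_continuous.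
Qed.

Lemma Ck_coord k U j : open U -> Ck k U (fun x => x 0 j).
Proof.
move=> oU; have c x : {for x, continuous (fun x : 'rV[R]_n => x 0 j)}.
  exact: coord_continuous.
case: k => [|k]; first by move=> x Ux; apply: Ck0; exact: c.
apply: (@CkS k U _ (fun i _ => (i == j)%:R) oU) => [x _|x i _|i]; [exact: c| |exact: Ck_cst].
exact: is_derive_coord.
Qed.

Lemma Ck_add k U f g : open U -> Ck k U f -> Ck k U g -> Ck k U (fun x => f x + g x).
Proof.
move=> oU; elim: k f g => [|k IH] f g cf cg.
  move=> x Ux; apply: Ck0.
  apply: continuousD; [exact: Ck_continuous cf Ux|exact: Ck_continuous cg Ux].
apply: (@CkS k U _ (fun i x => pd i f x + pd i g x) oU).
- move=> x Ux; apply: continuousD; [exact: Ck_continuous cf Ux|exact: Ck_continuous cg Ux].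
- by move=> x i Ux; apply: is_deriveD; [exact: Ck_is_derive cf Ux|exact: Ck_is_derive cg Ux].
- by move=> i; apply: IH; exact: Ck_pd.
Qed.

Lemma Ck_mul k U f g : open U -> Ck k U f -> Ck k U g -> Ck k U (fun x => f x * g x).
Proof.
move=> oU; elim: k f g => [|k IH] f g cf cg.
  move=> x Ux; apply: Ck0.
  apply: continuousM; [exact: Ck_continuous cf Ux|exact: Ck_continuous cg Ux].
apply: (@CkS k U _ (fun i x => f x * pd i g x + g x * pd i f x) oU).
- move=> x Ux; apply: continuousM; [exact: Ck_continuous cf Ux|exact: Ck_continuous cg Ux].
- by move=> x i Ux; apply: is_deriveM; [exact: Ck_is_derive cf Ux|exact: Ck_is_derive cg Ux].
- move=> i; apply: Ck_add oU (IH _ _ _ (Ck_pd i cg)) (IH _ _ _ (Ck_pd i cf)).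
    exact: CkW (leqnSn k) cf.
  exact: CkW (leqnSn k) cg.
Qed.

Lemma Ck_inv k U f : open U -> (forall x, U x -> f x != 0) ->
  Ck k U f -> Ck k U (fun x => (f x)^-1).
Proof.
move=> oU f0; elim: k => [|k IH] cf.
  move=> x Ux; apply: Ck0.
  apply: continuousV; [exact: f0|exact: Ck_continuous cf Ux].
have ck := CkW (leqnSn k) cf.
apply: (@CkS k U _ (fun i x => - 1 * (((f x)^-1 * (f x)^-1) * pd i f x)) oU).
- move=> x Ux; apply: continuousV; [exact: f0|exact: Ck_continuous cf Ux].
- move=> x i Ux; apply: is_derive_eq.
    apply: (@is_derive_outer _ _ f GRing.inv); last exact: Ck_is_derive cf Ux.
    exact: (is_deriveV (f := id) (f0 x Ux)).
  by rewrite [_ *: 1]mulr1 expr2 invfM; ring.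
- move=> i; apply: (Ck_mul oU (Ck_cst _ (-1) oU)).
  exact: Ck_mul oU (Ck_mul oU (IH ck) (IH ck)) (Ck_pd i cf).
Qed.

(** The derivative of p o f involves q o f and conversely, so the induction on k is on
    both composites at once.  The case of interest is p = phi, q = phi'. *)
Lemma Ck_outer_pair (k : nat) U f (p q : R -> R) (a b : R) : open U ->
  (forall t : R, is_derive t 1 p (a * q t)) -> (forall t : R, is_derive t 1 q (b * p t)) ->
  Ck k U f -> Ck k U (p \o f) /\ Ck k U (q \o f).
Proof.
move=> oU dp dq; elim: k => [|k IH] cf.
  split=> x Ux; apply: Ck0; apply: continuous_comp (Ck_continuous cf Ux) _.
    exact: is_derive_continuous1 (dp _).
  exact: is_derive_continuous1 (dq _).
have [cp cq] := IH (CkW (leqnSn k) cf).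
have aux (p' q' : R -> R) a' : (forall t : R, is_derive t 1 p' (a' * q' t)) ->
    Ck k U (q' \o f) -> Ck k.+1 U (p' \o f).
  move=> dp' cq'.
  apply: (@CkS k U _ (fun i x => a' * (q' \o f) x * pd i f x) oU).
  - move=> x Ux; apply: continuous_comp (Ck_continuous cf Ux) _.
    exact: is_derive_continuous1 (dp' _).
  - by move=> x i Ux; exact: is_derive_outer (dp' _) (Ck_is_derive i cf Ux).
  - move=> i; exact: Ck_mul oU (Ck_mul oU (Ck_cst _ a' oU) cq') (Ck_pd i cf).
by split; [exact: aux dp cq|exact: aux dq cp].
Qed.

End CkClosure.

(** * Symmetry of second derivatives *)

Section Schwarz.
Variables (R : realType) (n : nat).
Implicit Types (f g : 'rV[R]_n -> R) (x y v w : 'rV[R]_n) (U : set 'rV[R]_n).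
Let e i : 'rV[R]_n := delta_mx 0 i.

Lemma MVT_line f x v (s : R) : 0 <= s ->
  (forall t, 0 <= t <= s -> derivable f (t *: v + x) v) ->
  exists2 t, 0 <= t <= s & f (s *: v + x) - f x = s * 'D_v f (t *: v + x).
Proof.
move=> s0 df; pose F (t : R) := f (t *: v + x).
have dF (t : R) : 0 <= t <= s -> is_derive t 1 F ('D_v f (t *: v + x)).
  move=> t0; apply/is_derive_line.
  have /is_derive_line := derivableP (df t t0).
  congr (is_derive _ _ _ _); apply/funext => h; rewrite /F; congr f.
  by rewrite [h *: 1]mulr1 scalerDl addrA.
have [||t ts E] := @MVT_segment R F (fun t => 'D_v f (t *: v + x)) 0 s s0.
- by move=> t; rewrite in_itv /= => /andP[/ltW t0 /ltW ts]; apply: dF; rewrite t0.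
- apply: derivable_within_continuous => t; rewrite in_itv /= => ts.
  by case: (dF t ts).
exists t; first by move: ts; rewrite in_itv.
by move: E; rewrite /F scale0r add0r subr0 mulrC.
Qed.

Lemma approx_both (d a b c eps : R) : `|d - c * a| <= c * (eps / 2) ->
  `|d - c * b| <= c * (eps / 2) -> `|c * (b - a)| <= c * eps.
Proof.
rewrite !ler_norml => /andP[a1 a2] /andP[b1 b2].
by apply/andP; split; lra.
Qed.

Let diff2 f x v w (s : R) :=
  f (s *: v + (s *: w + x)) - f (s *: v + x) - (f (s *: w + x) - f x).

(** Two applications of the mean value theorem, first in direction i to the increment of
    f in direction j, then in direction j to the partial derivative in direction i. *)
Lemma diff2_approx U f x i j (eps : R) : open U -> Ck 2 U f -> U x -> 0 < eps ->
  \forall s \near (0 : R)^'+,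
    `|diff2 f x (e i) (e j) s - s ^+ 2 * pd j (pd i f) x| <= s ^+ 2 * eps.
Proof.
move=> oU cf Ux eps0.
have c2 : {for x, continuous (pd j (pd i f))}.
  exact: Ck_continuous (Ck_pd j (Ck_pd i cf)) Ux.
have /nbhs_ballP[r /= r0 Hr] : \forall y \near x,
    U y /\ `|pd j (pd i f) y - pd j (pd i f) x| <= eps.
  have nU : nbhs x U by exact: open_nbhs_nbhs.
  have /cvgrPdist_le /(_ _ eps0) Hi := c2.
  by apply: filterS2 nU Hi => y Uy Hi; split; [exact: Uy|rewrite distrC; exact: Hi].
near=> s.
have s0 : 0 < s by near: s; exact: nbhs_right_gt.
have sr : s + s < r.
  have : s < r / 2 by near: s; apply: nbhs_right_lt; exact: divr_gt0.
  lra.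
have inb (a b : R) : 0 <= a <= s -> 0 <= b <= s ->
    U (a *: e i + (b *: e j + x)) /\
    `|pd j (pd i f) (a *: e i + (b *: e j + x)) - pd j (pd i f) x| <= eps.
  move=> /andP[a0 a1] /andP[b0 b1]; apply: Hr; rewrite -ball_normE /= distrC.
  rewrite addrA addrK; apply: le_lt_trans (ler_normD _ _) _.
  have ne (k : 'I_n) : `|e k| <= 1.
    apply: norm_le_coord => // l; rewrite mxE.
    by case: (_ && _); rewrite ?normr1 ?normr0.
  apply: le_lt_trans sr; rewrite !normrZ (ger0_norm a0) (ger0_norm b0).
  by apply: lerD; apply: le_trans (ler_wpM2l _ (ne _)) _; rewrite ?mulr1.
have s00 : 0 <= s <= s by rewrite ltW /=.
have z00 : 0 <= (0 : R) <= s by rewrite lexx ltW.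
have inb0 a : 0 <= a <= s -> U (a *: e i + x).
  by move=> /inb /(_ z00)[+ _]; rewrite scale0r add0r.
pose g y := f (s *: e j + y) - f y.
have dg t : 0 <= t <= s -> is_derive (t *: e i + x) (e i) g
   (pd i f (s *: e j + (t *: e i + x)) - pd i f (t *: e i + x)).
  move=> ts; apply: is_deriveB; last exact: Ck_is_derive cf (inb0 _ ts).
  apply/is_derive_line.
  have Us : U (s *: e j + (t *: e i + x)).
    by rewrite addrCA; have [] := inb t s ts s00.
  have /is_derive_line := Ck_is_derive i cf Us.
  congr (is_derive _ _ _ _); apply/funext => h; congr f.
  by rewrite addrCA.
have [t ts Et] : exists2 t, 0 <= t <= s &
    g (s *: e i + x) - g x = s * 'D_(e i) g (t *: e i + x).
  apply: MVT_line; first exact: ltW.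
  by move=> t ts; case: (dg t ts).
move: Et; have [_ ->] := dg t ts => Et.
have [t' ts' Et'] : exists2 t', 0 <= t' <= s &
    pd i f (s *: e j + (t *: e i + x)) - pd i f (t *: e i + x) =
    s * 'D_(e j) (pd i f) (t' *: e j + (t *: e i + x)).
  apply: MVT_line; first exact: ltW.
  move=> t' ts'; have c1 : Ck 1 U (pd i f) by exact: Ck_pd cf.
  apply: (Ck_derivable c1).
  by rewrite addrCA; have [] := inb t t' ts ts'.
have -> : diff2 f x (e i) (e j) s = g (s *: e i + x) - g x.
  by rewrite /diff2 /g (addrCA (s *: e i)).
rewrite Et Et' mulrA -expr2 -mulrBr normrM ger0_norm ?sqr_ge0 //.
rewrite ler_wpM2l ?sqr_ge0 //.
by rewrite [_ + (_ + _)]addrCA; have [] := inb t t' ts ts'.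
Unshelve. all: by end_near. Qed.

(** Both mixed partial derivatives are the limit of the same second difference
    quotient, which is symmetric in the two directions. *)
Lemma pd_sym U f x i j : open U -> Ck 2 U f -> U x ->
  pd i (pd j f) x = pd j (pd i f) x.
Proof.
move=> oU cf Ux; apply/eqP; rewrite -subr_eq0 -normr_le0.
apply/ler_addgt0Pl => eps eps0; rewrite addr0.
have e20 : 0 < eps / 2 by rewrite divr_gt0.
have A1 := diff2_approx i j oU cf Ux e20.
have A2 := diff2_approx j i oU cf Ux e20.
have F := filterI (filterI A1 A2) (nbhs_right_gt (0 : R)).
have [s [[H1 H2] s0]] := @filter_ex _ _ (at_right_proper_filter (0 : R)) _ (F _ _).
rewrite /= in H1 H2.
have S : diff2 f x (e j) (e i) s = diff2 f x (e i) (e j) s.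
  have swap (a b c d : R) : a - b - (c - d) = a - c - (b - d) by ring.
  by rewrite /diff2 (addrCA (s *: e j)); exact: swap.
rewrite S in H2; have s20 : 0 < s ^+ 2 by exact: exprn_gt0.
rewrite -(ler_pM2l s20) -[s ^+ 2 in leLHS](gtr0_norm s20) -normrM.
exact: approx_both H1 H2.
Qed.

End Schwarz.

(** * Euclidean geometry and polar coordinates *)

Section Euclid.
Variables (R : realType) (n : nat).
Implicit Types (u v w x : 'rV[R]_n) (a b : R).

Lemma dotpE u v : dotp u v = (u *m v^T) 0 0.
Proof. by rewrite mxE; apply: eq_bigr => i _; rewrite mxE. Qed.

Lemma dotpC u v : dotp u v = dotp v u.
Proof. by apply: eq_bigr => i _; rewrite mulrC. Qed.

Lemma dotpDl u v w : dotp (u + v) w = dotp u w + dotp v w.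
Proof. by rewrite !dotpE mulmxDl mxE. Qed.

Lemma dotpDr u v w : dotp u (v + w) = dotp u v + dotp u w.
Proof. by rewrite dotpC dotpDl !(dotpC u). Qed.

Lemma dotpZl a u v : dotp (a *: u) v = a * dotp u v.
Proof. by rewrite !dotpE -scalemxAl mxE. Qed.

Lemma dotpZr a u v : dotp u (a *: v) = a * dotp u v.
Proof. by rewrite dotpC dotpZl dotpC. Qed.

Lemma dotpNl u v : dotp (- u) v = - dotp u v.
Proof. by rewrite -scaleN1r dotpZl mulN1r. Qed.

Lemma dotpNr u v : dotp u (- v) = - dotp u v.
Proof. by rewrite dotpC dotpNl dotpC. Qed.

Lemma dotp0l v : dotp 0 v = 0.
Proof. by rewrite dotpE mul0mx mxE. Qed.

Lemma dotp_ge0 u : 0 <= dotp u u.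
Proof. by apply: sumr_ge0 => i _; rewrite -expr2 sqr_ge0. Qed.

Lemma dotp_eq0 u : (dotp u u == 0) = (u == 0).
Proof.
apply/eqP/eqP => [|->]; last exact: dotp0l.
move/eqP; rewrite psumr_eq0 => [/allP u0|i _]; last by rewrite -expr2 sqr_ge0.
apply/rowP => i; rewrite mxE; apply/eqP.
by have := u0 i (mem_index_enum _); rewrite mulf_eq0 orbb.
Qed.

Lemma enorm_sqr u : enorm u ^+ 2 = dotp u u.
Proof. by rewrite sqr_sqrtr // dotp_ge0. Qed.

Lemma enorm_ge0 u : 0 <= enorm u.
Proof. exact: sqrtr_ge0. Qed.

Lemma enorm_eq0 u : (enorm u == 0) = (u == 0).
Proof. by rewrite -(sqrf_eq0 (enorm u)) enorm_sqr dotp_eq0. Qed.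

Lemma enorm0 : enorm (0 : 'rV[R]_n) = 0.
Proof. by apply/eqP; rewrite enorm_eq0. Qed.

Lemma enorm_gt0 u : (0 < enorm u) = (u != 0).
Proof. by rewrite lt_def enorm_ge0 andbT enorm_eq0. Qed.

Lemma enormZ a u : enorm (a *: u) = `|a| * enorm u.
Proof. by rewrite /enorm dotpZl dotpZr mulrA -expr2 sqrtrM ?sqr_ge0 // sqrtr_sqr. Qed.

Lemma dotp_sqr_le u v : dotp u v ^+ 2 <= dotp u u * dotp v v.
Proof.
have [->|u0] := eqVneq u 0; first by rewrite !dotp0l expr0n mul0r.
have a0 : 0 < dotp u u by rewrite lt_def dotp_eq0 u0 dotp_ge0.
have := dotp_ge0 (dotp u u *: v - dotp u v *: u).
have -> : dotp (dotp u u *: v - dotp u v *: u) (dotp u u *: v - dotp u v *: u) =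
   dotp u u * (dotp u u * dotp v v - dotp u v ^+ 2).
  rewrite !(dotpDl, dotpDr, dotpNl, dotpNr, dotpZl, dotpZr) (dotpC v u).
  by ring.
by rewrite pmulr_rge0 // subr_ge0.
Qed.

Lemma dotp_le_enorm u v : `|dotp u v| <= enorm u * enorm v.
Proof.
rewrite -[leLHS]sqrtr_sqr /enorm -sqrtrM ?dotp_ge0 //.
by rewrite ler_sqrt ?dotp_sqr_le // mulr_ge0 ?dotp_ge0.
Qed.

Lemma enormD u v : enorm (u + v) <= enorm u + enorm v.
Proof.
rewrite -ler_sqr ?nnegrE ?addr_ge0 ?enorm_ge0 // enorm_sqr sqrrD !enorm_sqr.
rewrite dotpDl !dotpDr (dotpC v u).
have := dotp_le_enorm u v; rewrite ler_norml => /andP[_ H].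
by move: H; rewrite mulr2n; lra.
Qed.

Lemma coord_le_enorm u i : `|u 0 i| <= enorm u.
Proof.
rewrite -sqrtr_sqr ler_sqrt ?dotp_ge0 // /dotp (bigD1 i) //= -expr2 lerDl.
by apply: sumr_ge0 => j _; rewrite -expr2 sqr_ge0.
Qed.

Lemma norm_le_enorm u : `|u| <= enorm u.
Proof. by apply: norm_le_coord; [exact: enorm_ge0|exact: coord_le_enorm]. Qed.

Lemma continuous_sum (T : topologicalType) (I : Type) (r : seq I) (F : I -> T -> R) t :
  (forall i, {for t, continuous (F i)}) ->
  {for t, continuous (fun s => \sum_(i <- r) F i s)}.
Proof.
move=> cF; elim: r => [|i r IH].
  have -> : (fun s => \sum_(i <- [::]) F i s) = (fun=> 0).
    by apply/funext => s; rewrite big_nil.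
  exact: cst_continuous.
have -> : (fun s => \sum_(j <- i :: r) F j s) = (fun s => F i s + \sum_(j <- r) F j s).
  by apply/funext => s; rewrite big_cons.
exact: continuousD (cF i) IH.
Qed.

Lemma dotp_continuous (T : topologicalType) (f g : T -> 'rV[R]_n) t :
  {for t, continuous f} -> {for t, continuous g} ->
  {for t, continuous (fun s => dotp (f s) (g s))}.
Proof.
move=> cf cg; rewrite /dotp; apply: continuous_sum => i; apply: continuousM.
  exact: (@continuous_comp _ _ _ f (fun x => x 0 i) t cf (@coord_continuous _ _ _ 0 i _)).
exact: (@continuous_comp _ _ _ g (fun x => x 0 i) t cg (@coord_continuous _ _ _ 0 i _)).
Qed.

Lemma enorm_continuous : continuous (@enorm R n).
Proof.
move=> x; apply: continuous_comp; last exact: sqrt_continuous.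
by apply: dotp_continuous; exact: cvg_id.
Qed.

Lemma open_neq0 : open [set x : 'rV[R]_n | x != 0].
Proof.
have -> : [set x : 'rV[R]_n | x != 0] = (@enorm R n) @^-1` [set y | 0 < y].
  by apply/seteqP; split=> x /=; rewrite enorm_gt0.
apply: open_comp; last exact: open_gt.
by move=> x _; exact: enorm_continuous.
Qed.

Lemma is_derive_enorm x v : x != 0 -> is_derive x v (@enorm R n) (dotp x v / enorm x).
Proof.
move=> x0; have D : is_derive x v (fun y => dotp y y) (2 * dotp x v).
  apply/is_derive_line.
  have -> : (fun h : R => dotp (h *: v + x) (h *: v + x)) =
     (fun h => h * (h * dotp v v) + h * (2 * dotp x v) + dotp x x).
    apply/funext => h; rewrite dotpDl !dotpDr !dotpZl !dotpZr (dotpC v x); ring.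
  apply: is_derive_eq.
  by rewrite mul0r !scale0r !add0r addr0 [_%:A]mulr1.
have q0 : 0 < dotp x x by rewrite lt_def dotp_eq0 x0 dotp_ge0.
have D2 := is_derive_outer (f := fun y => dotp y y) (is_derive1_sqrt q0) D.
apply: (is_derive_eq D2).
by rewrite -/(enorm x) invfM mulrACA mulVf ?mul1r 1?mulrC // pnatr_eq0.
Qed.

Lemma Ck_enorm k : Ck k [set x | x != 0] (@enorm R n).
Proof.
have c x : x != 0 -> {for x, continuous (@enorm R n)} by move=> _; exact: enorm_continuous.
elim: k => [|k IH]; first by move=> x x0; split=> [[|] // _|//]; exact: c.
apply: (@CkS _ _ k _ _ (fun i x => x 0 i * (enorm x)^-1)) => //; first exact: open_neq0.
- move=> x i x0; apply: (is_derive_eq (is_derive_enorm _ x0)); congr (_ / _).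
  rewrite /dotp (bigD1 i) //= mxE !eqxx mulr1 big1 ?addr0 // => j ji.
  by rewrite mxE (negbTE ji) andbF mulr0.
- move=> i; apply: Ck_mul; [exact: open_neq0|exact: Ck_coord open_neq0|].
  by apply: Ck_inv => // [|x x0]; [exact: open_neq0|rewrite enorm_eq0].
Qed.

End Euclid.

Section Direction.
Variables (R : realType) (n : nat).
Implicit Types (x z : 'rV[R]_n.+1).

Lemma enorm_delta (i : 'I_n.+1) : enorm (delta_mx 0 i : 'rV[R]_n.+1) = 1.
Proof.
rewrite /enorm /dotp (bigD1 i) //= mxE !eqxx mulr1 big1 ?addr0 ?sqrtr1 // => j ji.
by rewrite mxE (negbTE ji) andbF mulr0.
Qed.

Lemma enorm_dir x : enorm (dir x) = 1.
Proof.
rewrite /dir; case: eqVneq => [_|x0]; first exact: enorm_delta.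
by rewrite enormZ normfV ger0_norm ?enorm_ge0 // mulVf // enorm_eq0.
Qed.

Lemma polar x : x = enorm x *: dir x.
Proof.
rewrite /dir; case: eqVneq => [->|x0]; first by rewrite enorm0 scale0r.
by rewrite scalerA mulfV ?scale1r // enorm_eq0.
Qed.

Lemma usphere_neq0 z : usphere z -> z != 0.
Proof. by move=> z1; rewrite -enorm_eq0 z1 oner_eq0. Qed.

Lemma dirZ (r : R) x : 0 < r -> x != 0 -> dir (r *: x) = dir x.
Proof.
move=> r0 x0; rewrite /dir scaler_eq0 (gt_eqF r0) (negbTE x0) /=.
by rewrite enormZ gtr0_norm // scalerA invfM mulrAC mulVf ?mul1r // gt_eqF.
Qed.

Lemma dir_usphere z : usphere z -> dir z = z.
Proof.
by move=> z1; rewrite /dir (negbTE (usphere_neq0 z1)) z1 invr1 scale1r.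
Qed.

Lemma dir_ray (r : R) z : 0 < r -> usphere z -> dir (r *: z) = z.
Proof. by move=> r0 z1; rewrite dirZ ?usphere_neq0 // dir_usphere. Qed.

Lemma enorm_ray (r : R) z : 0 <= r -> usphere z -> enorm (r *: z) = r.
Proof. by move=> r0 z1; rewrite enormZ z1 mulr1 ger0_norm. Qed.

End Direction.

(** * The functions phi and phi'/phi *)

Section Phi.
Variables (R : realType) (K : int).
Hypothesis hK : K = -1 \/ K = 0 \/ K = 1.
Implicit Types (r s t : R).

Lemma phi_m1E : @phi R (-1) = fun r => 2^-1 * (expR r + - expR (- r)).
Proof. by apply/funext => t; rewrite /phi /= mulrC. Qed.

Lemma dphi_m1E : @dphi R (-1) = fun r => 2^-1 * (expR r + expR (- r)).
Proof.
apply/funext => t; rewrite /dphi derive1E.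
have D : is_derive t 1 (@phi R (-1)) (2^-1 * (expR t + expR (- t))).
  by rewrite phi_m1E; apply: is_derive_eq; rewrite mulrN1 opprK.
by case: D.
Qed.

Lemma phi_0E : @phi R 0 = fun r => r.
Proof. by apply/funext => t; rewrite /phi eqxx. Qed.

Lemma dphi_0E : @dphi R 0 = fun=> 1.
Proof. by apply/funext => t; rewrite /dphi phi_0E derive1E derive_id. Qed.

Lemma phi_1E : @phi R 1 = @sin R.
Proof. by apply/funext => t. Qed.

Lemma dphi_1E : @dphi R 1 = @cos R.
Proof. by apply/funext => t; rewrite /dphi phi_1E derive1E; case: (is_derive_sin t). Qed.

Lemma is_derive_phi r : is_derive r 1 (@phi R K) (dphi K r).
Proof.
case: hK => [->|[->|->]].
- by rewrite phi_m1E dphi_m1E; apply: is_derive_eq; rewrite mulrN1 opprK.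
- by rewrite phi_0E dphi_0E; exact: is_derive_id.
- by rewrite phi_1E dphi_1E; exact: is_derive_sin.
Qed.

Lemma is_derive_dphi r : is_derive r 1 (@dphi R K) (- K%:~R * phi K r).
Proof.
case: hK => [->|[->|->]].
- by rewrite phi_m1E dphi_m1E; apply: is_derive_eq; rewrite mulrN1 mulrN1z opprK mul1r.
- by rewrite phi_0E dphi_0E oppr0 mul0r; exact: is_derive_cst.
- by rewrite phi_1E dphi_1E mulN1r; exact: is_derive_cos.
Qed.

Lemma phi0 : phi K 0 = 0 :> R.
Proof.
case: hK => [->|[->|->]]; first by rewrite phi_m1E oppr0 subrr mulr0.
  by rewrite phi_0E.
by rewrite phi_1E sin0.
Qed.

Lemma dphi0 : dphi K 0 = 1 :> R.
Proof.
case: hK => [->|[->|->]]; first by rewrite dphi_m1E oppr0 !expR0; field.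
  by rewrite dphi_0E.
by rewrite dphi_1E cos0.
Qed.

Lemma phiN r : phi K (- r) = - phi K r.
Proof.
case: hK => [->|[->|->]]; first by rewrite phi_m1E opprK -mulrN opprB.
  by rewrite phi_0E.
by rewrite phi_1E sinN.
Qed.

Lemma phiB r s : phi K (r - s) = phi K r * dphi K s - dphi K r * phi K s.
Proof.
case: hK => [->|[->|->]].
- rewrite phi_m1E dphi_m1E opprB !expRD.
  have er := expRxMexpNx_1 r; have es := expRxMexpNx_1 s.
  move: er es; move: (expR r) (expR (- r)) (expR s) (expR (- s)) => a a' b b' _ _.
  by field.
- by rewrite phi_0E dphi_0E; ring.
- by rewrite phi_1E dphi_1E sinB.
Qed.

(** The conserved quantity of phi'' = - K phi; it also gives (phi'/phi)' = - 1/phi^2 for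
    all three curvatures. *)
Lemma phi_pyth r : dphi K r ^+ 2 + K%:~R * phi K r ^+ 2 = 1.
Proof.
case: hK => [->|[->|->]].
- rewrite phi_m1E dphi_m1E mulrN1z.
  have := expRxMexpNx_1 r; move: (expR r) (expR (- r)) => a a' aa.
  have -> : (2^-1 * (a + a')) ^+ 2 + -1 * (2^-1 * (a - a')) ^+ 2 = a * a' by field.
  exact: aa.
- by rewrite dphi_0E mul0r addr0 expr1n.
- by rewrite phi_1E dphi_1E mul1r cos2Dsin2.
Qed.

Lemma phi_gt0 r : 0 < r -> in_radius K r -> 0 < phi K r.
Proof.
case: hK => [->|[->|->]] r0.
- move=> _; rewrite phi_m1E mulr_gt0 // subr_gt0 ltr_expR; lra.
- by rewrite phi_0E.
- by move=> /(_ erefl) rpi; rewrite phi_1E sin_gt0_pi // r0.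
Qed.

End Phi.

Section RadialFunction.
Variables (R : realType) (K : int) (n : nat) (rho : 'rV[R]_n.+1 -> R).
Hypothesis hK : K = -1 \/ K = 0 \/ K = 1.
Hypothesis rho_smooth : smooth_on_sphere rho.
Hypothesis rho_range : forall z, usphere z -> 0 < rho z /\ in_radius K (rho z).
Implicit Types (x y z v : 'rV[R]_n.+1).

Lemma phi_rho_gt0 z : usphere z -> 0 < phi K (rho z).
Proof. by move=> /rho_range[]; exact: phi_gt0. Qed.

(** The cotangent of rho in the geometry of curvature K, as a function on the whole
    space that is homogeneous of degree 0. *)
Definition cot_rho x : R := dphi K (rho (dir x)) / phi K (rho (dir x)).

(** Separates the variables r and z: phi(r - rho) = phi(r) phi'(rho) - phi'(r) phi(rho). *)
Lemma bfunE x : bfun K rho x = phi K (enorm x) * cot_rho x - dphi K (enorm x).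
Proof.
have p0 := phi_rho_gt0 (enorm_dir x).
rewrite /bfun /cot_rho phiB // mulrBl mulrA; congr (_ - _).
by rewrite mulfK // gt_eqF.
Qed.

Lemma Ck_phi_pair k (U : set 'rV[R]_n.+1) f : open U -> Ck k U f ->
  Ck k U (phi K \o f) /\ Ck k U (dphi K \o f).
Proof.
move=> oU; apply: (@Ck_outer_pair _ _ _ _ _ _ _ 1 (- K%:~R) oU).
  by move=> t; rewrite mul1r; exact: is_derive_phi.
by move=> t; exact: is_derive_dphi.
Qed.

Lemma Ck_cot_rho k : Ck k [set x | x != 0] cot_rho.
Proof.
have o0 := @open_neq0 R n.+1.
have [cp cd] := Ck_phi_pair o0 (rho_smooth k).
apply: (Ck_mul o0 cd); apply: (Ck_inv o0 _ cp) => x _.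
by rewrite gt_eqF // phi_rho_gt0 // /usphere /= enorm_dir.
Qed.

Lemma Ck_bfun k : Ck k [set x | x != 0] (bfun K rho).
Proof.
have o0 := @open_neq0 R n.+1.
have [cp cd] := Ck_phi_pair o0 (@Ck_enorm R n.+1 k).
have -> : bfun K rho = (fun x => phi K (enorm x) * cot_rho x + (-1) * dphi K (enorm x)).
  by apply/funext => x; rewrite bfunE mulN1r.
exact: (Ck_add o0 (Ck_mul o0 cp (Ck_cot_rho k)) (Ck_mul o0 (Ck_cst _ _ o0) cd)).
Qed.

End RadialFunction.

(** * Christoffel symbols of the space form *)

Section Contraction.
Variables (R : realType) (n : nat).
Implicit Types (u v w y a b c x : 'rV[R]_n).

(** Bilinear forms instead of matrix entries: all identities below are linear in the
    arguments, which can then be split into radial and tangential parts. *)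
Definition bil (H : 'M[R]_n) u v : R := (u *m H *m v^T) 0 0.

Lemma bilE H u v : bil H u v = \sum_i \sum_j u 0 i * v 0 j * H i j.
Proof.
rewrite /bil mxE exchange_big /=; apply: eq_bigr => j _.
rewrite !mxE mulr_suml; apply: eq_bigr => i _; ring.
Qed.

Lemma bil_rows m1 m2 (M : 'M[R]_(m1, n)) (N : 'M[R]_(m2, n)) H i j :
  (M *m H *m N^T) i j = bil H (row i M) (row j N).
Proof.
rewrite /bil -row_mul !mxE; by apply: eq_bigr => k _; rewrite !mxE.
Qed.

Lemma sum_delta (a : 'I_n -> R) i : \sum_j a j * (i == j)%:R = a i.
Proof.
rewrite (bigD1 i) //= eqxx mulr1 big1 ?addr0 // => j ji.
by rewrite eq_sym (negbTE ji) mulr0.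
Qed.

Lemma dotp_delta u i : dotp u (delta_mx 0 i) = u 0 i.
Proof.
rewrite -(sum_delta (fun j => u 0 j) i); apply: eq_bigr => j _.
by rewrite mxE eqxx eq_sym.
Qed.

Lemma bil_1 u v : bil 1%:M u v = dotp u v.
Proof. by rewrite /bil mulmx1 dotpE. Qed.

Lemma bil_tensor x y u v : bil (x^T *m y) u v = dotp u x * dotp v y.
Proof.
rewrite /bil mulmxA -mulmxA mxE big_ord1 -!dotpE; congr (_ * _).
by rewrite dotpC !dotpE.
Qed.

Lemma bilD H1 H2 u v : bil (H1 + H2) u v = bil H1 u v + bil H2 u v.
Proof. by rewrite /bil mulmxDr mulmxDl mxE. Qed.

Lemma bilZ k H u v : bil (k *: H) u v = k * bil H u v.
Proof. by rewrite /bil -scalemxAr -scalemxAl mxE. Qed.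

Lemma bilN H u v : bil (- H) u v = - bil H u v.
Proof. by rewrite -scaleN1r bilZ mulN1r. Qed.

Definition pd_mx (g : 'rV[R]_n -> 'M[R]_n) x (l : 'I_n) : 'M[R]_n :=
  \matrix_(i, j) pd l (fun y => g y i j) x.

Definition dmetric (g : 'rV[R]_n -> 'M[R]_n) x a b c : R :=
  \sum_l a 0 l * bil (pd_mx g x l) b c.

(** Only contractions of the Christoffel symbols occur: in the Hessian y is the gradient
    of the function, in the second fundamental form the covector of the normal. *)
Definition gamma_form (g : 'rV[R]_n -> 'M[R]_n) x u v y : R :=
  \sum_i \sum_j u 0 i * v 0 j * (\sum_k christoffel g x k i j * y 0 k).

(** Koszul's formula.  The only trace of the inverse metric is the vector Y dual to y,
    for which a closed form is available. *)
Lemma gamma_formE g x u v y (Y : 'rV[R]_n) : Y = y *m invmx (g x) ->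
  gamma_form g x u v y =
  2^-1 * (dmetric g x u v Y + dmetric g x v u Y - dmetric g x Y u v).
Proof.
move=> YE; pose D i j k := pd i (fun z => g z j k) x.
have inner_sum i j : \sum_k christoffel g x k i j * y 0 k =
    2^-1 * \sum_l Y 0 l * (D i j l + D j i l - D l i j).
  rewrite /christoffel; under eq_bigr do rewrite -mulrA mulr_suml.
  rewrite -mulr_sumr exchange_big; congr (_ * _); apply: eq_bigr => l _.
  rewrite YE mxE mulr_suml; apply: eq_bigr => k _; rewrite -/(D i j l) -/(D j i l) -/(D l i j).
  by rewrite mulrAC [in RHS](mulrC (y 0 k)).
have E1 : dmetric g x u v Y = \sum_i \sum_j \sum_l u 0 i * v 0 j * (Y 0 l * D i j l).
  apply: eq_bigr => i _; rewrite bilE mulr_sumr; apply: eq_bigr => j _.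
  rewrite mulr_sumr; apply: eq_bigr => l _; rewrite mxE -/(D i j l) !mulrA //.
have E2 : dmetric g x v u Y = \sum_i \sum_j \sum_l u 0 i * v 0 j * (Y 0 l * D j i l).
  rewrite exchange_big; apply: eq_bigr => i _; rewrite bilE mulr_sumr.
  apply: eq_bigr => j _; rewrite mulr_sumr; apply: eq_bigr => l _.
  by rewrite mxE -/(D i j l) !mulrA; congr (_ * _ * _); rewrite mulrC.
have E3 : dmetric g x Y u v = \sum_i \sum_j \sum_l u 0 i * v 0 j * (Y 0 l * D l i j).
  rewrite /dmetric; under eq_bigr do rewrite bilE mulr_sumr.
  rewrite exchange_big; apply: eq_bigr => i _.
  under eq_bigr do rewrite mulr_sumr.
  rewrite exchange_big; apply: eq_bigr => j _; apply: eq_bigr => l _.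
  by rewrite mxE -/(D l i j) mulrCA.
rewrite E1 E2 E3 /gamma_form mulrBr mulrDr !mulr_sumr -big_split -sumrB /=.
apply: eq_bigr => i _; rewrite !mulr_sumr -big_split -sumrB /=.
apply: eq_bigr => j _; rewrite inner_sum mulrCA !mulr_sumr -big_split -sumrB /=.
by apply: eq_bigr => l _; rewrite -!mulrDr -!mulrBr; congr (_ * _).
Qed.

End Contraction.

Section SpaceFormMetric.
Variables (R : realType) (K : int) (n : nat).
Hypothesis hK : K = -1 \/ K = 0 \/ K = 1.
Implicit Types (x y z u v a b c : 'rV[R]_n.+1) (r : R).

Let g := @space_form_metric R K n.

Definition warp2 (r : R) : R := (phi K r / r) ^+ 2.
(** With this coefficient the metric is warp2 I + radial2 x^T x, polynomial in x apart
    from functions of |x|, which is easier to differentiate than the form with dir x. *)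
Definition radial2 (r : R) : R := (1 - warp2 r) / r ^+ 2.
Definition dwarp2 (r : R) : R := 2 * phi K r * (dphi K r * r - phi K r) / r ^+ 3.
Definition dradial2 (r : R) : R := - dwarp2 r / r ^+ 2 - 2 * (1 - warp2 r) / r ^+ 3.

Lemma space_form_metricE x : x != 0 ->
  g x = warp2 (enorm x) *: 1%:M + radial2 (enorm x) *: (x^T *m x).
Proof.
move=> x0; rewrite /g /space_form_metric (negbTE x0) /dir (negbTE x0) -/(warp2 _).
have -> : ((enorm x)^-1 *: x)^T *m ((enorm x)^-1 *: x) = (enorm x)^-1 ^+ 2 *: (x^T *m x).
  by rewrite [(_ *: x)^T]linearZ /= -scalemxAl -scalemxAr scalerA expr2.
rewrite scalerBr scalerA.
rewrite addrCA -scalerBl; congr (_ + _ *: _).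
by rewrite /radial2 mulrBl mul1r exprVn.
Qed.

Lemma inner_space_form x u v : x != 0 ->
  inner g x u v = warp2 (enorm x) * dotp u v + radial2 (enorm x) * (dotp u x * dotp v x).
Proof.
move=> x0; rewrite -[LHS]/(bil (g x) u v) space_form_metricE // bilD !bilZ.
by rewrite bil_1 bil_tensor.
Qed.

Lemma is_derive_warp2 r : r != 0 -> is_derive r 1 warp2 (dwarp2 r).
Proof.
move=> r0; have dp := is_derive_phi hK r.
have E : warp2 = fun r => phi K r * r^-1 * (phi K r * r^-1).
  by apply/funext => t; rewrite /warp2 expr2.
have di := is_deriveV (f := id) r0 (is_derive_id r 1).
rewrite E; apply: is_derive_eq.
rewrite /dwarp2 !/(_ *: _) /=.
by field.
Qed.

Lemma is_derive_radial2 r : r != 0 -> is_derive r 1 radial2 (dradial2 r).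
Proof.
move=> r0; have dw := is_derive_warp2 r0.
have E : radial2 = fun r => (1 - warp2 r) * (r^-1 * r^-1).
  by apply/funext => t; rewrite /radial2 expr2 invfM.
have di := is_deriveV (f := id) r0 (is_derive_id r 1).
rewrite E; apply: is_derive_eq.
rewrite /dradial2 !/(_ *: _) /=.
by field.
Qed.

Lemma warp2_gt0 r : 0 < phi K r -> 0 < r -> 0 < warp2 r.
Proof. by move=> p0 r0; rewrite exprn_gt0 // divr_gt0. Qed.

Lemma pd_mx_space_form r z l : 0 < r -> usphere z ->
  pd_mx g (r *: z) l = (dwarp2 r * z 0 l) *: 1%:M
    + (dradial2 r * r ^+ 2 * z 0 l) *: (z^T *m z)
    + (radial2 r * r) *: ((delta_mx 0 l)^T *m z + z^T *m delta_mx 0 l).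
Proof.
move=> r0 z1; have x0 : r *: z != 0 by rewrite scaler_eq0 gt_eqF //= usphere_neq0.
have nr := enorm_ray (ltW r0) z1; have rn0 : r != 0 by rewrite gt_eqF.
apply/matrixP => i j; rewrite mxE.
pose w := fun y : 'rV[R]_n.+1 => warp2 (enorm y) * (i == j)%:R
    + radial2 (enorm y) * (y 0 i * y 0 j).
have E : \forall y \near (r *: z), w y = g y i j.
  have : nbhs (r *: z) [set y | y != 0] by apply: open_nbhs_nbhs; split; [exact: open_neq0|].
  apply: filterS => y y0; rewrite space_form_metricE // !mxE /w.
  by rewrite big_ord1 !mxE.
have dc k := is_derive_coord (r *: z) l k.
have de := is_derive_enorm (delta_mx 0 l) x0.
have dn : dotp (r *: z) (delta_mx 0 l) / enorm (r *: z) = z 0 l.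
  by rewrite nr dotpZl dotp_delta mulrC mulKf.
rewrite dn in de.
have dw : is_derive (r *: z) (delta_mx 0 l) (warp2 \o @enorm R n.+1) (dwarp2 r * z 0 l).
  by apply: is_derive_outer de; rewrite nr; exact: is_derive_warp2.
have dr : is_derive (r *: z) (delta_mx 0 l) (radial2 \o @enorm R n.+1) (dradial2 r * z 0 l).
  by apply: is_derive_outer de; rewrite nr; exact: is_derive_radial2.
rewrite /pd -(near_eq_derive _ E).
have D : is_derive (r *: z) (delta_mx 0 l)
    ((warp2 \o @enorm R n.+1) * (fun=> (i == j)%:R) +
     (radial2 \o @enorm R n.+1) * ((fun y : 'rV[R]_n.+1 => y 0 i) * (fun y : 'rV[R]_n.+1 => y 0 j)))
   (warp2 r *: 0 + (i == j)%:R *: (dwarp2 r * z 0 l) +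
    (radial2 r *: ((r * z 0 i) *: (l == j)%:R + (r * z 0 j) *: (l == i)%:R) +
      (r * z 0 i * (r * z 0 j)) *: (dradial2 r * z 0 l))).
  have d0 : is_derive (r *: z) (delta_mx 0 l) (fun _ : 'rV[R]_n.+1 => (i == j)%:R : R) 0.
    exact: is_derive_cst.
  have := is_deriveD (is_deriveM dw d0) (is_deriveM dr (is_deriveM (dc i) (dc j))).
  by rewrite !fctE /= !nr !mxE.
case: D => _ ->.
rewrite !mxE !big_ord1 !mxE !/(_ *: _) /= ?eqxx /= (eq_sym i l) (eq_sym j l).
by ring.
Qed.

Lemma dmetric_space_form r z a b c : 0 < r -> usphere z ->
  dmetric g (r *: z) a b c = dwarp2 r * dotp a z * dotp b c
    + dradial2 r * r ^+ 2 * dotp a z * (dotp b z * dotp c z)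
    + radial2 r * r * (dotp a b * dotp c z + dotp b z * dotp a c).
Proof.
move=> r0 z1; rewrite /dmetric.
under eq_bigr do rewrite pd_mx_space_form // !bilD !bilZ bilD bil_1 !bil_tensor !dotp_delta.
rewrite (_ : dotp a z = \sum_l a 0 l * z 0 l) // (_ : dotp a b = \sum_l a 0 l * b 0 l) //.
rewrite (_ : dotp a c = \sum_l a 0 l * c 0 l) //.
rewrite !(mulr_sumr, mulr_suml) -!big_split /= !(mulr_sumr, mulr_suml) -!big_split /=.
by apply: eq_bigr => l _; ring.
Qed.

(** The line of z and its orthogonal complement are eigenspaces of the metric, for the
    eigenvalues 1 and phi(r)^2 / r^2. *)
Lemma invmx_space_form r z y : 0 < r -> 0 < phi K r -> usphere z ->
  dotp z y *: z + (warp2 r)^-1 *: (y - dotp z y *: z) = y *m invmx (g (r *: z)).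
Proof.
move=> r0 p0 z1; have x0 : r *: z != 0 by rewrite scaler_eq0 gt_eqF //= usphere_neq0.
have nr := enorm_ray (ltW r0) z1.
have zz : z *m z^T = 1%:M.
  by rewrite [LHS]mx11_scalar -dotpE -enorm_sqr z1 expr1n.
have gE : g (r *: z) = warp2 r *: 1%:M + (1 - warp2 r) *: (z^T *m z).
  rewrite space_form_metricE // nr; congr (_ + _).
  rewrite [(_ *: z)^T]linearZ /= -scalemxAl -scalemxAr !scalerA /radial2; congr (_ *: _).
  by field; rewrite gt_eqF.
have w0 : warp2 r != 0 by rewrite gt_eqF // warp2_gt0.
have zP : z *m (z^T *m z) = z by rewrite mulmxA zz mul1mx.
have yP : y *m (z^T *m z) = dotp z y *: z.
  by rewrite mulmxA [y *m _]mx11_scalar -dotpE mul_scalar_mx dotpC.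
have zg : z *m g (r *: z) = z.
  by rewrite gE mulmxDr -!scalemxAr mulmx1 zP -scalerDl addrC subrK scale1r.
have yg : (y - dotp z y *: z) *m g (r *: z) = warp2 r *: (y - dotp z y *: z).
  rewrite mulmxBl -scalemxAl zg gE mulmxDr -!scalemxAr mulmx1 yP scalerBr !scalerA.
  by rewrite -addrA; congr (_ + _); rewrite mulrBl mul1r scalerBl addrAC subrr add0r.
have gu : g (r *: z) \in unitmx.
  have : g (r *: z) *m (z^T *m z + (warp2 r)^-1 *: (1%:M - z^T *m z)) = 1%:M.
    rewrite gE mulmxDl -!scalemxAl mul1mx mulmxDr -scalemxAr mulmxBr mulmx1.
    rewrite -mulmxA zP subrr scaler0 addr0 scalerDr scalerA mulfV // scale1r.
    rewrite addrC addrA -scalerDl subrK scale1r addrC subrK //.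
  by case/mulmx1_unit.
apply: (can_inj (mulmxK gu)); rewrite mulmxKV // mulmxDl -!scalemxAl zg yg scalerA.
by rewrite mulVf // scale1r addrC subrK.
Qed.

(** The coefficients compare the symbols phi'/phi and - phi phi' of polar coordinates
    with their flat values 1/r and - r, rescaled to Cartesian vectors; both vanish for
    phi(r) = r. *)
Lemma gamma_space_form r z u v y : 0 < r -> 0 < phi K r -> usphere z ->
  gamma_form g (r *: z) u v y =
  (dphi K r / phi K r - r^-1) *
     (dotp z u * (dotp y v - dotp z y * dotp z v) + dotp z v * (dotp y u - dotp z y * dotp z u))
  + (r^-1 - phi K r * dphi K r / r ^+ 2) * dotp z y * (dotp u v - dotp z u * dotp z v).
Proof.
move=> r0 p0 z1; rewrite (gamma_formE u v (invmx_space_form y r0 p0 z1)).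
rewrite !dmetric_space_form //.
rewrite !(dotpDl, dotpDr, dotpZl, dotpZr, dotpNl, dotpNr).
have zz : dotp z z = 1 by rewrite -enorm_sqr z1 expr1n.
rewrite zz (dotpC u z) (dotpC v z) (dotpC y z) (dotpC v u) (dotpC v y) (dotpC u y).
have rn : r != 0 by rewrite gt_eqF.
have pn : phi K r != 0 by rewrite gt_eqF.
rewrite /dradial2 /radial2 /dwarp2 /warp2.
move: (dotp z u) (dotp z v) (dotp z y) (dotp u v) (dotp y u) (dotp y v) (dphi K r) (phi K r) pn.
move=> zu zv zy uv yu yv d p pn.
by field; rewrite rn pn.
Qed.

End SpaceFormMetric.

(** * Homogeneous functions and covariant Hessians *)

Section Hessians.
Variables (R : realType) (n : nat).
Implicit Types (f F G : 'rV[R]_n.+1 -> R) (x y z u v : 'rV[R]_n.+1) (r t c : R).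

Let e i : 'rV[R]_n.+1 := delta_mx 0 i.
Let X0 := [set x : 'rV[R]_n.+1 | x != 0].

Definition grad f x : 'rV[R]_n.+1 := \row_i pd i f x.
Definition hess0 f x : 'M[R]_n.+1 := \matrix_(i, j) pd i (pd j f) x.

Lemma bil_hessian (g : 'rV[R]_n.+1 -> 'M[R]_n.+1) f x u v :
  bil (hessian g f x) u v = bil (hess0 f x) u v - gamma_form g x u v (grad f x).
Proof.
rewrite !bilE /gamma_form -sumrB; apply: eq_bigr => i _.
rewrite -sumrB; apply: eq_bigr => j _; rewrite !mxE mulrBr; congr (_ - _ * _).
by apply: eq_bigr => k _; rewrite mxE.
Qed.

Lemma bil_sym (H : 'M[R]_n.+1) u v : H^T = H -> bil H u v = bil H v u.
Proof.
move=> HT; rewrite /bil.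
have -> : v *m H *m u^T = (u *m H *m v^T)^T by rewrite !trmx_mul !trmxK HT mulmxA.
by rewrite [RHS]mxE.
Qed.

Lemma hess0_sym f x : Ck 2 X0 f -> x != 0 -> (hess0 f x)^T = hess0 f x.
Proof.
move=> cf x0; apply/matrixP => i j; rewrite !mxE.
exact: (pd_sym _ _ (@open_neq0 R n.+1) cf x0).
Qed.

Lemma derive_grad f x v : differentiable f x -> 'D_v f x = dotp v (grad f x).
Proof. by move=> df; rewrite derive_pd //; apply: eq_bigr => i _; rewrite mxE. Qed.

Lemma near_neq0 x : x != 0 -> \forall y \near x, y != 0.
Proof. by move=> x0; apply: open_nbhs_nbhs; split; [exact: open_neq0|]. Qed.

(** Differentiation lowers the degree of homogeneity by one. *)
Lemma pd_scale G c t x i : 0 < t -> (forall y, y != 0 -> G (t *: y) = c * G y) ->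
  x != 0 -> derivable G x (e i) -> pd i G (t *: x) = c / t * pd i G x.
Proof.
move=> t0 hG x0 dG; have tx0 : t *: x != 0 by rewrite scaler_eq0 gt_eqF.
have E : \forall y \near (t *: x), c * G (t^-1 *: y) = G y.
  apply: filterS (near_neq0 tx0) => y y0.
  by rewrite -hG ?scaler_eq0 ?invr_eq0 ?gt_eqF // scalerA mulfV ?scale1r // gt_eqF.
have D : is_derive (t *: x) (e i) (fun y => c * G (t^-1 *: y)) (c / t * pd i G x).
  apply/is_derive_line.
  have /is_derive_line Dl := derivableP dG.
  have -> : (fun h : R => c * G (t^-1 *: (h *: e i + t *: x))) =
      (fun h => c * ((fun h => G (h *: e i + x)) \o (fun h => h * t^-1)) h).
    apply/funext => h /=; rewrite scalerDr !scalerA mulVf ?gt_eqF // scale1r.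
    by rewrite (mulrC t^-1).
  have Dl' : is_derive (0 * t^-1) 1 (fun h : R => G (h *: e i + x)) (pd i G x).
    by rewrite mul0r.
  have Ds : is_derive (0 : R) 1 (fun h : R => h * t^-1) t^-1.
    by apply: is_derive_eq; rewrite scaler0 add0r [_%:A]mulr1.
  have Dc := @is_derive1_comp R _ (fun h : R => h * t^-1) 0 _ _ Dl' Ds.
  apply: is_derive_eq.
  by rewrite /(_ *: _) /= mulrA mulrAC.
by rewrite /pd -(near_eq_derive _ E); case: D.
Qed.

Section DegreeZero.
Variable F : 'rV[R]_n.+1 -> R.
Hypothesis F_smooth : Ck 2 X0 F.
Hypothesis F_hom : forall t x, 0 < t -> x != 0 -> F (t *: x) = F x.

Let oX0 := @open_neq0 R n.+1.

(** F is constant along rays. *)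
Lemma euler0 x : x != 0 -> dotp x (grad F x) = 0.
Proof.
move=> x0; have dF : differentiable F x by exact: Ck_differentiable oX0 F_smooth x0.
rewrite -derive_grad //.
have D : is_derive (0 : R) 1 (fun h : R => F (h *: x + x)) 0.
  apply: (near_eq_is_derive (f := fun=> F x)).
    have : (0 : R) > -1 by lra.
    move/lt_nbhsr; apply: filterS => h h1; have -> : h *: x + x = (h + 1) *: x by rewrite scalerDl scale1r.
    by rewrite F_hom // -ltrBlDr sub0r.
by have [_ ->] := (is_derive_line F x x 0).2 D.
Qed.

(** Euler's relation for F, differentiated once more. *)
Lemma euler0_hess x u : x != 0 -> bil (hess0 F x) u x = - dotp u (grad F x).
Proof.
move=> x0.
have E i : \sum_k x 0 k * pd i (pd k F) x = - pd i F x.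
  have D : is_derive x (e i) (\sum_(k < n.+1) (fun y : 'rV[R]_n.+1 => y 0 k * pd k F y))
     (\sum_(k < n.+1) (x 0 k * pd i (pd k F) x + pd k F x * (i == k)%:R)).
    apply: is_derive_sum => k.
    have d1 := Ck_is_derive i (Ck_pd k F_smooth) x0.
    have d2 := is_derive_coord x i k.
    exact: is_deriveM.
  have : 'D_(e i) (\sum_(k < n.+1) (fun y : 'rV[R]_n.+1 => y 0 k * pd k F y)) x = 0.
    rewrite -(derive_cst (0 : R) x (e i)); apply: near_eq_derive.
    apply: filterS (near_neq0 x0) => y y0; rewrite fct_sumE -[RHS](euler0 y0).
    by apply: eq_bigr => k _; rewrite mxE.
  case: D => _ ->; rewrite big_split /= sum_delta => /eqP.
  by rewrite addr_eq0 => /eqP.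
rewrite bilE /dotp -sumrN; apply: eq_bigr => i _.
under eq_bigr do rewrite -mulrA mxE.
by rewrite -mulr_sumr E mxE mulrN.
Qed.

Lemma euler0_hess_l x u : x != 0 -> bil (hess0 F x) x u = - dotp u (grad F x).
Proof. by move=> x0; rewrite bil_sym ?hess0_sym // euler0_hess. Qed.

Lemma grad_scale t x : 0 < t -> x != 0 -> grad F (t *: x) = t^-1 *: grad F x.
Proof.
move=> t0 x0; apply/rowP => i; rewrite !mxE (@pd_scale _ 1) ?mul1r //.
  by move=> y y0; rewrite mul1r F_hom.
exact: Ck_derivable F_smooth x0.
Qed.

Lemma hess0_scale t x : 0 < t -> x != 0 -> hess0 F (t *: x) = t^-2 *: hess0 F x.
Proof.
move=> t0 x0; apply/matrixP => i j; rewrite !mxE (@pd_scale _ t^-1) //.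
- by rewrite expr2 invfM.
- by move=> y y0; have /rowP/(_ j) := grad_scale t0 y0; rewrite !mxE.
- exact: Ck_derivable (Ck_pd j F_smooth) x0.
Qed.

End DegreeZero.
End Hessians.

(** * The covariant Hessian of b *)

Section HessianOfB.
Variables (R : realType) (K : int) (n : nat) (rho : 'rV[R]_n.+1 -> R).
Hypothesis hK : K = -1 \/ K = 0 \/ K = 1.
Hypothesis rho_smooth : smooth_on_sphere rho.
Hypothesis rho_range : forall z, usphere z -> 0 < rho z /\ in_radius K (rho z).
Implicit Types (x y z u v : 'rV[R]_n.+1) (r t : R).

Let e i : 'rV[R]_n.+1 := delta_mx 0 i.
Let X0 := [set x : 'rV[R]_n.+1 | x != 0].
Let g := @space_form_metric R K n.
Let b := bfun K rho.
Let C := cot_rho K rho.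

Let C_smooth k : Ck k X0 C.
Proof. exact: Ck_cot_rho. Qed.

Lemma cot_rho_hom t x : 0 < t -> x != 0 -> C (t *: x) = C x.
Proof. by move=> t0 x0; rewrite /C /cot_rho dirZ. Qed.

(** The derivative of b in the direction z; the second term is - phi''(r). *)
Definition radial_b x : R := dphi K (enorm x) * C x + K%:~R * phi K (enorm x).

Let is_derive_enorm_e x i : x != 0 -> is_derive x (e i) (@enorm R n.+1) (x 0 i / enorm x).
Proof. by move=> x0; have := is_derive_enorm (e i) x0; rewrite dotp_delta. Qed.

Lemma is_derive_bfun x i : x != 0 ->
  is_derive x (e i) b (radial_b x * (x 0 i / enorm x) + phi K (enorm x) * pd i C x).
Proof.
move=> x0; have de := is_derive_enorm_e i x0.
have dC := Ck_is_derive i (C_smooth 1) x0.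
have dp := is_derive_outer (is_derive_phi hK _) de.
have dd := is_derive_outer (is_derive_dphi hK _) de.
have -> : b = (phi K \o @enorm R n.+1) * C - (dphi K \o @enorm R n.+1).
  by apply/funext => y; rewrite /b bfunE.
apply: (is_derive_eq (is_deriveB (is_deriveM dp dC) dd)).
rewrite /radial_b !/(_ *: _) /=; move: (C x) (pd i C x) (_ / _) => c dc q; ring.
Qed.

(** Product rule for the gradient of b given by [is_derive_bfun], the derivative of
    x/|x| being (I - z^T z)/r. *)
Lemma hess0_bfun r z : 0 < r -> usphere z ->
  hess0 b (r *: z) = (K%:~R * (dphi K r - phi K r * C (r *: z))) *: (z^T *m z)
   + dphi K r *: ((grad C (r *: z))^T *m z + z^T *m grad C (r *: z))
   + (radial_b (r *: z) / r) *: (1%:M - z^T *m z) + phi K r *: hess0 C (r *: z).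
Proof.
move=> r0 z1; have x0 : r *: z != 0 by rewrite scaler_eq0 gt_eqF //= usphere_neq0.
have nr := enorm_ray (ltW r0) z1; have rn0 : r != 0 by rewrite gt_eqF.
apply/matrixP => i j; rewrite mxE.
have E : \forall y \near (r *: z),
    radial_b y * (y 0 j / enorm y) + phi K (enorm y) * pd j C y = pd j b y.
  by apply: filterS (near_neq0 x0) => y y0; case: (is_derive_bfun j y0).
have zi k : (r *: z) 0 k / r = z 0 k by rewrite mxE mulrC mulKf.
have de : is_derive (r *: z) (e i) (@enorm R n.+1) (z 0 i).
  by have := is_derive_enorm_e i x0; rewrite nr zi.
have dC := Ck_is_derive i (C_smooth 1) x0.
have dCj := Ck_is_derive i (Ck_pd j (C_smooth 2)) x0.
have dp : is_derive (r *: z) (e i) (phi K \o @enorm R n.+1) (dphi K r * z 0 i).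
  by apply: is_derive_outer de; rewrite nr; exact: is_derive_phi.
have dd : is_derive (r *: z) (e i) (dphi K \o @enorm R n.+1) (- K%:~R * phi K r * z 0 i).
  by apply: is_derive_outer de; rewrite nr; exact: is_derive_dphi.
have di : is_derive (r *: z) (e i) (GRing.inv \o @enorm R n.+1) (- r ^- 2 * z 0 i).
  apply: is_derive_outer de; rewrite nr.
  by apply: (is_derive_eq (is_deriveV (f := id) rn0 (is_derive_id r 1))); rewrite [_%:A]mulr1.
have dj := is_derive_coord (r *: z) i j.
have dk : is_derive (r *: z) (e i) (fun _ : 'rV[R]_n.+1 => K%:~R : R) 0.
  exact: is_derive_cst.
have D := is_deriveD (is_deriveM (is_deriveD (is_deriveM dd dC) (is_deriveM dk dp))
   (is_deriveM dj di)) (is_deriveM dp dCj).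
rewrite [LHS]/pd -(near_eq_derive _ E).
case: D => _ ->.
rewrite !mxE !big_ord1 !mxE /= /radial_b nr !fctE /= nr ![(r *: z) 0 _]mxE !/(_ *: _) /=.
move: (C _) (pd i C _) (pd j C _) (pd i (pd j C) _) (phi K r) (dphi K r) => c ci cj cij p d.
by field.
Qed.

(** The term in D^2 C carries all the second derivatives of rho; the multiple of z z^T
    is - K b because phi'' = - K phi. *)
Lemma hessian_bfun r z u v : 0 < r -> 0 < phi K r -> usphere z ->
  bil (hessian g b (r *: z)) u v =
    - K%:~R * b (r *: z) * (dotp z u * dotp z v)
    + radial_b (r *: z) * (phi K r * dphi K r / r ^+ 2) * (dotp u v - dotp z u * dotp z v)
    + phi K r / r * (dotp z u * dotp v (grad C (r *: z)) + dotp z v * dotp u (grad C (r *: z)))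
    + phi K r * bil (hess0 C (r *: z)) u v.
Proof.
move=> r0 p0 z1; have x0 : r *: z != 0 by rewrite scaler_eq0 gt_eqF //= usphere_neq0.
have nr := enorm_ray (ltW r0) z1; have rn0 : r != 0 by rewrite gt_eqF.
have zz : dotp z z = 1 by rewrite -enorm_sqr z1 expr1n.
rewrite bil_hessian hess0_bfun // !(bilD, bilZ, bilN, bil_tensor) bil_1.
rewrite gamma_space_form //.
have gb : grad b (r *: z) = radial_b (r *: z) *: z + phi K r *: grad C (r *: z).
  apply/rowP => i; rewrite mxE [pd i b _]/pd; case: (is_derive_bfun i x0) => _ ->.
  by rewrite nr !mxE; congr (_ * _ + _); rewrite mulrC mulKf.
have zC : dotp z (grad C (r *: z)) = 0.
  have := euler0 (C_smooth 2) cot_rho_hom x0; rewrite dotpZl => /eqP.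
  by rewrite mulf_eq0 (negbTE rn0) /= => /eqP.
rewrite gb !(dotpDl, dotpDr, dotpZl, dotpZr) zC zz !(dotpC (grad C _)) (dotpC u z) (dotpC v z).
have -> : b (r *: z) = phi K r * C (r *: z) - dphi K r by rewrite /b (bfunE hK rho_range) nr.
have := phi_pyth hK r; have pn : phi K r != 0 by rewrite gt_eqF.
move: (radial_b _) (C _) (dotp u (grad C _)) (dotp v (grad C _)) (bil _ u v).
move: (dotp z u) (dotp z v) (dotp u v) (phi K r) (dphi K r) (K%:~R : R) pn.
move=> zu zv uv p d k pn s c cu cv cuv pyth.
by field; rewrite rn0 pn.
Qed.

(** By [phi_pyth], phi'(r) (phi'(r) C + K phi(r)) = C - K b phi(r), which is where the
    term - K b comes from in the tangential directions. *)
Lemma hessian_bfun_tangential r z u v : 0 < r -> 0 < phi K r -> usphere z ->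
  dotp z u = 0 -> dotp z v = 0 ->
  bil (hessian g b (r *: z)) u v = phi K r / r ^+ 2 *
    (bil (hess0 C z) u v + (C z - K%:~R * b (r *: z) * phi K r) * dotp u v).
Proof.
move=> r0 p0 z1 zu zv; have rn0 : r != 0 by rewrite gt_eqF.
rewrite hessian_bfun // zu zv !mul0r !mulr0 addr0 subr0 add0r.
have z0 := usphere_neq0 z1.
rewrite (hess0_scale (C_smooth 2) cot_rho_hom r0 z0) bilZ.
rewrite /b (bfunE hK rho_range) /radial_b -/C !(cot_rho_hom r0 z0) (enorm_ray (ltW r0) z1).
have := phi_pyth hK r; have pn : phi K r != 0 by rewrite gt_eqF.
move: (C z) (bil _ u v) (dotp u v).
move: (phi K r) (dphi K r) (K%:~R : R) pn.
move=> p d k pn c cuv uv pyth.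
have E : d ^+ 2 * c = c - k * p ^+ 2 * c
  by have -> : d ^+ 2 = 1 - k * p ^+ 2 by [rewrite -pyth addrK]; ring.
have -> : (d * c + k * p) * (p * d / r ^+ 2) * uv
   = p / r ^+ 2 * ((d ^+ 2 * c + k * p * d) * uv) by field.
by rewrite E mulr0 addr0; field.
Qed.

(** The contribution phi(r)/r <u, grad C> of the gradient of C cancels against the one
    of D^2 C by Euler's relation. *)
Lemma hessian_bfun_mixed r z u : 0 < r -> 0 < phi K r -> usphere z -> dotp z u = 0 ->
  bil (hessian g b (r *: z)) u z = 0 /\ bil (hessian g b (r *: z)) z u = 0.
Proof.
move=> r0 p0 z1 zu; have rn0 : r != 0 by rewrite gt_eqF.
have z0 := usphere_neq0 z1.
have x0 : r *: z != 0 by rewrite scaler_eq0 gt_eqF.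
have zz : dotp z z = 1 by rewrite -enorm_sqr z1 expr1n.
have gs := grad_scale (C_smooth 2) cot_rho_hom r0 z0.
have zC := euler0 (C_smooth 2) cot_rho_hom z0.
have h1 := euler0_hess (C_smooth 2) cot_rho_hom u z0.
have h2 := euler0_hess_l (C_smooth 2) cot_rho_hom u z0.
rewrite !hessian_bfun // (hess0_scale (C_smooth 2) cot_rho_hom r0 z0) !bilZ h1 h2 gs.
rewrite !dotpZr zC zu zz (dotpC u z) zu.
by split; field.
Qed.

Lemma hessian_bfun_radial r z : 0 < r -> 0 < phi K r -> usphere z ->
  bil (hessian g b (r *: z)) z z = - K%:~R * b (r *: z).
Proof.
move=> r0 p0 z1; have rn0 : r != 0 by rewrite gt_eqF.
have z0 := usphere_neq0 z1.
have zz : dotp z z = 1 by rewrite -enorm_sqr z1 expr1n.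
have gs := grad_scale (C_smooth 2) cot_rho_hom r0 z0.
have zC := euler0 (C_smooth 2) cot_rho_hom z0.
rewrite hessian_bfun // (hess0_scale (C_smooth 2) cot_rho_hom r0 z0) bilZ gs dotpZr.
rewrite (euler0_hess (C_smooth 2) cot_rho_hom z z0) zC zz.
by field.
Qed.

End HessianOfB.

(** * Normal coordinates of the sphere *)

Section Sinc.
Variable R : realType.
Implicit Types (h c : R).

(** Continuous extension to h = 0 of the coefficient in [normal_param]; there the
    quotient sin h / h is 0 by convention, but it then multiplies the vector 0. *)
Definition sinc h : R := if h == 0 then 1 else sin h / h.

Lemma sinc_mul h : sinc h * h = sin h.
Proof. by rewrite /sinc; case: eqP => [->|/eqP h0]; rewrite ?mulr0 ?sin0 // divfK. Qed.

Let sin_within h : {within `[0, h], continuous (@sin R)}.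
Proof. by apply: continuous_subspaceT => x; exact: continuous_sin. Qed.

Let cos_within h : {within `[0, h], continuous (@cos R)}.
Proof. by apply: continuous_subspaceT => x; exact: continuous_cos. Qed.

Lemma sin_le_id h : 0 <= h -> `|sin h| <= h.
Proof.
move=> h0; have [c _] := @MVT_segment R sin cos 0 h h0 (fun x _ => is_derive_sin x) (@sin_within h).
by rewrite sin0 !subr0 => ->; rewrite normrM (ger0_norm h0) ler_piMl // cos_max.
Qed.

Lemma cos_sub1_le h : 0 <= h -> `|cos h - 1| <= h ^+ 2.
Proof.
move=> h0; have [c] := @MVT_segment R cos (fun x => - sin x) 0 h h0 (fun x _ => is_derive_cos x) (@cos_within h).
rewrite in_itv /= => /andP[c0 ch].
rewrite cos0 subr0 => ->; rewrite normrM normrN (ger0_norm h0) expr2 ler_wpM2r //.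
exact: le_trans (sin_le_id c0) ch.
Qed.

Lemma sin_sub_le h : 0 <= h -> `|sin h - h| <= h ^+ 3.
Proof.
move=> h0; have [c] := @MVT_segment R sin cos 0 h h0 (fun x _ => is_derive_sin x) (@sin_within h).
rewrite in_itv /= => /andP[c0 ch].
rewrite sin0 !subr0 => ->; rewrite -[X in _ - X]mul1r -mulrBl normrM (ger0_norm h0) exprSr.
rewrite ler_wpM2r //; apply: le_trans (cos_sub1_le c0) _.
by rewrite ler_sqr ?nnegrE.
Qed.

(** sin h = h + O(h^3), so the difference quotient of sinc at 0 is O(h). *)
Lemma is_derive_sinc0 : is_derive (0 : R) 1 sinc 0.
Proof.
apply/is_derive1_caratheodory; exists (fun h => (sinc h - 1) / h); split.
- by move=> h; rewrite /sinc eqxx subr0; case: eqP => [->|/eqP h0];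
    rewrite ?subrr ?mul0r // divfK.
- apply/cvgrPdist_le => eps eps0; rewrite /sinc eqxx subrr mul0r.
  near=> h; rewrite sub0r normrN.
  have heps : `|h| <= eps.
    near: h; have /nbhs_ballP := @nbhsx_ballx R R 0 _ eps0.
    move=> [d /= d0 H]; apply/nbhs_ballP; exists d => // h /H.
    by rewrite -ball_normE /= sub0r normrN => /ltW.
  case: eqP => [_|/eqP h0]; first by rewrite subrr mul0r normr0 ltW.
  have -> : (sin h / h - 1) / h = (sin h - h) / h ^+ 2 by field.
  have hle : `|sin h - h| <= `|h| ^+ 3.
    have [hp|hn] := leP 0 h; first by rewrite (ger0_norm hp) sin_sub_le.
    have nh0 : 0 <= - h by rewrite oppr_ge0 ltW.
    by have := sin_sub_le nh0; rewrite sinN -opprD normrN (ltr0_norm hn).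
  rewrite normrM normfV normrX ler_pdivrMr ?exprn_gt0 ?normr_gt0 //.
  apply: le_trans hle _; rewrite exprS ler_wpM2r ?exprn_ge0 //.
- by rewrite invr0 mulr0.
Unshelve. all: by end_near. Qed.

End Sinc.

Section NormalCoordinates.
Variables (R : realType) (p : nat).
Variables (z : 'rV[R]_p.+2) (E : 'M[R]_(p.+1, p.+2)).
Hypothesis z1 : usphere z.
Hypothesis EE : E *m E^T = 1%:M.
Hypothesis Ez : E *m z^T = 0.
Implicit Types (a l i j : 'I_p.+1) (h s : R) (y : 'rV[R]_p.+1).

Let N := normal_param z E.
Let e i : 'rV[R]_p.+1 := delta_mx 0 i.

Lemma dotp_rows a l : dotp (row a E) (row l E) = (a == l)%:R.
Proof. by rewrite -bil_1 -bil_rows mulmx1 EE mxE. Qed.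

Lemma dotp_row_z a : dotp (row a E) z = 0.
Proof.
have /matrixP/(_ a 0) := Ez; rewrite mxE [in X in _ = X -> _]mxE => <-.
by apply: eq_bigr => k _; rewrite !mxE.
Qed.

Lemma dotp_z_row a : dotp z (row a E) = 0.
Proof. by rewrite dotpC dotp_row_z. Qed.

Lemma dotp_zz : dotp z z = 1.
Proof. by rewrite -enorm_sqr z1 expr1n. Qed.

Lemma enorm_mulE y : enorm (y *m E) = enorm y.
Proof.
by rewrite /enorm !dotpE trmx_mul mulmxA -(mulmxA y) EE mulmx1.
Qed.

Lemma normal_paramE y : N y = cos (enorm y) *: z + sinc (enorm y) *: (y *m E).
Proof.
rewrite /N /normal_param enorm_mulE /sinc; case: eqP => [/eqP|//].
by rewrite enorm_eq0 => /eqP ->; rewrite mul0mx !scaler0.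
Qed.

Lemma enorm_normal_param y : enorm (N y) = 1.
Proof.
have zE : dotp z (y *m E) = 0.
  by rewrite dotpC dotpE -mulmxA Ez mulmx0 mxE.
have q : dotp (N y) (N y) = 1.
  rewrite normal_paramE !(dotpDl, dotpDr, dotpZl, dotpZr) (dotpC (y *m E) z) zE dotp_zz.
  rewrite -enorm_sqr enorm_mulE !mulr0 addr0 add0r mulr1 -!expr2 mulrA -!expr2.
  by rewrite -exprMn sinc_mul cos2Dsin2.
by rewrite /enorm q sqrtr1.
Qed.

Lemma normal_param_ray l h : N (h *: e l) = cos h *: z + sin h *: row l E.
Proof.
rewrite normal_paramE enormZ enorm_delta mulr1 cos_norm -scalemxAl -rowE scalerA.
congr (_ + _ *: _); rewrite -sinc_mul; congr (_ * _).
rewrite /sinc normr_eq0; case: eqP => // _.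
have [hp|hn] := leP 0 h; first by rewrite ger0_norm.
by rewrite ltr0_norm // sinN invrN mulrNN.
Qed.

Lemma normal_param0 : N 0 = z.
Proof. by have := normal_param_ray ord0 0; rewrite scale0r cos0 sin0 scale1r scale0r addr0. Qed.

(** The velocity at h e_l of the curve s |-> N (h e_l + s e_a), where N is the
    coordinate map: a rotation if a = l, and otherwise a Jacobi field along the
    geodesic in direction e_l.  First derivatives of N on the axes are enough to compute
    the second derivatives at 0. *)
Definition velocity a l h : 'rV[R]_p.+2 :=
  if a == l then - sin h *: z + cos h *: row a E else sinc h *: row a E.

Lemma velocity0 a l : velocity a l 0 = row a E.
Proof.
by rewrite /velocity /sinc eqxx sin0 cos0 oppr0 scale0r add0r scale1r; case: ifP.
Qed.

(** For a = l the curve runs along a great circle.  For a <> l and h <> 0 the norm of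
    s e_a + h e_l is stationary at s = 0, so cos and sinc contribute nothing. *)
Lemma is_derive_normal_param a l h k :
  is_derive (h *: e l) (e a) (fun y => N y 0 k) (velocity a l h 0 k).
Proof.
apply/is_derive_line.
have same c : is_derive (0 : R) 1 (fun s => (cos (s + c) *: z + sin (s + c) *: row a E) 0 k)
    ((- sin c *: z + cos c *: row a E) 0 k).
  have -> : (fun s => (cos (s + c) *: z + sin (s + c) *: row a E) 0 k) =
      (fun s => cos (s + c) * z 0 k + sin (s + c) * E a k).
    by apply/funext => s; rewrite !mxE.
  apply: is_derive_eq; rewrite !mxE !/(_ *: _) /= !add0r; ring.
rewrite /velocity; case: eqVneq => [<-|al].
  have -> : (fun s => N (s *: e a + h *: e a) 0 k) =
      (fun s => (cos (s + h) *: z + sin (s + h) *: row a E) 0 k).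
    by apply/funext => s; rewrite -scalerDl normal_param_ray.
  exact: same.
have [->|h0] := eqVneq h 0.
  have -> : (fun s => N (s *: e a + 0 *: e l) 0 k) =
      (fun s => (cos (s + 0) *: z + sin (s + 0) *: row a E) 0 k).
    by apply/funext => s; rewrite scale0r !addr0 normal_param_ray.
  apply: (is_derive_eq (same 0)).
  by rewrite sin0 cos0 oppr0 scale0r add0r /sinc eqxx.
pose q s := Num.sqrt (s * s + h ^+ 2).
have nE s : enorm (s *: e a + h *: e l) = q s.
  rewrite /enorm !(dotpDl, dotpDr, dotpZl, dotpZr) !dotp_delta !mxE !eqxx /=.
  by rewrite (eq_sym l a) (negbTE al) !mulr1 !mulr0 addr0 add0r -expr2.
have qh : q 0 = `|h| by rewrite /q mulr0 add0r sqrtr_sqr.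
have qn0 : q 0 != 0 by rewrite qh normr_eq0.
have dq : is_derive (0 : R) 1 q 0.
  have p0 : 0 < 0 * 0 + h ^+ 2 by rewrite mulr0 add0r exprn_even_gt0.
  have := @is_derive1_comp R Num.sqrt (fun s => s * s + h ^+ 2) 0 _ _ (is_derive1_sqrt p0) _.
  have d2 : is_derive (0 : R) 1 (fun s => s * s + h ^+ 2) 0.
    by apply: is_derive_eq; rewrite !scale0r !addr0.
  by move=> /(_ _ d2); rewrite mulr0.
have -> : (fun s => N (s *: e a + h *: e l) 0 k) =
   (fun s => (cos \o q) s * z 0 k + (sin \o q) s * (q s)^-1 * (s * E a k + h * E l k)).
  apply/funext => s; rewrite normal_paramE nE mulmxDl -!scalemxAl -!rowE !mxE /sinc.
  case: eqP => [qs|_]; last by [].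
  have : q s ^+ 2 = 0 by rewrite qs expr0n.
  rewrite sqr_sqrtr ?addr_ge0 ?sqr_ge0 -?expr2 ?sqr_ge0 // => /eqP.
  by rewrite paddr_eq0 ?sqr_ge0 // !sqrf_eq0 (negbTE h0) andbF.
have dc := @is_derive1_comp R cos q 0 _ _ (is_derive_cos _) dq.
have ds := @is_derive1_comp R sin q 0 _ _ (is_derive_sin _) dq.
have di := @is_deriveV R q 0 _ 1 qn0 dq.
apply: is_derive_eq; rewrite !mxE !/(_ *: _) /= !(mulr0, mul0r, add0r, addr0, mulr1).
by congr (_ * _); rewrite qh /sinc (negbTE h0); case: (ger0P h) => // hn; rewrite sinN invrN mulrNN.
Qed.

Lemma coord_vec_normal_param a l h : coord_vec N a (h *: e l) = velocity a l h.
Proof. by apply/rowP => k; rewrite mxE /pd; case: (is_derive_normal_param a l h k). Qed.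

(** Hence the second derivatives of the coordinate map at 0 are - delta_al z, normal to
    the sphere. *)
Lemma is_derive_velocity a l k :
  is_derive (0 : R) 1 (fun h => velocity a l h 0 k) (- (a == l)%:R * z 0 k).
Proof.
rewrite /velocity; case: eqVneq => al.
  have -> : (fun h => (- sin h *: z + cos h *: row a E) 0 k) =
      (fun h => - sin h * z 0 k + cos h * E a k) by apply/funext => h; rewrite !mxE.
  by apply: is_derive_eq; rewrite !/(_ *: _) /= cos0 sin0; ring.
have -> : (fun h => (sinc h *: row a E) 0 k) = (fun h => sinc h * E a k).
  by apply/funext => h; rewrite !mxE.
have ds := is_derive_sinc0 R.
by apply: is_derive_eq; rewrite !/(_ *: _) /=; ring.
Qed.

End NormalCoordinates.

Section NormalCoordinatesCalculus.
Variables (R : realType) (p : nat).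
Variables (z : 'rV[R]_p.+2) (E : 'M[R]_(p.+1, p.+2)).
Hypothesis z1 : usphere z.
Hypothesis EE : E *m E^T = 1%:M.
Hypothesis Ez : E *m z^T = 0.
Implicit Types (a l i j : 'I_p.+1) (h s : R) (y : 'rV[R]_p.+1) (F : 'rV[R]_p.+2 -> R).

Let N := normal_param z E.
Let e i : 'rV[R]_p.+1 := delta_mx 0 i.
Let X0 := [set x : 'rV[R]_p.+2 | x != 0].
Let oX0 := @open_neq0 R p.+2.

Let N0 y : N y != 0.
Proof. by rewrite -enorm_eq0 enorm_normal_param // oner_eq0. Qed.

Lemma is_derive_comp_normal F a l h : differentiable F (N (h *: e l)) ->
  is_derive (h *: e l) (e a) (F \o N) (dotp (velocity z E a l h) (grad F (N (h *: e l)))).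
Proof.
move=> dF; apply/is_derive_line.
have dN k := (is_derive_line _ _ _ _).1 (is_derive_normal_param z EE a l h k).
have dF' : differentiable F (N (0 *: e a + h *: e l)) by rewrite scale0r add0r.
have D := is_derive_curve (c := fun s => N (s *: e a + h *: e l)) dF' dN.
apply: (is_derive_eq D).
by rewrite scale0r add0r; apply: eq_bigr => k _; rewrite mxE.
Qed.

Lemma is_derive_sum_R (f : 'I_p.+2 -> R -> R) (d : 'I_p.+2 -> R) (t : R) :
  (forall k, is_derive t 1 (f k) (d k)) ->
  is_derive t 1 (fun s => \sum_k f k s) (\sum_k d k).
Proof.
move=> H; have -> : (fun s => \sum_k f k s) = \sum_k f k.
  by apply/funext => s; rewrite fct_sumE.
exact: is_derive_sum.
Qed.

Let smooth_differentiable F x : Ck 2 X0 F -> x != 0 -> differentiable F x.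
Proof. by move=> cF x0; exact: Ck_differentiable oX0 cF x0. Qed.

Lemma pd_comp_normal F i j h : Ck 2 X0 F -> pd j (F \o N) (h *: e i) =
  dotp (velocity z E j i h) (grad F (N (h *: e i))).
Proof.
move=> cF; have dF := smooth_differentiable cF (N0 (h *: e i)).
by rewrite /pd; have [_ ->] := is_derive_comp_normal j dF.
Qed.

Lemma is_derive_grad_normal F i j : Ck 2 X0 F ->
  is_derive (0 : R) 1 (fun h => dotp (velocity z E j i h) (grad F (N (h *: e i))))
    (bil (hess0 F z) (row i E) (row j E) - (j == i)%:R * dotp z (grad F z)).
Proof.
move=> cF.
have dkF k x : x != 0 -> differentiable (pd k F) x.
  by move=> x0; exact: Ck_differentiable oX0 (Ck_pd k cF) x0.
have D : is_derive (0 : R) 1 (fun h => dotp (velocity z E j i h) (grad F (N (h *: e i))))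
   (\sum_k (row j E 0 k * dotp (row i E) (grad (pd k F) z)
       + pd k F z * (- (j == i)%:R * z 0 k))).
  apply: is_derive_sum_R => k.
  have dv := is_derive_velocity z E j i k.
  have dk := (is_derive_line _ _ _ _).1 (is_derive_comp_normal i (dkF k _ (N0 (0 *: e i)))).
  have -> : (fun h => velocity z E j i h 0 k * grad F (N (h *: e i)) 0 k) =
     (fun h => velocity z E j i h 0 k) * (fun h => (pd k F \o N) (h *: e i + 0 *: e i)).
    by apply/funext => h; rewrite fctE /= mxE scale0r addr0.
  apply: (is_derive_eq (is_deriveM dv dk)).
  by rewrite /= !scale0r addr0 /N (normal_param0 z EE) !velocity0.
apply: (is_derive_eq D); rewrite big_split /=; congr (_ + _).
  rewrite bilE exchange_big; apply: eq_bigr => k _.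
  rewrite /dotp mulr_sumr; apply: eq_bigr => l _; rewrite !mxE; ring.
rewrite -mulNr /dotp mulr_sumr; apply: eq_bigr => k _; rewrite !mxE; ring.
Qed.

Lemma pd2_comp_normal F i j : Ck 2 X0 F ->
  pd i (pd j (F \o N)) 0 =
  bil (hess0 F z) (row i E) (row j E) - (j == i)%:R * dotp z (grad F z).
Proof.
move=> cF; rewrite {1}/pd.
have D := is_derive_grad_normal i j cF.
have E1 : (fun h => dotp (velocity z E j i h) (grad F (N (h *: e i)))) =
    (fun h : R => pd j (F \o N) (h *: e i + 0)).
  by apply/funext => h; rewrite addr0 pd_comp_normal.
rewrite E1 in D.
by have [_ ->] := (is_derive_line (pd j (F \o N)) 0 (e i) _).2 D.
Qed.

(** The derivative of a scalar product of two coordinate vectors pairs multiples of z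
    with tangent vectors. *)
Lemma pd_sphere_metric0 l a b : pd l (fun y => sphere_metric z E y a b) 0 = 0.
Proof.
have D : is_derive (0 : R) 1 (fun h => sphere_metric z E (h *: e l + 0) a b)
   (\sum_k (row a E 0 k * (- (b == l)%:R * z 0 k) + row b E 0 k * (- (a == l)%:R * z 0 k))).
  have -> : (fun h => sphere_metric z E (h *: e l + 0) a b) =
     (fun h => \sum_k velocity z E a l h 0 k * velocity z E b l h 0 k).
    by apply/funext => h; rewrite addr0 mxE !coord_vec_normal_param.
  apply: is_derive_sum_R => k.
  have da := is_derive_velocity z E a l k.
  have db := is_derive_velocity z E b l k.
  apply: (is_derive_eq (is_deriveM da db)).
  by rewrite !velocity0 !/(_ *: _).
rewrite /pd; have [_ ->] := (is_derive_line (fun y => sphere_metric z E y a b) 0 (e l) _).2 D.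
rewrite big_split /=.
have S c d : \sum_k row c E 0 k * (- d * z 0 k) = - d * dotp (row c E) z.
  by rewrite /dotp mulr_sumr; apply: eq_bigr => k _; ring.
by rewrite !S !dotp_row_z // !mulr0 addr0.
Qed.

(** The Christoffel symbols vanish at the center, since the first derivatives of the
    metric do. *)
Lemma hessian_sphere_metric0 (f : 'rV[R]_p.+1 -> R) i j :
  hessian (sphere_metric z E) f 0 i j = pd i (pd j f) 0.
Proof.
rewrite mxE big1 ?subr0 // => k _; rewrite /christoffel big1 ?mulr0 ?mul0r // => l _.
by rewrite !pd_sphere_metric0 addr0 subr0 mulr0.
Qed.

Variable rho : 'rV[R]_p.+2 -> R.
Hypothesis rho_smooth : smooth_on_sphere rho.

Let Rr := rho \o @dir R p.+1.

Lemma rho_normal_param : rho \o normal_param z E = Rr \o N.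
Proof. by apply/funext => y; rewrite /Rr /= dir_usphere //; exact: enorm_normal_param. Qed.

Lemma rho_dir_hom t x : 0 < t -> x != 0 -> Rr (t *: x) = Rr x.
Proof. by move=> t0 x0; rewrite /Rr /= dirZ. Qed.

Lemma rho_dE i : rho_d rho z E i = dotp (row i E) (grad Rr z).
Proof.
rewrite /rho_d rho_normal_param /pd.
have dF : differentiable Rr (N (0 *: e i)).
  exact: Ck_differentiable oX0 (rho_smooth 1) (N0 _).
have [_] := is_derive_comp_normal i dF.
by rewrite scale0r velocity0 /N normal_param0 // => ->.
Qed.

(** The radial part of the second derivatives of the coordinate map does not contribute,
    by Euler's relation for the degree 0 function rho o dir. *)
Lemma rho_ddE i j : rho_dd rho z E i j = bil (hess0 Rr z) (row i E) (row j E).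
Proof.
rewrite /rho_dd hessian_sphere_metric0 rho_normal_param pd2_comp_normal; last exact: rho_smooth.
by rewrite (euler0 (rho_smooth 2) rho_dir_hom (usphere_neq0 z1)) mulr0 subr0.
Qed.

Lemma rho_dd_sym i j : rho_dd rho z E i j = rho_dd rho z E j i.
Proof.
by rewrite !rho_ddE bil_sym // (hess0_sym (rho_smooth 2) (usphere_neq0 z1)).
Qed.

End NormalCoordinatesCalculus.

(** * The Hessian in the adapted frame *)

Section HessianOfCot.
Variables (R : realType) (K : int) (n : nat) (rho : 'rV[R]_n.+1 -> R).
Hypothesis hK : K = -1 \/ K = 0 \/ K = 1.
Hypothesis rho_smooth : smooth_on_sphere rho.
Hypothesis rho_range : forall z, usphere z -> 0 < rho z /\ in_radius K (rho z).
Implicit Types (x y z u v : 'rV[R]_n.+1) (r t : R).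

Let e i : 'rV[R]_n.+1 := delta_mx 0 i.
Let Rr := rho \o @dir R n.
Let C := cot_rho K rho.

(** The quotient rule and [phi_pyth]. *)
Lemma is_derive_cot t : phi K t != 0 ->
  is_derive t 1 (fun s => dphi K s * (phi K s)^-1) (- (phi K t) ^- 2).
Proof.
move=> p0; have dp := is_derive_phi hK t; have dd := is_derive_dphi hK t.
have di := is_deriveV p0 dp.
apply: is_derive_eq.
have := phi_pyth hK t; rewrite !/(_ *: _) /=; move: p0.
move: (phi K t) (dphi K t) (K%:~R : R) => f d k p0 pyth.
have -> : d * (- f ^- 2 * d) + f^-1 * (- k * f) = - (f ^- 2) * (d ^+ 2 + k * f ^+ 2) by field.
by rewrite pyth mulr1.
Qed.

Lemma is_derive_dcot t : phi K t != 0 ->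
  is_derive t 1 (fun s => - ((phi K s)^-1 * (phi K s)^-1)) (2 * dphi K t / phi K t ^+ 3).
Proof.
move=> p0; have dp := is_derive_phi hK t.
have di := is_deriveV p0 dp.
apply: is_derive_eq; rewrite !/(_ *: _) /=; move: p0.
by move: (phi K t) (dphi K t) => f d p0; field.
Qed.

Let phi_R_neq0 x : phi K (Rr x) != 0.
Proof. by rewrite gt_eqF // (phi_rho_gt0 hK rho_range) // /usphere /= enorm_dir. Qed.

Lemma is_derive_cot_rho x i : x != 0 ->
  is_derive x (e i) C (- (phi K (Rr x)) ^- 2 * pd i Rr x).
Proof.
move=> x0; have dR := Ck_is_derive i (rho_smooth 1) x0.
exact: is_derive_outer (is_derive_cot (phi_R_neq0 x)) dR.
Qed.

Lemma bil_hess0_cot_rho x u v : x != 0 ->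
  bil (hess0 C x) u v = 2 * dphi K (Rr x) / phi K (Rr x) ^+ 3
      * dotp u (grad Rr x) * dotp v (grad Rr x)
    - (phi K (Rr x)) ^- 2 * bil (hess0 Rr x) u v.
Proof.
move=> x0.
have -> : hess0 C x = (2 * dphi K (Rr x) / phi K (Rr x) ^+ 3) *: ((grad Rr x)^T *m grad Rr x)
    - (phi K (Rr x)) ^- 2 *: hess0 Rr x.
  apply/matrixP => i j; rewrite mxE.
  have dR := Ck_is_derive i (rho_smooth 1) x0.
  have dRj := Ck_is_derive i (Ck_pd j (rho_smooth 2)) x0.
  have dd := is_derive_outer (is_derive_dcot (phi_R_neq0 x)) dR.
  have E : \forall y \near x, - ((phi K (Rr y))^-1 * (phi K (Rr y))^-1) * pd j Rr y = pd j C y.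
    apply: filterS (near_neq0 x0) => y y0; have [_] := is_derive_cot_rho j y0.
    by rewrite /pd => ->; rewrite expr2 invfM.
  rewrite [LHS]/pd -(near_eq_derive _ E).
  have [_ ->] := is_deriveM dd dRj.
  rewrite !mxE big_ord1 !mxE !/(_ *: _) /=.
  move: (pd i Rr x) (pd j Rr x) (pd i (pd j Rr) x) (phi_R_neq0 x).
  move: (phi K _) (dphi K _) => f d a b c f0; field.
  exact: f0.
by rewrite bilD bilN !bilZ bil_tensor mulrA.
Qed.

End HessianOfCot.

Section AdaptedFrame.
Variables (R : realType) (K : int) (p : nat) (rho : 'rV[R]_p.+2 -> R).
Variables (z : 'rV[R]_p.+2) (E : 'M[R]_(p.+1, p.+2)).
Hypothesis hK : K = -1 \/ K = 0 \/ K = 1.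
Hypothesis rho_smooth : smooth_on_sphere rho.
Hypothesis rho_range : forall z, usphere z -> 0 < rho z /\ in_radius K (rho z).
Hypothesis z1 : usphere z.
Hypothesis adE : adapted rho z E.
Implicit Types (i j : 'I_p.+1).

Let f := phi K (rho z).
Let d := dphi K (rho z).
Let w := wfun K rho z E.
Let G := grad_norm rho z E.
Let Rr := rho \o @dir R p.+1.

Let EE : E *m E^T = 1%:M. Proof. by case: adE. Qed.
Let Ez : E *m z^T = 0. Proof. by case: adE. Qed.

Let f0 : 0 < f. Proof. exact: phi_rho_gt0. Qed.

Lemma wfun_sqr : w ^+ 2 = 1 + G ^+ 2 / f ^+ 2.
Proof. by rewrite sqr_sqrtr // addr_ge0 // divr_ge0 // sqr_ge0. Qed.

Lemma wfun_gt0 : 0 < w.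
Proof. by rewrite sqrtr_gt0 ltr_wpDr // divr_ge0 // sqr_ge0. Qed.

Lemma sqrt_wfun : Num.sqrt (f ^+ 2 + G ^+ 2) = f * w.
Proof.
have -> : f ^+ 2 + G ^+ 2 = (f * w) ^+ 2.
  rewrite exprMn wfun_sqr mulrDr mulr1 mulrCA mulfV ?mulr1 //.
  by rewrite sqrf_eq0 gt_eqF.
by rewrite sqrtr_sqr ger0_norm // mulr_ge0 // ltW // wfun_gt0.
Qed.

Lemma rho_d_adapted i : rho_d rho z E i = if i == ord0 then G else 0.
Proof. by case: adE => _ _ g0 ga _; case: eqP => [->//|/eqP/ga]. Qed.

Lemma rho_dd_adapted i j : i != ord0 -> j != ord0 -> i != j -> rho_dd rho z E i j = 0.
Proof. by case: adE => _ _ _ _; apply. Qed.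

Lemma h_mxE i j : h_mx K rho z E i j = w^-1 *
  (- rho_dd rho z E i j + 2 * d / f * rho_d rho z E i * rho_d rho z E j + f * d * (i == j)%:R).
Proof.
rewrite mxE -/f -/d -/G sqrt_wfun; congr (_ * _).
by rewrite invfM mulrA mulfV ?mul1r // gt_eqF.
Qed.

Lemma h_mx_sym i j : h_mx K rho z E i j = h_mx K rho z E j i.
Proof.
have aux (a b c x y t : R) : a * (b + c * x * y + t) = a * (b + c * y * x + t).
  by rewrite (mulrAC c).
rewrite !h_mxE (rho_dd_sym z1 EE Ez rho_smooth i j) (eq_sym i j).
exact: aux.
Qed.

Let gam i : R := if i == ord0 then (f * w)^-1 else f^-1.

(** gamma_11 is simplified with |grad rho|^2 = phi^2 (w^2 - 1). *)
Lemma gamma_mx_adapted : gamma_mx K rho z E = diag_mx (\row_i gam i).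
Proof.
apply/matrixP => i j; rewrite !mxE !rho_d_adapted -/f -/w /gam.
have fn : f != 0 by rewrite gt_eqF.
have wn : w != 0 by rewrite gt_eqF // wfun_gt0.
have w1 : 1 + w != 0 by rewrite gt_eqF // addr_gt0 // wfun_gt0.
have [->|ij] := eqVneq i j; last first.
  rewrite mulr0n; case: eqP => [i0|_]; last by rewrite mul0r mul0r subr0 mulr0.
  case: eqP => [j0|_]; last by rewrite mulr0 mul0r subr0 mulr0.
  by move: ij; rewrite i0 j0 eqxx.
rewrite !mulr1n; case: eqP => _; last by rewrite mul0r mul0r subr0 mulr1.
have -> : G * G = f ^+ 2 * (w ^+ 2 - 1).
  rewrite wfun_sqr [1 + _]addrC addrK [RHS]mulrC divfK ?expr2 //.
  by rewrite mulf_neq0.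
move: fn wn w1; move: f w => a b an bn b1.
by field; rewrite b1 bn an.
Qed.

Lemma a_mxE i j : a_mx K rho z E i j = gam i * h_mx K rho z E i j * gam j.
Proof. by rewrite /a_mx gamma_mx_adapted mul_mx_diag mul_diag_mx !mxE. Qed.

Lemma a_mx_sym : (a_mx K rho z E)^T = a_mx K rho z E.
Proof.
have aux (a b c : R) : a * b * c = c * b * a by ring.
by apply/matrixP => i j; rewrite mxE !a_mxE (h_mx_sym i j) aux.
Qed.

(** The powers of w in the definition undo the factor 1/w that gamma has in the first
    direction; in the other directions h is diagonal because rho_ij is. *)
Lemma tangential_blockE r i j : tangential_block K rho z E r i j =
  (phi K r)^-1 * (w / f ^+ 2 * h_mx K rho z E i j).
Proof.
have fn : f != 0 by rewrite gt_eqF.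
have wn : w != 0 by rewrite gt_eqF // wfun_gt0.
rewrite mxE -/w !a_mxE /gam eqxx.
case: (eqVneq i ord0) => [->|i0] /=.
  case: (eqVneq j ord0) => [->|j0] /=; move: (h_mx _ _ _ _ _ _) => h; move: (_^-1) fn wn => q;
    by move: f w => a b an bn; field; rewrite an bn.
case: (eqVneq j ord0) => [->|j0] /=.
  rewrite (h_mx_sym i); move: (h_mx _ _ _ _ _ _) => h; move: (_^-1) fn wn => q.
  by move: f w => a b an bn; field; rewrite an bn.
case: eqVneq => [<-|ij].
  move: (h_mx _ _ _ _ _ _) => h; move: (_^-1) fn wn => q.
  by move: f w => a b an bn; field; rewrite an.
rewrite h_mxE rho_dd_adapted // !rho_d_adapted (negbTE i0) (negbTE ij).
by rewrite oppr0 mulr0n mulr0 mul0r mulr0 !addr0 !mulr0.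
Qed.

(** The blocks are the tangential, mixed and radial values of the covariant Hessian; the
    tangential one is (D^2 C + C delta)/phi(r) - K b delta, and the derivative of
    phi'/phi gives D^2 C + C delta = w h / phi(rho)^2. *)
Lemma hessian_in_frameE r : 0 < r -> in_radius K r ->
  hessian_in_frame K z E (bfun K rho) r =
  block_mx (tangential_block K rho z E r) 0 0 0 - (K%:~R * bfun K rho (r *: z))%:M.
Proof.
move=> r0 rK; have p0 : 0 < phi K r by exact: phi_gt0.
have pn : phi K r != 0 by rewrite gt_eqF.
have rn : r != 0 by rewrite gt_eqF.
have fn : f != 0 by rewrite gt_eqF.
have wn : w != 0 by rewrite gt_eqF // wfun_gt0.
set k := K%:~R * _.
rewrite /hessian_in_frame /frame; set H := hessian _ _ _.
set F := (phi K r)^-1 *: (r *: E).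
have rowF i : row i F = ((phi K r)^-1 * r) *: row i E.
  by apply/rowP => l; rewrite !mxE mulrA.
have rowz (i : 'I_1) : row i z = z by apply/rowP => l; rewrite mxE ord1.
have zF i : dotp z (row i F) = 0 by rewrite rowF dotpZr dotp_z_row // mulr0.
rewrite mul_col_mx tr_col_mx mul_col_row scalar_mx_block opp_block_mx add_block_mx.
have mixed i := hessian_bfun_mixed hK rho_smooth rho_range r0 p0 z1 (zF i).
congr block_mx.
- apply/matrixP => i j; rewrite bil_rows.
  rewrite (hessian_bfun_tangential hK rho_smooth rho_range r0 p0 z1 (zF i) (zF j)).
  have nd := bil_hess0_cot_rho hK rho_smooth rho_range (row i F) (row j F) (usphere_neq0 z1).
  rewrite nd /= dir_usphere // -/f -/d !rowF !(dotpZl, dotpZr).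
  have scal (H' : 'M[R]_p.+2) c u v : bil H' (c *: u) (c *: v) = c * c * bil H' u v.
    by rewrite /bil linearZ /= -!scalemxAl -scalemxAr scalerA mxE.
  rewrite scal -!(rho_dE z1 EE Ez rho_smooth) -(rho_ddE z1 EE Ez rho_smooth) dotp_rows //.
  rewrite [RHS]mxE tangential_blockE h_mxE [(- _%:M) i j]mxE [_%:M i j]mxE.
  have -> : cot_rho K rho z = d / f by rewrite /cot_rho dir_usphere.
  rewrite -/k; move: k => k; move: (rho_d _ _ _ i) (rho_d _ _ _ j) (rho_dd _ _ _ i j).
  rewrite -(mulr_natr k (i == j)); move: ((i == j)%:R : R) => del.
  move: (phi K r) pn fn wn => q qn; move: f w d => a b c an bn s t st.
  by field; rewrite an bn rn qn.
- apply/matrixP => i j; rewrite bil_rows rowz [RHS]mxE !mxE oppr0 addr0.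
  exact: (mixed i).1.
- apply/matrixP => i j; rewrite bil_rows rowz [RHS]mxE !mxE oppr0 addr0.
  exact: (mixed j).2.
- apply/matrixP => i j; rewrite bil_rows !rowz.
  rewrite (hessian_bfun_radial hK rho_smooth rho_range r0 p0 z1) !mxE.
  by rewrite !ord1 eqxx mulr1n add0r mulNr.
Qed.

End AdaptedFrame.

(** For m and n equal but not convertible, as p.+1 + 1 and p.+2. *)
Lemma mulmx1C_cast (R : comNzRingType) m n (A : 'M[R]_(m, n)) (B : 'M[R]_(n, m)) :
  m = n -> A *m B = 1%:M -> B *m A = 1%:M.
Proof. by move=> mn; move: A B; rewrite {}mn => A B; exact: mulmx1C. Qed.

Lemma char_poly_similar (F : fieldType) n (P A B : 'M[F]_n) :
  P \in unitmx -> P *m A = B *m P -> char_poly A = char_poly B.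
Proof.
move=> Pu PAB; rewrite /char_poly; pose Q := map_mx polyC P.
have detQ : \det Q != 0.
  by rewrite det_map_mx polyC_eq0 -unitfE -unitmxE.
have E : Q *m char_poly_mx A = char_poly_mx B *m Q.
  by rewrite /char_poly_mx mulmxBr mulmxBl -!map_mxM PAB scalar_mxC.
by apply: (mulfI detQ); rewrite -det_mulmx E det_mulmx mulrC.
Qed.

Section PrincipalCurvatures.
Variables (R : realType) (K : int) (p : nat) (rho : 'rV[R]_p.+2 -> R).
Variables (z : 'rV[R]_p.+2) (E : 'M[R]_(p.+1, p.+2)).
Hypothesis hK : K = -1 \/ K = 0 \/ K = 1.
Hypothesis rho_smooth : smooth_on_sphere rho.
Hypothesis rho_range : forall z, usphere z -> 0 < rho z /\ in_radius K (rho z).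
Hypothesis z1 : usphere z.
Hypothesis adE : adapted rho z E.
Implicit Types (i j a b c : 'I_p.+1) (u v nu : 'rV[R]_p.+2) (h : R).

Let f := phi K (rho z).
Let d := dphi K (rho z).
Let w := wfun K rho z E.
Let G := grad_norm rho z E.
Let Rr := rho \o @dir R p.+1.
Let N := normal_param z E.
Let g := @space_form_metric R K p.+1.
Let X := graph_param rho z E.
Let e i : 'rV[R]_p.+1 := delta_mx 0 i.
Local Notation rd := (rho_d rho z E).
Let X0 := [set x : 'rV[R]_p.+2 | x != 0].
Let oX0 := @open_neq0 R p.+2.

Let EE : E *m E^T = 1%:M. Proof. by case: adE. Qed.
Let Ez : E *m z^T = 0. Proof. by case: adE. Qed.
Let f0 : 0 < f. Proof. exact: phi_rho_gt0. Qed.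
Let rho0 : 0 < rho z. Proof. by case: (rho_range z1). Qed.

Let N0 y : N y != 0.
Proof. by rewrite -enorm_eq0 enorm_normal_param // oner_eq0. Qed.

(** z and the rows of E form an orthonormal basis. *)
Lemma dotp_completeness u v :
  dotp u v = dotp z u * dotp z v + \sum_c dotp (row c E) u * dotp (row c E) v.
Proof.
have H : z^T *m z + E^T *m E = 1%:M.
  have M1 : col_mx E z *m (col_mx E z)^T = 1%:M.
    rewrite tr_col_mx mul_col_row EE Ez -[z *m E^T]trmxK trmx_mul trmxK Ez trmx0.
    by rewrite [z *m z^T]mx11_scalar -dotpE dotp_zz // -scalar_mx_block.
  have := mulmx1C_cast (addn1 _) M1.
  by rewrite tr_col_mx mul_row_col addrC.
rewrite -bil_1 -H bilD bil_tensor (dotpC u z) (dotpC v z); congr (_ + _).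
rewrite /bil mulmxA -mulmxA mxE; apply: eq_bigr => c _.
congr (_ * _).
  by rewrite dotpC dotpE mxE [RHS]mxE; apply: eq_bigr => k _; rewrite !mxE.
by rewrite dotpE !mxE; apply: eq_bigr => k _; rewrite !mxE.
Qed.

Lemma coord_vec_graph b l h : coord_vec X b (h *: e l) =
  Rr (N (h *: e l)) *: velocity z E b l h
  + dotp (velocity z E b l h) (grad Rr (N (h *: e l))) *: N (h *: e l).
Proof.
apply/rowP => k; rewrite mxE.
have dR := is_derive_comp_normal EE b
  (Ck_differentiable oX0 (rho_smooth 1) (N0 (h *: e l))).
have dN := is_derive_normal_param z EE b l h k.
have -> : (fun y => X y 0 k) = (Rr \o N) * (fun y => N y 0 k).
  apply/funext => y; rewrite /X /graph_param mxE; congr (_ * _).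
  by rewrite /Rr /= dir_usphere //; exact: enorm_normal_param.
rewrite /pd; have [_ ->] := is_deriveM dR dN.
by rewrite !mxE /= !/(_ *: _) /= [X in _ + X = _]mulrC.
Qed.

Lemma graph_param0 : X 0 = rho z *: z.
Proof. by rewrite /X /graph_param normal_param0. Qed.

Lemma coord_vec_graph0 b : coord_vec X b 0 = rho z *: row b E + rd b *: z.
Proof.
have := coord_vec_graph b b 0; rewrite scale0r => ->.
rewrite velocity0 /N normal_param0 // rho_dE //.
by rewrite /Rr /= dir_usphere.
Qed.

(** Tested against an arbitrary u, to be chosen as the covector of the normal.  The
    Cartesian part comes from the product rule for rho(z) z. *)
Lemma cov_coord_vec_graph a b u : dotp (cov_coord_vec g X a b 0) u =
  rd a * dotp (row b E) u + rd b * dotp (row a E) u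
  + (rho_dd rho z E a b - rho z * (a == b)%:R) * dotp z u
  + gamma_form g (rho z *: z) (coord_vec X a 0) (coord_vec X b 0) u.
Proof.
have z0 := usphere_neq0 z1.
have dX k : pd a (fun y => coord_vec X b y 0 k) 0 =
    rd a * E b k + rd b * E a k + (rho_dd rho z E a b - rho z * (a == b)%:R) * z 0 k.
  have dR := (is_derive_line _ _ _ _).1 (is_derive_comp_normal EE a
    (Ck_differentiable oX0 (rho_smooth 1) (N0 (0 *: e a)))).
  have dN := (is_derive_line _ _ _ _).1 (is_derive_normal_param z EE a a 0 k).
  have dv := is_derive_velocity z E b a k.
  have dg := is_derive_grad_normal z1 EE Ez a b (rho_smooth 2).
  have D := is_deriveD (is_deriveM dR dv) (is_deriveM dg dN).
  have E1 : (fun h => ((Rr \o N) (h *: e a + 0 *: e a)) * velocity z E b a h 0 k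
       + dotp (velocity z E b a h) (grad Rr (N (h *: e a))) * N (h *: e a + 0 *: e a) 0 k)
     = (fun h : R => coord_vec X b (h *: e a + 0) 0 k).
    by apply/funext => h; rewrite scale0r addr0 coord_vec_graph !mxE.
  rewrite -[X in is_derive _ _ X]/(fun h => ((Rr \o N) (h *: e a + 0 *: e a)) * velocity z E b a h 0 k
       + dotp (velocity z E b a h) (grad Rr (N (h *: e a))) * N (h *: e a + 0 *: e a) 0 k) E1 in D.
  rewrite /pd; have [_ ->] := (is_derive_line (fun y => coord_vec X b y 0 k) 0 (e a) _).2 D.
  rewrite /= !scale0r !addr0 /N normal_param0 // !velocity0 !/(_ *: _) /=.
  rewrite -(rho_ddE z1 EE Ez rho_smooth) -(rho_dE z1 EE Ez rho_smooth).
  rewrite (euler0 (rho_smooth 2) (rho_dir_hom rho) z0) mulr0 subr0.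
  rewrite -(rho_dE z1 EE Ez rho_smooth).
  rewrite /Rr /= dir_usphere // (eq_sym b a) ![row _ _ 0 k]mxE.
  move: (rd a) (rd b) (rho_dd _ _ _ a b) ((a == b)%:R : R) (E a k) (E b k) (z 0 k) (rho z).
  by move=> *; ring.
have lin (x y t : R) : \sum_k (x * E b k + y * E a k + t * z 0 k) * u 0 k =
    x * dotp (row b E) u + y * dotp (row a E) u + t * dotp z u.
  rewrite /dotp !mulr_sumr -!big_split /=; apply: eq_bigr => k _; rewrite !mxE; ring.
rewrite {1}/dotp /cov_coord_vec.
under eq_bigr do rewrite mxE dX mulrDl.
rewrite big_split /= graph_param0; congr (_ + _).
  exact: lin.
rewrite /gamma_form; under eq_bigr do rewrite mulr_suml.
rewrite exchange_big; apply: eq_bigr => i _.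
under eq_bigr do rewrite mulr_suml.
rewrite exchange_big; apply: eq_bigr => j _; rewrite mulr_sumr.
apply: eq_bigr => k _.
have aux (q x y t : R) : q * x * y * t = x * y * (q * t) by ring.
exact: aux.
Qed.

End PrincipalCurvatures.

Section ShapeOperator.
Variables (R : realType) (K : int) (p : nat) (rho : 'rV[R]_p.+2 -> R).
Variables (z : 'rV[R]_p.+2) (E : 'M[R]_(p.+1, p.+2)).
Hypothesis hK : K = -1 \/ K = 0 \/ K = 1.
Hypothesis rho_smooth : smooth_on_sphere rho.
Hypothesis rho_range : forall z, usphere z -> 0 < rho z /\ in_radius K (rho z).
Hypothesis z1 : usphere z.
Hypothesis adE : adapted rho z E.
Implicit Types (i j a b c : 'I_p.+1) (u v nu : 'rV[R]_p.+2) (h : R).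

Let f := phi K (rho z).
Let d := dphi K (rho z).
Let w := wfun K rho z E.
Let G := grad_norm rho z E.
Let g := @space_form_metric R K p.+1.
Let X := graph_param rho z E.
Local Notation rd := (rho_d rho z E).
Let q : R := warp2 K (rho z).

Let EE : E *m E^T = 1%:M. Proof. by case: adE. Qed.
Let Ez : E *m z^T = 0. Proof. by case: adE. Qed.
Let f0 : 0 < f. Proof. exact: phi_rho_gt0. Qed.
Let rho0 : 0 < rho z. Proof. by case: (rho_range z1). Qed.
Let w0 : 0 < w. Proof. exact: wfun_gt0. Qed.
Let fn : f != 0. Proof. by rewrite gt_eqF. Qed.
Let rn : rho z != 0. Proof. by rewrite gt_eqF. Qed.
Let wn : w != 0. Proof. by rewrite gt_eqF. Qed.
Let x0 : rho z *: z != 0. Proof. by rewrite scaler_eq0 gt_eqF //= usphere_neq0. Qed.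

Let X_0 : X 0 = rho z *: z. Proof. exact: (graph_param0 adE). Qed.

Let qE : q = (f / rho z) ^+ 2. Proof. by []. Qed.

(** The covector g(nu, .) at rho(z) z, as a Euclidean vector. *)
Definition lower nu : 'rV[R]_p.+2 := q *: nu + ((1 - q) * dotp z nu) *: z.

Lemma inner_lower u nu : inner g (rho z *: z) u nu = dotp u (lower nu).
Proof.
rewrite inner_space_form // enorm_ray // ?ltW // -/q !(dotpDr, dotpZr).
rewrite (dotpC nu z) /radial2 -/q; congr (_ + _).
by move: (dotp u z) (dotp z nu) rn => a b; move: (rho z) => r r0; field.
Qed.

Lemma dotp_z_lower nu : dotp z (lower nu) = dotp z nu.
Proof. by rewrite !(dotpDr, dotpZr) (dotp_zz z1); ring. Qed.

Lemma dotp_row_lower a nu : dotp (row a E) (lower nu) = q * dotp (row a E) nu.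
Proof. by rewrite !(dotpDr, dotpZr) (dotp_row_z Ez) mulr0 addr0. Qed.

Lemma inner_coord_vec a nu : inner g (X 0) nu (coord_vec X a 0) =
  rho z * (q * dotp (row a E) nu) + rd a * dotp z nu.
Proof.
have sym u v : inner g (X 0) u v = inner g (X 0) v u.
  rewrite X_0 !inner_lower /lower !(dotpDr, dotpZr) (dotpC u v) (dotpC u z) (dotpC v z).
  by move: (dotp v u) (dotp z v) (dotp z u) => *; ring.
rewrite sym X_0 inner_lower (coord_vec_graph0 rho_smooth z1 adE).
by rewrite dotpDl !dotpZl dotp_row_lower dotp_z_lower.
Qed.

Lemma first_ffE a b : first_ff g X 0 a b = f ^+ 2 * (a == b)%:R + rd a * rd b.
Proof.
rewrite mxE inner_coord_vec !(coord_vec_graph0 rho_smooth z1 adE).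
rewrite !dotpDr !dotpZr (dotp_rows EE) (dotp_row_z Ez) (dotp_z_row Ez) (dotp_zz z1).
rewrite qE (eq_sym b a).
move: (rd a) (rd b) ((a == b)%:R : R) rn; move: (rho z) f => r k s t e r0.
by field.
Qed.

Lemma dotp_z_coord_vec a : dotp z (coord_vec X a 0) = rd a.
Proof.
rewrite (coord_vec_graph0 rho_smooth z1 adE); move: (rd a) => x.
by rewrite dotpDr !dotpZr (dotp_z_row Ez) (dotp_zz z1) mulr0 add0r mulr1.
Qed.

Lemma dotp_coord_vec a b : dotp (coord_vec X a 0) (coord_vec X b 0) =
  rho z ^+ 2 * (a == b)%:R + rd a * rd b.
Proof.
rewrite !(coord_vec_graph0 rho_smooth z1 adE); move: (rd a) (rd b) => x y.
rewrite dotpDr !dotpZr !dotpDl !dotpZl (dotp_z_row Ez) (dotp_row_z Ez) (dotp_rows EE) (dotp_zz z1).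
by move: ((a == b)%:R : R) (rho z) => *; ring.
Qed.

Lemma dotp_lower_coord_vec nu a : dotp (lower nu) (coord_vec X a 0) =
  rho z * (q * dotp (row a E) nu) + rd a * dotp z nu.
Proof.
rewrite (coord_vec_graph0 rho_smooth z1 adE) dotpDr !dotpZr !(dotpC (lower nu)).
by rewrite dotp_row_lower dotp_z_lower.
Qed.

(** The components of z/w - grad rho / (w phi(rho)^2): radial part 1/w, and tangential
    part opposite to the gradient of rho.  The factor q turns the Euclidean product with a
    tangent vector into the Riemannian one. *)
Definition outward_components nu :=
  dotp z nu = w^-1 /\ forall a, q * dotp (row a E) nu = - rd a / (w * rho z).

Lemma second_ffE nu : outward_components nu -> second_ff g X nu 0 = h_mx K rho z E.
Proof.
move=> [zn tn]; apply/matrixP => a b; rewrite mxE h_mxE //.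
rewrite X_0 inner_lower (cov_coord_vec_graph K rho_smooth z1 adE).
rewrite (gamma_space_form hK _ _ _ rho0 f0 z1).
move: (dotp_z_lower nu) (dotp_row_lower a nu) (dotp_row_lower b nu).
move: (dotp_lower_coord_vec nu a) (dotp_lower_coord_vec nu b) (dotp_coord_vec a b).
move: (dotp_z_coord_vec a) (dotp_z_coord_vec b) (tn a) (tn b) zn.
move: (coord_vec X a 0) (coord_vec X b 0) (lower nu) (row a E) (row b E) => Xa Xb L Ea Eb.
move: (rd a) (rd b) (rho_dd _ _ _ a b) ((a == b)%:R : R) => da db dab e.
move=> zXa zXb Ea_nu Eb_nu zn' LXa LXb XX Lz La Lb.
rewrite XX zXa zXb LXa LXb La Lb Lz Ea_nu Eb_nu zn' -/f -/d -/w.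
move: rn fn wn; move: (rho z) f w d => r k s t r0 k0 s0.
by field; rewrite r0 k0 s0.
Qed.

Let wsqr : w ^+ 2 = 1 + G ^+ 2 / f ^+ 2. Proof. exact: wfun_sqr. Qed.

Lemma inner_self nu : inner g (X 0) nu nu =
  dotp z nu ^+ 2 + q * \sum_c dotp (row c E) nu ^+ 2.
Proof.
rewrite X_0 inner_lower !(dotpDr, dotpZr).
rewrite (dotp_completeness z1 adE nu nu) (dotpC nu z).
under [in RHS]eq_bigr do rewrite expr2.
move: (\sum_c _) (dotp z nu) => s t; ring.
Qed.

(** Orthogonality to the coordinate vectors determines the tangential part from the
    radial one, and the norm then determines the square of the radial part; the sign
    condition selects 1/w. *)
Lemma outward_normalP nu : outward_components nu <->
  is_unit_normal g X 0 nu /\ 0 < inner g (rho z *: z) nu z.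
Proof.
have q0 : q != 0 by rewrite qE expf_neq0 // mulf_neq0 // invr_neq0.
have inz : inner g (rho z *: z) nu z = dotp z nu.
  rewrite inner_lower !(dotpDr, dotpZr) (dotp_zz z1) (dotpC nu z).
  by move: (dotp z nu) => t; ring.
have sumE s : (forall a, q * dotp (row a E) nu = - rd a * s / rho z) ->
    inner g (X 0) nu nu = dotp z nu ^+ 2 + s ^+ 2 * (G ^+ 2 / f ^+ 2).
  move=> tn; rewrite inner_self (bigD1 ord0) //= big1 ?addr0 => [|c c0]; last first.
    apply/eqP; rewrite sqrf_eq0 -(mulrI_eq0 _ (mulfI q0)) tn rho_d_adapted //.
    by rewrite (negbTE c0) oppr0 !mul0r.
  have := tn ord0; rewrite rho_d_adapted // eqxx -/G => t0.
  have -> : dotp (row ord0 E) nu = - G * s / rho z / q by rewrite -t0 mulrC mulKf.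
  rewrite qE; congr (_ + _); move: rn fn; move: (rho z) f => r k r0 k0.
  by field; rewrite r0 k0.
split=> [[zn tn]|[[n1 nX] npos]].
  split; last by rewrite inz zn invr_gt0.
  split=> [|a].
    rewrite (sumE w^-1) => [|a]; last by rewrite tn invfM mulrA.
    have <- : w ^+ 2 - 1 = G ^+ 2 / f ^+ 2 by rewrite wsqr addrC addKr.
    rewrite zn; move: wn; move: w => s s0; by field.
  rewrite inner_coord_vec tn zn; move: (rd a) wn rn; move: w (rho z) => s r t s0 r0.
  by field; rewrite s0 r0.
have tn a : q * dotp (row a E) nu = - rd a * dotp z nu / rho z.
  have := nX a; rewrite inner_coord_vec => /eqP; rewrite addr_eq0 => /eqP H.
  by rewrite mulNr -H [RHS]mulrC mulKf.
(* The normalization reads (w <z, nu>)^2 = 1, and <z, nu> is positive. *)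
have zn : dotp z nu = w^-1.
  have := n1; rewrite (sumE _ tn).
  have <- : w ^+ 2 - 1 = G ^+ 2 / f ^+ 2 by rewrite wsqr addrC addKr.
  rewrite mulrBr mulr1 addrC subrK -exprMn => /eqP.
  rewrite -(expr1n R 2) eqrXn2 // ?mulr_ge0 ?ltW // -?inz // => /eqP H.
  by rewrite -[LHS](mulfK wn) H mul1r.
by split=> // a; rewrite tn zn invfM mulrA.
Qed.

Lemma outward_normal_exists : exists nu, outward_components nu.
Proof.
exists (w^-1 *: (z - (G * rho z / f ^+ 2) *: row ord0 E)); split.
  by rewrite !(dotpDr, dotpZr, dotpNr) (dotp_zz z1) (dotp_z_row Ez) mulr0 subr0 mulr1.
move=> a; rewrite !(dotpDr, dotpZr, dotpNr) (dotp_row_z Ez) (dotp_rows EE).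
rewrite rho_d_adapted // qE -/G.
move: wn rn fn; move: w f (rho z) => s k r s0 r0 k0.
by case: eqP => _ /=; field; rewrite s0 r0 ?k0.
Qed.

(** The inverse of the first fundamental form is gamma^2, so the shape operator is
    gamma^2 h, which gamma conjugates to gamma h gamma. *)
Lemma char_poly_shape_operator nu : outward_components nu ->
  char_poly (shape_operator g X nu 0) = char_poly (a_mx K rho z E).
Proof.
move=> on; have gE := gamma_mx_adapted hK rho_range z1 adE.
set ga := gamma_mx K rho z E in gE *.
have gu : ga \in unitmx.
  rewrite unitmxE gE det_diag unitfE; apply/prodf_neq0 => i _; rewrite mxE.
  by case: ifP => _; rewrite invr_neq0 // mulf_neq0.
have fg : first_ff g X 0 *m (ga *m ga) = 1%:M.
  rewrite gE mulmx_diag mul_mx_diag; apply/matrixP => i j.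
  rewrite mxE first_ffE !mxE !rho_d_adapted // -/G -/f -/w.
  have GG : G * G = f ^+ 2 * (w ^+ 2 - 1).
    by rewrite wsqr [1 + _]addrC addrK [RHS]mulrC divfK ?expr2 // mulf_neq0.
  have [<-|ij] := eqVneq i j.
    case: eqP => _; rewrite ?GG; move: fn wn; move: f w => k s k0 s0 /=; field;
      by rewrite ?k0 ?s0.
  rewrite mulr0 add0r; case: eqP => [i0|_]; last by rewrite !mul0r.
  by case: eqP => [j0|_]; [move: ij; rewrite i0 j0 eqxx|rewrite mulr0 mul0r].
have fu : first_ff g X 0 \in unitmx by case/mulmx1_unit: fg.
have inv : invmx (first_ff g X 0) = ga *m ga.
  by rewrite -[RHS](mulKmx fu) fg mulmx1.
apply/esym/(char_poly_similar gu).
by rewrite /shape_operator inv second_ffE // /a_mx -/ga !mulmxA.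
Qed.

Lemma principal_curvaturesP (kappa : 'I_p.+1 -> R) :
  eigenvalues_are (a_mx K rho z E) kappa <-> principal_curvatures_are K rho z E kappa.
Proof.
split=> [ev|[nu [un pos ev]]].
  have [nu on] := outward_normal_exists.
  have [un pos] := (outward_normalP nu).1 on.
  by exists nu; split=> //; rewrite /eigenvalues_are char_poly_shape_operator.
have on : outward_components nu by apply/outward_normalP.
by rewrite /eigenvalues_are -(char_poly_shape_operator on).
Qed.

End ShapeOperator.

(** * Curves and their lengths *)

Section ArcLength.
Variables (R : realType) (m : R -> R).
Hypothesis m_continuous : continuous m.
Hypothesis m_ge0 : forall t, 0 <= m t.

Definition arc (x : R) : R := Rintegral lebesgue_measure `[0, x]%classic m.

Let m_integrable (x : R) : lebesgue_measure.-integrable `[0, x]%classic (EFin \o m).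
Proof.
apply: continuous_compact_integrable; first exact: segment_compact.
by apply: continuous_subspaceT; exact: m_continuous.
Qed.

Lemma is_derive_arc (x : R) : 0 < x -> is_derive x 1 arc (m x).
Proof.
move=> x0; have x1 : x < x + 1 by rewrite ltrDl.
have [d1 d2] := continuous_FTC1_closed x1 (m_integrable (x + 1)) x0 (m_continuous (x := x)).
by split; [exact: d1|rewrite -d2 derive1E].
Qed.

Lemma arc_continuous : {within `[0, 1], continuous arc}.
Proof. exact: (parameterized_integral_continuous ler01 (m_integrable 1)). Qed.

Lemma arc0 : arc 0 = 0.
Proof. by rewrite /arc set_itv1 Rintegral_set1. Qed.

(** The monotonicity test applied to s f - L arc for s = 1 and s = -1. *)
Lemma arc_control (L : R) (f f' : R -> R) (a b : R) : 0 <= a -> a <= b -> b <= 1 ->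
  {within `[a, b], continuous f} ->
  (forall t, a < t < b -> is_derive t 1 f (f' t) /\ `|f' t| <= L * m t) ->
  `|f b - f a| <= L * (arc b - arc a).
Proof.
move=> a0 ab b1 cf df.
have sub : `[a, b]%classic `<=` `[0, 1]%classic.
  by move=> t /=; rewrite !in_itv /= => /andP[at_ tb]; rewrite (le_trans a0 at_) (le_trans tb b1).
have carc : {within `[a, b], continuous arc} := continuous_subspaceW sub arc_continuous.
have mono (s : R) : `|s| = 1 -> s * f b - L * arc b <= s * f a - L * arc a.
  move=> s1; pose k : R -> R := fun t => s * f t - L * arc t.
  have dk t : a < t < b -> is_derive t 1 k (s * f' t - L * m t).
    move=> tab; have [dft _] := df t tab.
    have t0 : 0 < t by move/andP: tab => [+ _]; exact: le_lt_trans.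
    have dA := is_derive_arc t0.
    by apply: is_derive_eq.
  have ck : {within `[a, b], continuous k}.
    move=> x; apply: (@continuousB _ _ (subspace `[a, b]) (fun t => s * f t) (fun t => L * arc t)).
      by apply: (@continuousM _ (subspace `[a, b]) (fun=> s) f); [exact: cst_continuous|exact: cf].
    by apply: (@continuousM _ (subspace `[a, b]) (fun=> L) arc); [exact: cst_continuous|exact: carc].
  have H := @ler0_derive1_le_cc R k a b _ _ ck.
  apply: H => //; rewrite ?bound_itvE //.
  - by move=> x; rewrite in_itv /= => /dk[].
  - move=> x; rewrite in_itv /= => xab; rewrite derive1E; have [_ ->] := dk x xab.
    rewrite subr_le0; have [_ +] := df x xab; apply: le_trans.
    by rewrite (le_trans (ler_norm _)) // normrM s1 mul1r.
have := mono 1; have := mono (-1); rewrite normrN1 normr1 => /(_ erefl) h1 /(_ erefl) h2.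
by rewrite ler_norml; apply/andP; split; lra.
Qed.

Lemma arc_le (a b : R) : 0 <= a -> a <= b -> b <= 1 -> arc a <= arc b.
Proof.
move=> a0 ab b1; have := @arc_control 1 (fun=> 0) (fun=> 0) a b a0 ab b1.
rewrite subrr normr0 mul1r subr_ge0; apply.
  by apply: continuous_subspaceT => x; exact: cst_continuous.
by move=> t _; rewrite mul1r m_ge0; split=> //; exact: is_derive_cst.
Qed.

End ArcLength.

Section SpeedAndLength.
Variables (R : realType) (K : int) (n : nat).
Hypothesis hK : K = -1 \/ K = 0 \/ K = 1.
Implicit Types (x y z u v : 'rV[R]_n.+1) (r t : R).

Let g := @space_form_metric R K n.

(** The square of phi(r)/r, completed continuously at r = 0: the factor by which the
    metric differs from the Euclidean one in tangential directions. *)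
Definition conf r : R := (if r == 0 then 1 else phi K r / r) ^+ 2.

(** Valid also at the origin, where the radial term has the coefficient 0 whatever the
    choice of dir 0. *)
Lemma inner_spaceE x v :
  inner g x v v = conf (enorm x) * dotp v v + (1 - conf (enorm x)) * dotp (dir x) v ^+ 2.
Proof.
have [->|x0] := eqVneq x 0.
  rewrite /conf enorm0 eqxx expr1n subrr mul0r addr0 mul1r.
  by rewrite /inner /g /space_form_metric eqxx mulmx1 dotpE.
rewrite inner_space_form // /conf enorm_eq0 (negbTE x0) -/(warp2 K (enorm x)) /radial2.
have -> : dotp v x = enorm x * dotp (dir x) v by rewrite -dotpZl -polar dotpC.
have : enorm x != 0 by rewrite enorm_eq0.
move: (warp2 K (enorm x)) (dotp v v) (dotp (dir x) v) (enorm x) => a b c e e0.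
by field.
Qed.

Lemma inner_split x v : inner g x v v =
  dotp (dir x) v ^+ 2 + conf (enorm x) * (dotp v v - dotp (dir x) v ^+ 2).
Proof. by rewrite inner_spaceE; ring. Qed.

Lemma dotp_dir_le x v : dotp (dir x) v ^+ 2 <= dotp v v.
Proof.
apply: le_trans (dotp_sqr_le _ _) _.
by rewrite -enorm_sqr enorm_dir expr1n mul1r.
Qed.

Lemma radial_le_speed x v : `|dotp (dir x) v| <= Num.sqrt (inner g x v v).
Proof.
rewrite -sqrtr_sqr ler_wsqrtr // inner_split lerDl mulr_ge0 ?sqr_ge0 //.
by rewrite subr_ge0 dotp_dir_le.
Qed.

(** The Euclidean splitting of v into radial and tangential parts is orthogonal for the
    Riemannian metric too. *)
Lemma tangential_le_speed x v : x != 0 ->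
  `|phi K (enorm x) / enorm x| * enorm (v - dotp (dir x) v *: dir x) <= Num.sqrt (inner g x v v).
Proof.
move=> x0; rewrite -sqrtr_sqr /enorm -sqrtrM ?sqr_ge0 // ler_wsqrtr // inner_split.
rewrite /conf -/(enorm x) enorm_eq0 (negbTE x0).
have dd : dotp (dir x) (dir x) = 1 by rewrite -enorm_sqr enorm_dir expr1n.
have -> : dotp (v - dotp (dir x) v *: dir x) (v - dotp (dir x) v *: dir x) =
    dotp v v - dotp (dir x) v ^+ 2.
  rewrite !(dotpDl, dotpDr, dotpNl, dotpNr, dotpZl, dotpZr) dd (dotpC v (dir x)).
  by move: (dotp v v) (dotp _ v) => a b; ring.
by rewrite lerDr sqr_ge0.
Qed.

Lemma conf_continuous : continuous conf.
Proof.
move=> r; apply: (@continuous_comp _ _ _ (fun r => if r == 0 then 1 else phi K r / r)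
   (fun s : R => s ^+ 2)); last exact: exprn_continuous.
have cphi s : {for s, continuous (@phi R K)} by exact: is_derive_continuous1 (is_derive_phi hK s).
have [->|r0] := eqVneq r 0.
  (* Caratheodory's slope function of phi at 0 is the completed quotient. *)
  have /is_derive1_caratheodory[h [hE ch h0]] := is_derive_phi hK (0 : R).
  have -> : (fun r => if r == 0 then 1 else phi K r / r) = h.
    apply/funext => s; case: eqP => [->|/eqP s0]; first by rewrite h0 dphi0.
    by have := hE s; rewrite phi0 // !subr0 => ->; rewrite mulfK.
  exact: ch.
have E : \forall s \near r, phi K s / s = (if s == 0 then 1 else phi K s / s).
  have := open_nbhs_nbhs (conj (@open_neq R 0) r0).
  by apply: filterS => s /= /negbTE ->.
have c : {for r, continuous (fun s => phi K s / s)}.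
  by apply: continuousM; [exact: cphi|apply: continuousV => //; exact: cvg_id].
move: c; rewrite /prop_for /continuous_at (negbTE r0); apply: cvg_trans.
exact: (@near_eq_cvg _ _ (nbhs r) _ _ _ E).
Qed.

Lemma dir_continuous x : x != 0 -> {for x, continuous (@dir R n)}.
Proof.
move=> x0.
have E : \forall y \near x, (enorm y)^-1 *: y = dir y.
  by apply: filterS (near_neq0 x0) => y y0; rewrite /dir (negbTE y0).
have c : {for x, continuous (fun y : 'rV[R]_n.+1 => (enorm y)^-1 *: y)}.
  apply: (@continuousZ _ _ _ (fun y => (enorm y)^-1) id); last exact: cvg_id.
  by apply: continuousV; [rewrite enorm_eq0|exact: enorm_continuous].
move: c; rewrite /prop_for /continuous_at [in X in _ -> _ --> X](_ : dir x = (enorm x)^-1 *: x).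
  by apply: cvg_trans; exact: (@near_eq_cvg _ _ (nbhs x) _ _ _ E).
by rewrite /dir (negbTE x0).
Qed.

End SpeedAndLength.

Section CurveLengths.
Variables (R : realType) (K : int) (n : nat).
Hypothesis hK : K = -1 \/ K = 0 \/ K = 1.
Implicit Types (x y z u v : 'rV[R]_n.+1) (r t s a b : R).

Let g := @space_form_metric R K n.

Section OneCurve.
Variable c : R -> 'rV[R]_n.+1.
Hypothesis c_derivable : forall t, derivable c t 1.
Hypothesis c_C1 : continuous (derive1 c).

Definition speed t : R := Num.sqrt (inner g (c t) (derive1 c t) (derive1 c t)).

Let c_continuous t : {for t, continuous c}.
Proof. exact/differentiable_continuous/derivable1_diffP. Qed.

Let r_continuous t : {for t, continuous (@enorm R n.+1 \o c)}.
Proof. by apply: continuous_comp; [exact: c_continuous|exact: enorm_continuous]. Qed.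

Let conf_r_continuous t : {for t, continuous (@conf R K \o (@enorm R n.+1 \o c))}.
Proof.
apply: (@continuous_comp _ _ _ (@enorm R n.+1 \o c) (@conf R K)); first exact: r_continuous.
exact: conf_continuous.
Qed.

Let v2_continuous t : {for t, continuous (fun s => dotp (derive1 c s) (derive1 c s))}.
Proof. by apply: dotp_continuous; exact: c_C1. Qed.

(** At times where c passes through the origin dir o c may jump, but it is multiplied by
    1 - conf, which tends to 0. *)
Let inner_continuous t :
  {for t, continuous (fun s => inner g (c s) (derive1 c s) (derive1 c s))}.
Proof.
pose k := @conf R K \o (@enorm R n.+1 \o c).
pose v2 := fun s => dotp (derive1 c s) (derive1 c s).
pose w := fun s => dotp (dir (c s)) (derive1 c s) ^+ 2.
have -> : (fun s => inner g (c s) (derive1 c s) (derive1 c s)) =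
    (fun s => k s * v2 s + (1 - k s) * w s).
  by apply/funext => s; rewrite inner_spaceE.
have ck : {for t, continuous (fun s => 1 - k s)}.
  by apply: continuousB; [exact: cst_continuous|exact: conf_r_continuous].
apply: (@continuousD _ _ _ (fun s => k s * v2 s) (fun s => (1 - k s) * w s)).
  by apply: continuousM; [exact: conf_r_continuous|exact: v2_continuous].
have [ct0|ct0] := eqVneq (c t) 0; last first.
  apply: (@continuousM _ _ (fun s => 1 - k s) w) => //.
  have cd : {for t, continuous (fun s => dotp (dir (c s)) (derive1 c s))}.
    apply: dotp_continuous; last exact: c_C1.
    apply: (@continuous_comp _ _ _ c (@dir R n)); first exact: c_continuous.
    exact: dir_continuous.
  apply: (@continuous_comp _ _ _ (fun s => dotp (dir (c s)) (derive1 c s)) (fun y : R => y ^+ 2)).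
    exact: cd.
  exact: exprn_continuous.
have kt : 1 - k t = 0 by rewrite /k /= ct0 enorm0 /conf eqxx expr1n subrr.
rewrite /prop_for /continuous_at kt mul0r.
have h0 : `|1 - k s| * v2 s @[s --> t] --> (0 : R).
  have -> : (0 : R) = `|1 - k t| * v2 t by rewrite kt normr0 mul0r.
  apply: (@continuousM _ _ (fun s => `|1 - k s|) v2); last exact: v2_continuous.
  apply: (@continuous_comp _ _ _ (fun s => 1 - k s) (fun x : R => `|x|)); first exact: ck.
  exact: norm_continuous.
apply: (@squeeze_cvgr _ _ _ _ (fun s => - (`|1 - k s| * v2 s)) (fun s => `|1 - k s| * v2 s)).
- near=> s; rewrite -ler_norml normrM ler_wpM2l // ger0_norm ?sqr_ge0 //.
  exact: dotp_dir_le.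
- have /(_ _) := cvgN h0; rewrite oppr0; apply; exact: nbhs_filter.
- exact: h0.
Unshelve. all: by end_near. Qed.

Lemma speed_continuous : continuous speed.
Proof.
move=> t; apply: (@continuous_comp _ _ _
  (fun s => inner g (c s) (derive1 c s) (derive1 c s)) (@Num.sqrt R)).
  exact: inner_continuous.
exact: sqrt_continuous.
Qed.

Lemma speed_ge0 t : 0 <= speed t.
Proof. exact: sqrtr_ge0. Qed.

Variables (F : 'rV[R]_n.+1 -> R) (S : set 'rV[R]_n.+1) (L : R).
Hypothesis L_ge0 : 0 <= L.
Hypothesis c_in : forall t, 0 <= t <= 1 -> S (c t).
Hypothesis F_continuous : forall x, S x -> {for x, continuous F}.
Hypothesis F_gradient : forall x, S x -> x != 0 ->
  differentiable F x /\ forall v, `|'D_v F x| <= L * Num.sqrt (inner g x v v).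

Let increment_off0 a b : 0 <= a -> a <= b -> b <= 1 ->
  (forall t, a < t < b -> c t != 0) ->
  `|F (c b) - F (c a)| <= L * (arc speed b - arc speed a).
Proof.
move=> a0 ab b1 c0.
apply: (@arc_control R speed speed_continuous L (F \o c)
   (fun t => 'D_(derive1 c t) F (c t)) a b a0 ab b1).
  apply: continuous_in_subspaceT => t; rewrite inE /= in_itv /= => /andP[at_ tb].
  apply: (@continuous_comp _ _ _ c F); first exact: c_continuous.
  apply: F_continuous; apply: c_in.
  by rewrite (le_trans a0 at_) (le_trans tb b1).
move=> t tab; have t01 : 0 <= t <= 1.
  by move/andP: tab => [at_ tb]; rewrite (le_trans a0 (ltW at_)) (le_trans (ltW tb) b1).
have [dF bF] := F_gradient (c_in t01) (c0 t tab).
split; last exact: bF.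
rewrite derive_pd //; apply: is_derive_curve => // k.
have dck : derivable (fun s => c s 0 k) t 1 by apply: (derivable_mxP _ _ _).1.
by rewrite derive1E derive_mx // mxE; exact: derivableP.
Qed.

(** A curve may pass through the origin, where F need not be differentiable; outside
    the first and the last such passage the derivative bound applies.  Between the two
    F has no increment, the curve starting and ending at the same point. *)
Lemma increment_le_arc b : 0 <= b -> b <= 1 ->
  `|F (c b) - F (c 0)| <= L * arc speed b.
Proof.
move=> b0 b1; have a00 : arc speed 0 = 0 by exact: arc0.
have [[t [tb ct]]|nz] := pselect (exists t, 0 <= t <= b /\ c t = 0); last first.
  have -> : arc speed b = arc speed b - arc speed 0 by rewrite a00 subr0.
  apply: increment_off0 => // t /andP[t0 tb].
  by apply/eqP => ct; apply: nz; exists t; rewrite (ltW t0) (ltW tb).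
(* The extreme points t0 and t1 of this compact set are the first and the last passage. *)
pose Z := `[0, b]%classic `&` [set t | enorm (c t) = 0].
have Zt : Z t by split; rewrite /= ?in_itv //= ct enorm0.
have cZ : compact Z.
  apply: compact_closedI; first exact: segment_compact.
  apply: (@preimage_closed _ _ (@enorm R n.+1 \o c) [set 0]).
    by move=> x _; exact: r_continuous.
  exact: closed_eq.
have cid : {within Z, continuous (fun x : R => x)} by apply: continuous_subspaceT => x; exact: cvg_id.
have [t1 /set_mem[t1b t1z] max1] := compact_EVT_max (ex_intro _ t Zt) cZ cid.
have [t0 /set_mem[t0b t0z] min0] := compact_EVT_min (ex_intro _ t Zt) cZ cid.
rewrite /= !in_itv /= in t1b t0b t1z t0z.
have c1 : c t1 = 0 by apply/eqP; rewrite -enorm_eq0 t1z.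
have c0 : c t0 = 0 by apply/eqP; rewrite -enorm_eq0 t0z.
have inZ s : 0 <= s <= b -> c s = 0 -> s \in Z.
  by move=> sb cs; apply/mem_set; split; rewrite /= ?in_itv //= cs enorm0.
have t01 : t0 <= t1 by apply: max1; exact: inZ.
move/andP: t0b => [t00 t0b]; move/andP: t1b => [t10 t1b].
have I0 : `|F (c t0) - F (c 0)| <= L * (arc speed t0 - arc speed 0).
  apply: increment_off0 => //; first exact: le_trans b1.
  move=> s /andP[s0 st]; apply/eqP => cs.
  have := min0 s (inZ s _ cs); rewrite (ltW s0) (le_trans (ltW st) t0b) => /(_ isT).
  by rewrite leNgt st.
have I1 : `|F (c b) - F (c t1)| <= L * (arc speed b - arc speed t1).
  apply: increment_off0 => // s /andP[ts sb]; apply/eqP => cs.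
  have := max1 s (inZ s _ cs); rewrite (ltW sb) (le_trans t10 (ltW ts)) => /(_ isT).
  by rewrite leNgt ts.
have Im : 0 <= L * (arc speed t1 - arc speed t0).
  apply: mulr_ge0 => //; rewrite subr_ge0.
  by apply: (arc_le speed_continuous speed_ge0) => //; exact: le_trans b1.
have -> : F (c b) - F (c 0) = (F (c b) - F (c t1)) + (F (c t0) - F (c 0)).
  by rewrite c1 c0; ring.
apply: le_trans (ler_normD _ _) _; rewrite a00 subr0 in I0.
lra.
Qed.

End OneCurve.
End CurveLengths.

(** * Riemannian distance *)

Section SphereBounds.
Variables (R : realType) (n : nat).

Lemma usphere_compact : compact (@usphere R n.+1).
Proof.
apply: bounded_closed_compact.
  exists 1; split => // M M1 x x1; apply: le_trans (norm_le_enorm x) _.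
  by rewrite x1 ltW.
apply: (@preimage_closed _ _ (@enorm R n.+1) [set 1]).
  by move=> x _; exact: enorm_continuous.
exact: closed_eq.
Qed.

Lemma usphere_nonempty : usphere (delta_mx 0 0 : 'rV[R]_n.+1).
Proof. exact: enorm_delta. Qed.

Lemma usphere_bounded (f : 'rV[R]_n.+1 -> R) :
  (forall z, usphere z -> {for z, continuous f}) ->
  exists2 B, 0 <= B & forall z, usphere z -> `|f z| <= B.
Proof.
move=> cf.
have [||c _ cmax] := @EVT_max_rV R n.+1 (fun z => `|f z|) (@usphere R n.+1) _ usphere_compact.
- by exists (delta_mx 0 0); exact: usphere_nonempty.
- apply: continuous_in_subspaceT => z /set_mem z1.
  by apply: (@continuous_comp _ _ _ f (fun x : R => `|x|)); [exact: cf|exact: norm_continuous].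
by exists `|f c| => // z z1; apply: cmax; exact/mem_set.
Qed.

Lemma usphere_attains_max (f : 'rV[R]_n.+1 -> R) :
  (forall z, usphere z -> {for z, continuous f}) ->
  exists2 c, usphere c & forall z, usphere z -> f z <= f c.
Proof.
move=> cf.
have [||c c1 cmax] := @EVT_max_rV R n.+1 f (@usphere R n.+1) _ usphere_compact.
- by exists (delta_mx 0 0); exact: usphere_nonempty.
- by apply: continuous_in_subspaceT => z /set_mem z1; exact: cf.
by exists c; [exact/set_mem|move=> z z1; apply: cmax; exact/mem_set].
Qed.

End SphereBounds.

Section Distance.
Variables (R : realType) (K : int) (n : nat).
Hypothesis hK : K = -1 \/ K = 0 \/ K = 1.
Implicit Types (x y z u v : 'rV[R]_n.+1) (r t s a b : R).

Let g := @space_form_metric R K n.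
Let N := @space_form R K n.+1.

Definition segment x y : R -> 'rV[R]_n.+1 := fun t => t *: (y - x) + x.

Lemma is_derive_segment x y t : is_derive t 1 (segment x y) (y - x).
Proof.
have D : is_derive t 1 (fun s : R => s *: (y - x)) (y - x).
  have c : derivable (fun s : R => s *: (y - x)) t 1.
    apply/derivable_mxP => i j.
    have -> : (fun s : R => (s *: (y - x)) i j) = (fun s => s * (y - x) i j).
      by apply/funext => s; rewrite mxE.
    exact: derivableM.
  split => //; rewrite derive_mx //; apply/matrixP => i j; rewrite mxE.
  have -> : (fun s : R => (s *: (y - x)) i j) = (fun s => s * (y - x) i j).
    by apply/funext => s; rewrite [in LHS]mxE.
  have d : is_derive t 1 (fun s : R => s * (y - x) i j) ((y - x) i j).
    by apply: is_derive_eq; rewrite scaler0 add0r [_%:A]mulr1.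
  by case: d.
have := is_deriveD D (is_derive_cst x t 1); rewrite addr0.
by [].
Qed.

(** The space form is a ball, hence convex. *)
Lemma segment_curve x y : N x -> N y -> curve_from_to N x y (segment x y).
Proof.
move=> Nx Ny.
have d1 : derive1 (segment x y) = fun=> y - x.
  by apply/funext => t; rewrite derive1E; case: (is_derive_segment x y t).
split.
- by move=> t; case: (is_derive_segment x y t).
- by rewrite d1; exact: cst_continuous.
- move=> t /andP[t0 t1] K1; have := Nx K1; have := Ny K1 => Ny1 Nx1.
  have -> : segment x y t = (1 - t) *: x + t *: y.
    by rewrite /segment scalerBr scalerBl scale1r addrC addrA addrAC.
  apply: le_lt_trans (enormD _ _) _; rewrite !enormZ (ger0_norm t0) ger0_norm ?subr_ge0 //.
  have [t00|tp] := leP t 0.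
    have -> : t = 0 by apply/eqP; rewrite eq_le t0 t00.
    by rewrite subr0 mul1r mul0r addr0.
  apply: (@lt_le_trans _ _ ((1 - t) * pi + t * pi)); last by rewrite -mulrDl subrK mul1r.
  by apply: ler_ltD; rewrite ?ltr_pM2l // ler_wpM2l ?subr_ge0 // ltW.
- by rewrite /segment scale0r add0r.
- by rewrite /segment scale1r subrK.
Qed.

Lemma curve_length_ge0 (c : R -> 'rV[R]_n.+1) : 0 <= curve_length g c.
Proof. by apply: Rintegral_ge0 => t _; exact: sqrtr_ge0. Qed.

Let lengths x y := [set l | exists2 c, curve_from_to N x y c & l = curve_length g c].

Let lengths_lb x y : lbound (lengths x y) 0.
Proof. by move=> _ [c _ ->]; exact: curve_length_ge0. Qed.

Lemma rdist_le x y c : curve_from_to N x y c -> rdist g N x y <= curve_length g c.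
Proof.
move=> cc; apply: ge_inf; first by exists 0; exact: lengths_lb.
by exists c.
Qed.

(** An infimum is bounded below by a constant only over a nonempty set of curves, which
    [segment_curve] provides. *)
Lemma le_rdist (L B : R) x y : N x -> N y -> 0 < L ->
  (forall c, curve_from_to N x y c -> B <= L * curve_length g c) -> B <= L * rdist g N x y.
Proof.
move=> Nx Ny L0 H; rewrite mulrC -ler_pdivrMr //; apply: lb_le_inf.
  by exists (curve_length g (segment x y)), (segment x y) => //; exact: segment_curve.
by move=> _ [c cc ->]; rewrite ler_pdivrMr // mulrC; exact: H.
Qed.

Lemma rdist_ge0 x y : N x -> N y -> 0 <= rdist g N x y.
Proof.
move=> Nx Ny; have := @le_rdist 1 0 x y Nx Ny ltr01; rewrite mul1r; apply.
by move=> c _; rewrite mul1r; exact: curve_length_ge0.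
Qed.

(** |x| is the distance to the origin: its gradient has norm 1. *)
Lemma enorm_increment x y c t : curve_from_to N x y c -> 0 <= t -> t <= 1 ->
  `|enorm (c t) - enorm x| <= arc (speed K c) t.
Proof.
move=> [dc cc cN c0 c1] t0 t1; rewrite -c0 -[leRHS]mul1r.
apply: (@increment_le_arc R K n hK c dc cc (@enorm R n.+1) setT 1 ler01 _ _ _ t t0 t1) => //.
  by move=> z _; exact: enorm_continuous.
move=> z _ z0; split; first exact: Ck_differentiable (@open_neq0 R n.+1) (Ck_enorm 1) z0.
move=> v; rewrite mul1r; have [_ ->] := is_derive_enorm v z0.
have -> : dotp z v / enorm z = dotp (dir z) v by rewrite /dir (negbTE z0) dotpZl mulrC.
exact: radial_le_speed.
Qed.

Lemma radial_length r s z : 0 <= r -> 0 <= s -> usphere z ->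
  curve_length g (segment (r *: z) (s *: z)) = `|r - s|.
Proof.
move=> r0 s0 z1; rewrite /curve_length.
have zz : dotp z z = 1 by rewrite -enorm_sqr z1 expr1n.
have speedE t : 0 <= t <= 1 -> Num.sqrt (inner g (segment (r *: z) (s *: z) t)
   (derive1 (segment (r *: z) (s *: z)) t) (derive1 (segment (r *: z) (s *: z)) t)) = `|r - s|.
  move=> /andP[t0 t1]; rewrite derive1E; have [_ ->] := is_derive_segment (r *: z) (s *: z) t.
  rewrite -scalerBl; have -> : segment (r *: z) (s *: z) t = (t * (s - r) + r) *: z.
    by rewrite /segment -scalerBl scalerA -scalerDl.
  set q := t * (s - r) + r; rewrite distrC.
  have q0 : 0 <= q by rewrite /q; nra.
  rewrite inner_spaceE !(dotpZl, dotpZr) zz.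
  have [qq|qp] := leP q 0.
    have -> : q = 0 by apply/eqP; rewrite eq_le qq q0.
    rewrite scale0r /conf enorm0 eqxx expr1n subrr mul0r addr0 mul1r mulr1.
    by rewrite -expr2 sqrtr_sqr.
  rewrite dir_ray // zz !mulr1 -expr2 -mulrDl addrC subrK mul1r.
  by rewrite sqrtr_sqr.
transitivity (Rintegral lebesgue_measure `[0, 1]%classic (fun _ : R => `|r - s|)).
  apply: eq_Rintegral => t /set_mem /=; rewrite in_itv /= => t01; exact: speedE.
rewrite Rintegral_cst; last exact: measurable_itv.
have -> : fine (lebesgue_measure `[0 : R, 1]%classic) = 1.
  by have := lebesgue_measure_itv `[0 : R, 1]%R; rewrite /= lte01 oppr0 adde0 => ->.
by rewrite mulr1.
Qed.

Lemma rdist_radial r s z : 0 <= r -> 0 <= s -> usphere z -> N (r *: z) -> N (s *: z) ->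
  rdist g N (r *: z) (s *: z) <= `|r - s|.
Proof.
move=> r0 s0 z1 Nr Ns; rewrite -(radial_length r0 s0 z1).
by apply: rdist_le; exact: segment_curve.
Qed.

End Distance.

(** * The Lipschitz bound for b *)

Section Lipschitz.
Variables (R : realType) (K : int) (n : nat) (rho : 'rV[R]_n.+1 -> R).
Hypothesis hK : K = -1 \/ K = 0 \/ K = 1.
Hypothesis rho_smooth : smooth_on_sphere rho.
Hypothesis rho_range : forall z, usphere z -> 0 < rho z /\ in_radius K (rho z).
Implicit Types (x y z u v : 'rV[R]_n.+1) (r t s : R).

Let X0 := [set x : 'rV[R]_n.+1 | x != 0].
Let oX0 := @open_neq0 R n.+1.
Let g := @space_form_metric R K n.
Let N := @space_form R K n.+1.
Let b := bfun K rho.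
Let C := cot_rho K rho.

(** For negative curvature b and its gradient grow exponentially, and estimates hold on
    balls only; for the other curvatures this is the whole space. *)
Definition in_ball r0 : set 'rV[R]_n.+1 := [set x | K = -1 -> enorm x <= r0].

Let C_smooth k : Ck k X0 C.
Proof. exact: Ck_cot_rho. Qed.

Lemma phi_bounded r0 : exists2 B, 0 < B &
  forall r, 0 <= r -> (K = -1 -> r <= r0) -> `|dphi K r| <= B /\ `|K%:~R * phi K r| <= B.
Proof.
case: hK => [->|[->|->]].
- exists (expR r0) => [|r rr0 /(_ erefl) rr]; first exact: expR_gt0.
  have e1 : expR (- r) <= expR r by rewrite ler_expR; lra.
  have e2 : expR r <= expR r0 by rewrite ler_expR.
  have e3 := expR_gt0 (- r).
  rewrite dphi_m1E phi_m1E mulrN1z mulN1r normrN !ler_norml; split; apply/andP; split; lra.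
- exists 1 => // r _ _; rewrite dphi_0E mul0r normr0 normr1; split=> //.
- exists 1 => // r _ _; rewrite dphi_1E phi_1E mul1r; split; [exact: cos_max|exact: sin_max].
Qed.

Lemma cot_rho_bounded : exists2 B, 0 <= B & forall z, usphere z ->
  `|C z| <= B /\ forall v, `|dotp v (grad C z)| <= enorm v * B.
Proof.
have z0 z : usphere z -> X0 z by exact: usphere_neq0.
have [B1 B10 H1] : exists2 B, 0 <= B & forall z, usphere z -> `|C z| <= B.
  by apply: usphere_bounded => z z1; exact: Ck_continuous (C_smooth 0) (z0 z z1).
have [B2 B20 H2] : exists2 B, 0 <= B & forall z, usphere z -> `|\sum_i `|pd i C z| | <= B.
  apply: usphere_bounded => z z1; apply: continuous_sum => i.
  apply: (@continuous_comp _ _ _ (pd i C) (fun x : R => `|x|)); last exact: norm_continuous.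
  exact: Ck_continuous (Ck_pd i (C_smooth 1)) (z0 z z1).
exists (B1 + B2) => [|z z1]; first exact: addr_ge0.
split=> [|v]; first by apply: le_trans (H1 z z1) _; rewrite lerDl.
apply: le_trans (ler_norm_sum _ _ _) _.
apply: (@le_trans _ _ (enorm v * \sum_i `|pd i C z|)).
  rewrite mulr_sumr; apply: ler_sum => i _; rewrite normrM mxE.
  by rewrite ler_wpM2r // coord_le_enorm.
rewrite ler_wpM2l ?enorm_ge0 //; apply: le_trans (ler_norm _) _.
by apply: le_trans (H2 z z1) _; rewrite lerDr.
Qed.

(** The radial derivative is phi' C + K phi, and the tangential one is phi(r)/r times a
    derivative of C on the sphere; the Riemannian norm of a tangential vector has the
    same factor phi(r)/r. *)
Lemma bfun_gradient r0 : exists2 L, 0 < L & forall x, in_ball r0 x -> x != 0 ->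
  differentiable b x /\ forall v, `|'D_v b x| <= L * Num.sqrt (inner g x v v).
Proof.
have [B B0 HB] := phi_bounded r0; have [B' B'0 HC] := cot_rho_bounded.
exists (B * (B' + 1) + B') => [|x xr x0].
  by rewrite ltr_wpDr // mulr_gt0 // ltr_wpDl.
have db : differentiable b x.
  exact: Ck_differentiable oX0 (Ck_bfun hK rho_smooth rho_range 1) x0.
split=> // v; rewrite derive_grad //.
set z := dir x; set r := enorm x.
have r0' : 0 < r by rewrite enorm_gt0.
have z1 : usphere z by exact: enorm_dir.
have xE : x = r *: z by exact: polar.
have Cx : C x = C z by rewrite xE; exact: (cot_rho_hom K rho r0' (usphere_neq0 z1)).
have gE : dotp v (grad b x) = radial_b K rho x * dotp z v
    + phi K r / r * dotp (v - dotp z v *: z) (grad C z).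
  have gb : grad b x = (radial_b K rho x / r) *: x + phi K r *: grad C x.
    apply/rowP => i; rewrite mxE [pd i b _]/pd.
    case: (is_derive_bfun hK rho_smooth rho_range i x0) => _ ->.
    by rewrite !mxE mulrAC mulrA.
  have gC : grad C x = r^-1 *: grad C z.
    by rewrite [in LHS]xE; exact: (grad_scale (C_smooth 2) (@cot_rho_hom _ K _ rho) r0' (usphere_neq0 z1)).
  have zC : dotp z (grad C z) = 0.
    exact: (euler0 (C_smooth 2) (@cot_rho_hom _ K _ rho) (usphere_neq0 z1)).
  rewrite gb gC dotpDr !dotpZr dotpDl dotpNl dotpZl zC mulr0 subr0 [in dotp v x]xE dotpZr (dotpC v z).
  have rn : r != 0 by rewrite gt_eqF.
  by move: (radial_b _ _ _) (dotp z v) (phi K r) (dotp v _) => p q s t; field.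
rewrite gE; apply: le_trans (ler_normD _ _) _; rewrite [leRHS]mulrDl; apply: lerD.
  rewrite normrM ler_pM //; last exact: radial_le_speed.
  have [H1 H2] := HB r (ltW r0') xr; rewrite /radial_b -/r -/C Cx.
  apply: le_trans (ler_normD _ _) _; rewrite [leRHS]mulrDr mulr1; apply: lerD => //.
  by rewrite normrM ler_pM //; have [] := HC z z1.
rewrite normrM; have [_ H] := HC z z1.
apply: le_trans (ler_wpM2l (normr_ge0 _) (H _)) _.
by rewrite mulrA mulrC ler_wpM2l //; exact: tangential_le_speed.
Qed.

(** At the origin C need not be continuous, but it is bounded and its factor phi(r) tends
    to 0. *)
Lemma bfun_continuous x : {for x, continuous b}.
Proof.
have [x0|x0] := eqVneq x 0; last first.
  exact: Ck_continuous (Ck_bfun hK rho_smooth rho_range 0) x0.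
have cp y : {for y, continuous (phi K \o @enorm R n.+1)}.
  apply: continuous_comp; first exact: enorm_continuous.
  exact: is_derive_continuous1 (is_derive_phi hK _).
have cd y : {for y, continuous (dphi K \o @enorm R n.+1)}.
  apply: continuous_comp; first exact: enorm_continuous.
  exact: is_derive_continuous1 (is_derive_dphi hK _).
have bE : b = (fun y => (phi K \o @enorm R n.+1) y * C y) - (dphi K \o @enorm R n.+1).
  by apply/funext => y; rewrite /b (bfunE hK rho_range).
have [B B0 HB] := cot_rho_bounded.
rewrite bE; apply: continuousB; last exact: cd.
have p0 : (phi K \o @enorm R n.+1) x = 0 by rewrite /= x0 enorm0 phi0.
rewrite /prop_for /continuous_at p0 mul0r.
have h0 : `|(phi K \o @enorm R n.+1) y| * B @[y --> x] --> (0 : R).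
  have -> : (0 : R) = `|(phi K \o @enorm R n.+1) x| * B by rewrite p0 normr0 mul0r.
  apply: (@continuousM _ _ (fun y => `|(phi K \o @enorm R n.+1) y|) (fun=> B)); last exact: cst_continuous.
  apply: (@continuous_comp _ _ _ (phi K \o @enorm R n.+1) (fun x : R => `|x|)); first exact: cp.
  exact: norm_continuous.
apply: (@squeeze_cvgr _ (nbhs x) (nbhs_filter x) _ (fun y => - (`|(phi K \o @enorm R n.+1) y| * B))
  (fun y => `|(phi K \o @enorm R n.+1) y| * B)).
- apply: nearW => y; rewrite -ler_norml normrM ler_wpM2l //.
  have [+ _] := HB _ (enorm_dir y).
  by rewrite /C /cot_rho dir_usphere //; exact: enorm_dir.
- have /(_ _) := cvgN h0; rewrite oppr0; apply; exact: nbhs_filter.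
- exact: h0.
Qed.

Lemma bfun_bounded r0 : exists2 M, 0 <= M & forall x, K = -1 -> enorm x <= r0 -> `|b x| <= M.
Proof.
have [B B0 HB] := phi_bounded r0; have [B' B'0 HC] := cot_rho_bounded.
exists (B * B' + B) => [|x K1 xr]; first by have B1 := ltW B0; rewrite addr_ge0 ?mulr_ge0.
have [H1 H2] := HB (enorm x) (enorm_ge0 x) (fun _ => xr).
rewrite /b (bfunE hK rho_range) -/C.
apply: le_trans (ler_normB _ _) _; apply: lerD => //; rewrite normrM ler_pM //.
  by move: H2; rewrite K1 mulrN1z mulN1r normrN.
have [+ _] := HC _ (enorm_dir x).
by rewrite /C /cot_rho dir_usphere //; exact: enorm_dir.
Qed.

(** A curve of length at most 1 that starts in the ball of radius r0 stays in the ball of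
    radius r0 + 1, where the gradient is bounded.  For longer curves the increment of b
    is at most twice its supremum on the ball of radius r0. *)
Lemma bfun_lipschitz r0 : exists2 L, 0 < L & forall x y, N x -> N y ->
  in_ball r0 x -> in_ball r0 y -> `|b x - b y| <= L * sf_dist K x y.
Proof.
have [L L0 HL] := bfun_gradient (r0 + 1); have [M M0 HM] := bfun_bounded r0.
exists (L + 2 * M) => [|x y Nx Ny xr yr]; first by rewrite ltr_wpDr // mulr_ge0.
apply: le_rdist => //; first by rewrite ltr_wpDr // mulr_ge0.
move=> c cc; have [dc cc1 cN c0 c1] := cc.
have len : curve_length g c = arc (speed K c) 1 by [].
have len0 := curve_length_ge0 K c.
have short : (K = -1 -> curve_length g c <= 1) -> `|b x - b y| <= L * curve_length g c.
  move=> sh; rewrite distrC -c0 -c1 len.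
  apply: (@increment_le_arc R K n hK c dc cc1 b (in_ball (r0 + 1)) L (ltW L0) _ _ _ 1 ler01 (lexx _)).
  - move=> t /andP[t0 t1] K1.
    have := enorm_increment hK cc t0 t1; have := xr K1; have := sh K1.
    have : arc (speed K c) t <= arc (speed K c) 1.
      exact: (arc_le (speed_continuous hK dc cc1) (speed_ge0 K c) t0 t1 (lexx _)).
    rewrite -len => h1 h2 h3 h4; have := le_trans (ler_norm _) h4; lra.
  - by move=> z _; exact: bfun_continuous.
  - exact: HL.
have [l1|l1] := leP (curve_length g c) 1.
  apply: le_trans (short (fun _ => l1)) _; rewrite ler_wpM2r // lerDl mulr_ge0 //.
have [K1|K1] := eqVneq K (-1); last first.
  apply: le_trans (short _) _; first by move=> K2; rewrite K2 eqxx in K1.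
  by rewrite ler_wpM2r // lerDl mulr_ge0.
apply: le_trans (ler_normB _ _) _.
have := HM x K1 (xr K1); have := HM y K1 (yr K1) => h1 h2.
apply: (@le_trans _ _ (2 * M * 1)); first by lra.
apply: (@le_trans _ _ (2 * M * curve_length g c)).
  by rewrite ler_wpM2l ?mulr_ge0 // ltW.
by rewrite ler_wpM2r // lerDr ltW.
Qed.

End Lipschitz.

(** * Star-shaped domains *)

Section StarShaped.
Variables (R : realType) (K : int) (n : nat).
Variables (Omega : set 'rV[R]_n.+1) (rho : 'rV[R]_n.+1 -> R).
Hypothesis hK : K = -1 \/ K = 0 \/ K = 1.
Hypothesis star : starshaped_domain K Omega rho.
Implicit Types (x y z : 'rV[R]_n.+1) (r t s : R).

Let N := @space_form R K n.+1.
Let g := @space_form_metric R K n.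
Let b := bfun K rho.

Let rho_smooth : smooth_on_sphere rho. Proof. by case: star. Qed.
Let rho_range z : usphere z -> 0 < rho z /\ in_radius K (rho z).
Proof. by case: star => _ _ _ + _; apply. Qed.

Let bd_eq : boundary Omega = radial_graph rho. Proof. by case: star. Qed.

Lemma boundary_polar x : boundary Omega x <-> enorm x = rho (dir x).
Proof.
rewrite bd_eq; split=> [[z z1 <-]|xr].
  have [r0 _] := rho_range z1.
  by rewrite dir_ray // enorm_ray // ltW.
by exists (dir x); [exact: enorm_dir|rewrite -xr -polar].
Qed.

(** Off the boundary, S meets Omega in the traces of its interior and of its closure,
    so in an open and closed subset. *)
Lemma connected_off_boundary (S : set 'rV[R]_n.+1) : connected S ->
  (forall x, S x -> ~ boundary Omega x) -> S `&` Omega !=set0 -> S `<=` Omega.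
Proof.
move=> cS nS [x [Sx Ox]].
have SO y : S y -> closure Omega y -> interior Omega y.
  by move=> Sy cy; apply: contrapT => ny; apply: (nS y Sy).
have E : S `&` interior Omega = S.
  apply: cS.
  - by exists x; split=> //; apply: SO => //; exact: subset_closure.
  - by exists (interior Omega) => //; exact: open_interior.
  - exists (closure Omega); first exact: closed_closure.
    apply/seteqP; split=> y [Sy Hy]; split=> //; last exact: SO.
    by apply: subset_closure; exact: interior_subset.
by move=> y; rewrite -E => -[_ /interior_subset].
Qed.

Let ray_connected x (I : interval R) : connected ((fun t : R => t *: x) @` [set` I]).
Proof.
apply: connected_continuous_connected.
  by apply/connected_intervalP; exact: interval_is_interval.
apply: continuous_subspaceT => t.
by apply: (@continuousZ _ _ _ (fun t : R => t) (fun=> x)); [exact: cvg_id|exact: cst_continuous].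
Qed.

(** The segment from the origin to x does not meet the boundary. *)
Lemma mem_inside x : enorm x < rho (dir x) -> Omega x.
Proof.
move=> xr.
have [x0|x0] := eqVneq x 0.
  by rewrite x0; apply: interior_subset; case: star.
have O0 : Omega 0 by apply: interior_subset; case: star.
apply: (connected_off_boundary (@ray_connected x `[0, 1]%R)).
- move=> _ [t /= + <-]; rewrite in_itv /= => /andP[t0 t1] /boundary_polar.
  have [t00|tp] := leP t 0.
    have -> : t = 0 by apply/eqP; rewrite eq_le t0 t00.
    rewrite scale0r enorm0 => e0; have [] := rho_range (enorm_dir (0 : 'rV[R]_n.+1)).
    by rewrite -e0 ltxx.
  rewrite dirZ // enormZ ger0_norm // => e0; move: xr; rewrite -e0.
  by rewrite ltNge ler_piMl ?enorm_ge0.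
- by exists 0; split=> //; exists 0; rewrite ?scale0r //= in_itv /= lexx ler01.
- by exists 1; rewrite ?scale1r //= in_itv /= lexx ler01.
Qed.

(** The ray from x to infinity does not meet the boundary, and Omega is bounded. *)
Lemma not_mem_outside x : rho (dir x) < enorm x -> ~ Omega x.
Proof.
move=> xr Ox; have x0 : x != 0.
  rewrite -enorm_gt0; apply: lt_trans xr; by case: (rho_range (enorm_dir x)).
have sub := connected_off_boundary (@ray_connected x `[1, +oo[%R).
have {}sub : (fun t : R => t *: x) @` `[1, +oo[%classic `<=` Omega.
  apply: sub; last by exists x; split=> //; exists 1; rewrite ?scale1r //= in_itv /= lexx.
  move=> _ [t /= + <-]; rewrite in_itv /= andbT => t1 /boundary_polar.
  have t0 : 0 < t by apply: lt_le_trans t1.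
  rewrite dirZ // enormZ gtr0_norm // => e0; move: xr; rewrite -e0.
  by rewrite ltNge ler_peMl ?enorm_ge0.
have [M [_ HM]] : bounded_set Omega by apply: compact_bounded; case: star => -[].
(* The norm of t x exceeds |M| + 1, the bound for Omega. *)
pose t := (`|M| + 2) / `|x| + 1.
have nx : 0 < `|x| by rewrite normr_gt0.
have t1 : 1 <= t by rewrite lerDr divr_ge0 // addr_ge0.
have := HM (`|M| + 1) (le_lt_trans (ler_norm M) _) (t *: x).
rewrite ltrDl ltr01 => /(_ isT) H.
have : `|t *: x| <= `|M| + 1 by apply: H; apply: sub; exists t; rewrite //= in_itv /= t1.
rewrite normrZ ger0_norm; last exact: le_trans t1.
rewrite /t mulrDl divfK ?gt_eqF // mul1r; have := normr_ge0 x; lra.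
Qed.

Lemma bfun_inside x : enorm x < rho (dir x) -> b x < 0.
Proof.
move=> xr; have [r0 rK] := rho_range (enorm_dir x).
have p0 := phi_rho_gt0 hK rho_range (enorm_dir x).
rewrite /b /bfun -opprB phiN // mulNr oppr_lt0 divr_gt0 // phi_gt0 // ?subr_gt0 //.
by move=> /rK; apply: le_lt_trans; rewrite gerBl enorm_ge0.
Qed.

Lemma bfun_outside x : N x -> rho (dir x) < enorm x -> 0 < b x.
Proof.
move=> Nx xr; have [r0 rK] := rho_range (enorm_dir x).
have p0 := phi_rho_gt0 hK rho_range (enorm_dir x).
rewrite /b /bfun divr_gt0 // phi_gt0 // ?subr_gt0 //.
by move=> /Nx; apply: le_lt_trans; rewrite gerBl ltW.
Qed.

Lemma bfun_boundary x : boundary Omega x -> b x = 0.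
Proof. by move=> /boundary_polar xr; rewrite /b /bfun xr subrr phi0 // mul0r. Qed.

Lemma boundary_subset : boundary Omega `<=` N.
Proof.
move=> x /boundary_polar xr; rewrite /N /space_form /= xr.
by case: (rho_range (enorm_dir x)).
Qed.

Let Rr_continuous z : usphere z -> {for z, continuous (rho \o @dir R n)}.
Proof. by move=> /usphere_neq0 z0; exact: Ck_continuous (rho_smooth 0) z0. Qed.

Lemma rho_bounded : exists m M, [/\ 0 < m, in_radius K M &
  forall z, usphere z -> m <= rho z <= M].
Proof.
have [z2 z21 H2] := usphere_attains_max Rr_continuous.
have [|z1 z11 H1] := @usphere_attains_max R n (fun z => - (rho \o @dir R n) z).
  move=> z zz; apply: (@continuousN _ _ _ (rho \o @dir R n) z); exact: (Rr_continuous zz).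
exists (rho z1), (rho z2); split; [by case: (rho_range z11)|by case: (rho_range z21)|].
move=> z zz; have := H1 z zz; have := H2 z zz.
by rewrite /= !dir_usphere // lerN2 => -> ->.
Qed.

Let dist x : R := rdist_set g N (boundary Omega) x.

Let bd_ray x : boundary Omega (rho (dir x) *: dir x).
Proof. by rewrite bd_eq; exists (dir x) => //; exact: enorm_dir. Qed.

Lemma dist_le x : N x -> dist x <= `|enorm x - rho (dir x)|.
Proof.
move=> Nx; have [r0 _] := rho_range (enorm_dir x).
apply: (@le_trans _ _ (rdist g N x (rho (dir x) *: dir x))).
  apply: ge_inf; last by exists (rho (dir x) *: dir x).
  by exists 0 => _ [y /boundary_subset Ny <-]; exact: rdist_ge0.
have Ny : N (rho (dir x) *: dir x) by apply: boundary_subset; exact: bd_ray.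
rewrite [X in rdist _ _ X _]polar; apply: rdist_radial => //; rewrite ?enorm_ge0 ?ltW //.
  exact: enorm_dir.
by rewrite -polar.
Qed.

Lemma bfun_le_dist r0 : exists2 L, 0 < L &
  forall x, N x -> in_ball K r0 x -> `|b x| <= L * dist x.
Proof.
have [m [M [m0 MK Hr]]] := rho_bounded.
have [L L0 HL] := bfun_lipschitz hK rho_smooth rho_range (Num.max r0 M).
exists L => // x Nx xr; rewrite mulrC -ler_pdivrMr //; apply: lb_le_inf.
  by exists (rdist g N x (rho (dir x) *: dir x)), (rho (dir x) *: dir x).
move=> _ [y yb <-]; rewrite ler_pdivrMr // mulrC.
have -> : b x = b x - b y by rewrite (bfun_boundary yb) subr0.
apply: HL => //; first exact: boundary_subset.
  by move=> K1; rewrite le_max xr.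
move=> _; move: yb => /boundary_polar ->.
by have /andP[_ rM] := Hr _ (enorm_dir y); rewrite le_max rM orbT.
Qed.

(** For K = 1 the continuous extension of phi(s)/s to the interval [0, s0] has a
    positive minimum; for K = -1 the bound is sinh s >= s/2. *)
Lemma phi_ge_linear s0 : in_radius K s0 -> exists2 k, 0 < k &
  forall s, 0 < s -> (K = 1 -> s <= s0) -> k * s <= phi K s.
Proof.
move=> s0K; have [K1|K1] := pselect (K = 1); last first.
  exists (2^-1); first by rewrite invr_gt0.
  move=> s sp _; case: hK => [->|[->|//]]; last by rewrite phi_0E; lra.
  rewrite phi_m1E ler_wpM2l ?invr_ge0 //.
  have e1 := expR_ge1Dx s; have : expR (- s) < 1 by rewrite expR_lt1 oppr_lt0.
  lra.
have [s0p|s0n] := ltP 0 s0; last first.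
  by exists 1 => // s sp /(_ K1) ss; have := lt_le_trans sp ss; rewrite ltNge s0n.
have [c cin Hc] := @EVT_min R (@conf R K) 0 s0 (ltW s0p)
  (continuous_subspaceT (@conf_continuous R K hK)).
have cpos : 0 < conf K c.
  move: cin; rewrite in_itv /= => /andP[c0 cs]; rewrite /conf exprn_gt0 //.
  case: eqP => [//|/eqP cn]; rewrite divr_gt0 ?lt_def ?cn //.
  rewrite -lt_def; apply: phi_gt0 => //; first by rewrite lt_def cn.
  by move=> /s0K; apply: le_lt_trans.
exists (Num.sqrt (conf K c)); first by rewrite sqrtr_gt0.
move=> s sp /(_ K1) ss.
have ps : 0 < phi K s by apply: phi_gt0 => // /s0K; exact: le_lt_trans.
have := Hc s; rewrite in_itv /= (ltW sp) ss => /(_ isT) cs.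
rewrite -ler_pdivlMr // -(ger0_norm (ltW (divr_gt0 ps sp))) -sqrtr_sqr ler_sqrt ?sqr_ge0 //.
by move: cs; rewrite {2}/conf gt_eqF.
Qed.

(** For K = 1 the gap r - rho stays away from pi in absolute value, since rho has a
    positive minimum m and a maximum M < pi on the sphere, and r < pi: it lies between
    - M and pi - m. *)
Lemma gap_le_bfun : exists2 A, 0 < A &
  forall x, N x -> `|enorm x - rho (dir x)| <= A * `|b x|.
Proof.
have [m [M [m0 MK Hr]]] := rho_bounded.
have [k k0 Hk] : exists2 k, 0 < k & forall x, N x -> enorm x != rho (dir x) ->
    k * `|enorm x - rho (dir x)| <= phi K `|enorm x - rho (dir x)|.
  pose s0 := Num.max M (pi - m).
  have [|k k0 Hk] := @phi_ge_linear s0.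
    by move=> K1; rewrite gt_max (MK K1) gtrBl.
  exists k => // x Nx xr; apply: Hk; first by rewrite normr_gt0 subr_eq0.
  have /andP[r1 r2] := Hr _ (enorm_dir x).
  move=> /Nx xpi; have x0 := enorm_ge0 x.
  rewrite le_max; move: (enorm x) (rho (dir x)) r1 r2 xpi x0 => e r r1 r2 epi e0.
  have [h|h] := ger0P (e - r); apply/orP; [right|left].
    by rewrite lerB // ltW.
  by rewrite opprB lerBlDr; apply: le_trans r2 _; rewrite lerDl.
have [P P0 HP] : exists2 P, 0 <= P & forall z, usphere z -> `|(phi K \o (rho \o @dir R n)) z| <= P.
  apply: usphere_bounded => z z1; apply: (@continuous_comp _ _ _ (rho \o @dir R n) (phi K)).
    exact: Rr_continuous.
  exact: is_derive_continuous1 (is_derive_phi hK _).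
have P1 : 0 < P + 1 by apply: ltr_wpDl.
have k'0 : 0 < k^-1 by rewrite invr_gt0.
exists (k^-1 * (P + 1)) => [|x Nx]; first exact: mulr_gt0.
have [->|xr] := eqVneq (enorm x) (rho (dir x)).
  by rewrite subrr normr0; apply: mulr_ge0 => //; exact: ltW (mulr_gt0 k'0 P1).
have p0 := phi_rho_gt0 hK rho_range (enorm_dir x).
have pP : phi K (rho (dir x)) <= P.
  have := HP (dir x) (enorm_dir x); rewrite /= dir_usphere //; last exact: enorm_dir.
  by apply: le_trans; exact: ler_norm.
have H := Hk x Nx xr.
have nb : phi K `|enorm x - rho (dir x)| <= `|phi K (enorm x - rho (dir x))|.
  have [h|h] := ger0P (enorm x - rho (dir x)); first exact: ler_norm.
  by rewrite phiN // -normrN ler_norm.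
rewrite /b /bfun normrM normfV (gtr0_norm p0) mulrA ler_pdivlMr //.
rewrite -mulrA ler_pdivlMl //; apply: (@le_trans _ _ (phi K `|enorm x - rho (dir x)| * P)).
  rewrite mulrA; apply: ler_pM => //; last exact: ltW.
  by rewrite mulr_ge0 // ltW.
rewrite mulrC; apply: ler_pM => //.
  by apply: le_trans H; rewrite mulr_ge0 // ltW.
by rewrite lerDl.
Qed.

(** The ratios of b and the signed distance are thus those of their absolute values. *)
Let signs x : N x -> ~ boundary Omega x -> exists2 e : R, `|e| = 1 &
  b x = e * `|b x| /\ signed_dist K Omega x = e * dist x.
Proof.
move=> Nx nb; have [lt|gt|eq] := ltgtP (enorm x) (rho (dir x)).
- have xO : x \in Omega by apply/mem_set; exact: mem_inside.
  exists (-1); first exact: normrN1.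
  by rewrite !mulN1r ltr0_norm ?bfun_inside // opprK /signed_dist xO.
- have /negbTE xO : x \notin Omega by apply/negP => /set_mem; exact: not_mem_outside.
  exists 1; first exact: normr1.
  by rewrite !mul1r gtr0_norm ?bfun_outside // /signed_dist xO.
- by case: nb; apply/boundary_polar.
Qed.

Let b_neq0 x : N x -> ~ boundary Omega x -> b x != 0.
Proof.
move=> Nx nb; have [lt|gt|eq] := ltgtP (enorm x) (rho (dir x)).
- by rewrite lt_eqF // bfun_inside.
- by rewrite gt_eqF // bfun_outside.
- by case: nb; apply/boundary_polar.
Qed.

Let dist_gt0 x : N x -> ~ boundary Omega x -> 0 < dist x.
Proof.
move=> Nx nb; have [L L0 /(_ x Nx (fun _ => lexx _)) H] := bfun_le_dist (enorm x).
have b0 : 0 < `|b x| by rewrite normr_gt0 b_neq0.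
by have := lt_le_trans b0 H; rewrite pmulr_rgt0.
Qed.

Let ratio1 x : N x -> ~ boundary Omega x -> b x / signed_dist K Omega x = `|b x| / dist x.
Proof.
move=> Nx nb; have [e e1 [E1 E2]] := signs Nx nb; rewrite [in LHS]E1 E2.
have e0 : e != 0 by rewrite -normr_eq0 e1 oner_eq0.
by rewrite invfM mulrACA mulfV // mul1r.
Qed.

Let ratio2 x : N x -> ~ boundary Omega x -> signed_dist K Omega x / b x = dist x / `|b x|.
Proof.
move=> Nx nb; have [e e1 [E1 E2]] := signs Nx nb; rewrite [in LHS]E1 E2.
have e0 : e != 0 by rewrite -normr_eq0 e1 oner_eq0.
by rewrite invfM mulrACA mulfV // mul1r.
Qed.

Lemma bfun_regularized_distance (D : set 'rV[R]_n.+1) r0 : D `<=` N -> D `<=` in_ball K r0 ->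
  regularized_distance_on K D Omega b.
Proof.
move=> DN Dr; split.
- by apply: Ck_sub (Ck_bfun hK rho_smooth rho_range 2) => x [_ /= /eqP].
- have [L L0 HL] := bfun_lipschitz hK rho_smooth rho_range r0.
  by exists L => x y Dx Dy; apply: HL; [exact: DN|exact: DN|exact: Dr|exact: Dr].
- move=> x [Nx nb]; rewrite ratio1 // ratio2 //.
  by split; rewrite divr_gt0 ?dist_gt0 // normr_gt0 b_neq0.
- have [L L0 HL] := bfun_le_dist r0; exists L => x [Dx nb].
  have Nx := DN x Dx; rewrite ratio1 // ler_pdivrMr ?dist_gt0 //.
  by apply: HL => //; exact: Dr.
- have [A A0 HA] := gap_le_bfun; exists A => x [Nx nb].
  rewrite ratio2 // ler_pdivrMr ?normr_gt0 ?b_neq0 //.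
  exact: le_trans (dist_le Nx) (HA x Nx).
Qed.

End StarShaped.

Theorem theorem1p2 (R : realType) (K : int) (p : nat)
    (hK : K = -1 \/ K = 0 \/ K = 1)
    (Omega : set 'rV[R]_p.+2) (rho : 'rV[R]_p.+2 -> R)
    (hOmega : starshaped_domain K Omega rho) :
  (K <> -1 -> regularized_distance K Omega (bfun K rho)) /\
  (K = -1 -> forall r0 : R,
     regularized_distance_on K [set x | enorm x <= r0] Omega (bfun K rho)) /\
  (forall (z : 'rV[R]_p.+2) (E : 'M[R]_(p.+1, p.+2)),
     usphere z -> adapted rho z E ->
     (forall r : R, 0 < r -> in_radius K r ->
        hessian_in_frame K z E (bfun K rho) r =
        block_mx (tangential_block K rho z E r) 0 0 0
        - (K%:~R * bfun K rho (r *: z))%:M) /\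
     (a_mx K rho z E)^T = a_mx K rho z E /\
     (forall kappa : 'I_p.+1 -> R,
        eigenvalues_are (a_mx K rho z E) kappa <->
        principal_curvatures_are K rho z E kappa)).
Proof.
have rho_smooth : smooth_on_sphere rho by case: hOmega.
have rho_range z : usphere z -> 0 < rho z /\ in_radius K (rho z).
  by case: hOmega => _ _ _ + _; apply.
split; [move=> K1|split=> [K1 r0|z E z1 adE]].
(* The condition of being in a ball is void for K <> -1, so any radius will do. *)
- by apply: (bfun_regularized_distance hK hOmega (r0 := 0)) => // x _ /K1.
- apply: (bfun_regularized_distance hK hOmega (r0 := r0)) => [x _ K2|x xr _].
    by move: K2; rewrite K1.
  exact: xr.
- split; first by move=> r r0 rK; exact: hessian_in_frameE.
  split; first exact: (a_mx_sym hK rho_smooth rho_range z1 adE).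
  by move=> kappa; exact: principal_curvaturesP.
Qed.
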